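(* Let $1\leq p_0<q_0\leq\infty$, let $T\in S(p_0,q_0)$ be linear, and let $w\in A_1$. Then there is a constant $c=c(T,p_0,q_0,\nu,n)>0$ such that $$\left\|\frac{T^\ast f}{w^{\frac{1}{q_0'}}}\right\|_{L^{q_0',\infty}(w)}\leq c\left([w]_{A_\infty}\log(e+[w]_{A_1})\right)^{\frac{1}{q_0'}}\|f\|_{L^{q_0'}}$$ for all $f\in L^{q_0'}$.
   Context: Setting: $\mathbf{R}^n$ carries a Borel measure $\mu$ with $0<\mu(B)<\infty$ for all balls $B$ and satisfying the doubling property $\mu(2B)\leq C\mu(B)$ for all balls $B$ ($2B$ is the ball with the same center and twice the radius). For the smallest such $C$, put $\nu:=\log_2 C$ (the doubling dimension). Write $|E|:=\mu(E)$, $L^p=L^p(\mu)$, $\langle f,g\rangle:=\int fg\,\mathrm{d}\mu$, and, for measurable $E$ with $0<|E|<\infty$, $\langle f\rangle_{p,E}:=\left(\frac{1}{|E|}\int_E|f|^p\,\mathrm{d}\mu\right)^{1/p}$ for $0<p<\infty$, $\langle f\rangle_{\infty,E}:=\operatorname{ess\,sup}_E|f|$. For $p\in[1,\infty]$, $p'=p/(p-1)$ (so $1'=\infty$, $\infty'=1$). Dyadic grids: for $\alpha\in\{0,\frac13,\frac23\}^n$, $\mathscr{D}^\alpha:=\bigcup_{k\in\mathbf{Z}}\{2^{-k}([0,1)^n+m+(-1)^k\alpha):m\in\mathbf{Z}^n\}$, and $\mathscr{D}:=\bigcup_\alpha\mathscr{D}^\alpha$. A collection $\mathscr{S}\subseteq\mathscr{D}$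 is $\eta$-sparse ($0<\eta\leq1$) if for each $\alpha$ there is a pairwise disjoint collection $(E_Q)_{Q\in\mathscr{S}\cap\mathscr{D}^\alpha}$ of measurable sets with $E_Q\subseteq Q$ and $|Q|\leq\eta^{-1}|E_Q|$. Weights: a weight is a measurable $w:\mathbf{R}^n\to(0,\infty)$, identified with the measure $w(E)=\int_E w\,\mathrm{d}\mu$; $L^p(w)$ and $L^{p,\infty}(w)$ are the Lebesgue and weak Lebesgue spaces for this measure. $w\in A_1$ means $[w]_{A_1}:=\sup_{Q\in\mathscr{D}}\langle w\rangle_{1,Q}(\operatorname{ess\,inf}_Q w)^{-1}<\infty$. $w\in A_\infty$ means $[w]_{A_\infty}:=\sup_B\frac{1}{w(B)}\int_B M^{\mathscr{B}}(w\chi_B)\,\mathrm{d}\mu<\infty$, the supremum over all balls $B$, where $M^{\mathscr{B}}f(x)=\sup_{B\ni x}\langle f\rangle_{1,B}$ is the uncentered maximal operator over balls. Sparsely dominated operators: let $\mathcal{D}$ be a space of test functions on $\mathbf{R}^n$ dense in $L^p(w)$ for all $1\leq p<\infty$ and all $w\in A_\infty$ (e.g. $C_c^\infty(\mathbf{R}^n)$). For $1\leq p_0<q_0\leq\infty$, $T\in S(p_0,q_0)$ means that $T$ is a (sub)linear operator, initially defined on $\mathcal{D}$, for which there are constants $c>0$ and $0<\eta\leq1$ such that for each pair $f,g\in\mathcal{D}$ there is an $\eta$-sparse collection $\mathscr{S}\subseteq\mathscr{D}$ with $|\langle Tf,g\rangle|\leq c\sum_{Q\in\mathscr{S}}\langle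 f\rangle_{p_0,Q}\langle g\rangle_{q_0',Q}|Q|$. A constant depending on $T$ means it depends on the constants $c,\eta$ in this domination property. For linear $T$, $T^\ast$ denotes the dual operator of $T$, i.e. $\langle Tf,g\rangle=\langle f,T^\ast g\rangle$; one has $T\in S(p_0,q_0)$ if and only if $T^\ast\in S(q_0',p_0')$. *)

(* Defs.v *)
From HB Require Import structures.
From mathcomp Require Import all_boot all_order all_algebra.
From mathcomp Require Import all_classical all_reals all_analysis.
Import numFieldNormedType.Exports.

Set Implicit Arguments.
Unset Strict Implicit.
Unset Printing Implicit Defensive.
Import Order.TTheory GRing.Theory Num.Theory.

Local Open Scope classical_set_scope.
Local Open Scope ring_scope.

(* R^n with its Borel sigma-algebra, i.e. the one generated by the open sets. *)
Definition euclidean (R : realType) (n : nat) :=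
  g_sigma_algebraType [set U : set 'rV[R]_n | open U].
HB.instance Definition _ (R : realType) (n : nat) :=
  Measurable.on (euclidean R n).

Section Geometry.
Context {R : realType} {n : nat}.
Implicit Types (x y : 'rV[R]_n) (k : int).

(* The library's norm on row vectors is the sup norm, so the open Euclidean
   balls have to be introduced by hand. *)
Definition eball x (r : R) : set (euclidean R n) :=
  [set y : 'rV[R]_n | Num.sqrt (\sum_(i < n) (y 0 i - x 0 i) ^+ 2) < r].

Definition balls : set (set (euclidean R n)) :=
  [set B | exists x (r : R), 0 < r /\ B = eball x r].

Definition unit_cube : set 'rV[R]_n := [set u | forall i, 0 <= u 0 i < 1].

Definition dyadic_shifts : set 'rV[R]_n :=
  [set alpha | forall i, alpha 0 i \in [:: 0; 1 / 3; 2 / 3]].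

Definition dyadic_cube (alpha : 'rV[R]_n) k (m : 'rV[int]_n) :
    set (euclidean R n) :=
  [set 2 ^ (- k) *: (u + map_mx intr m + (-1) ^ k *: alpha)
     | u in unit_cube].

Definition dyadic_grid (alpha : 'rV[R]_n) : set (set (euclidean R n)) :=
  [set Q | exists k m, Q = dyadic_cube alpha k m].

Definition dyadic : set (set (euclidean R n)) :=
  \bigcup_(alpha in dyadic_shifts) dyadic_grid alpha.

End Geometry.

Section Spaces.
Context {R : realType} {n : nat}.
Local Notation Rn := (euclidean R n).
Variable mu : {measure set Rn -> \bar R}.
Implicit Types (f g w : Rn -> R) (Q E B : set Rn) (p q : \bar R).
Implicit Types (T : (Rn -> R) -> (Rn -> R)) (V D : set (Rn -> R)).
Local Open Scope ereal_scope.

Definition doubling_with (C : R) : Prop :=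
  forall (x : 'rV[R]_n) (r : R), (0 < r)%R ->
    mu (eball x (2 * r)) <= C%:E * mu (eball x r).

Definition doubling_measure : Prop :=
  (forall B, balls B -> 0 < mu B < +oo) /\ exists C, doubling_with C.

(* log_2 of the smallest doubling constant *)
Definition doubling_dim : R :=
  (ln (inf [set C | doubling_with C]) / ln 2)%R.

Definition pairing f g : \bar R := \int[mu]_x (f x * g x)%:E.

Definition ess_sup_on E (h : Rn -> \bar R) : \bar R :=
  ereal_inf [set y | {ae mu, forall x, E x -> h x <= y}].

Definition ess_inf_on E (h : Rn -> \bar R) : \bar R :=
  ereal_sup [set y | {ae mu, forall x, E x -> y <= h x}].

(* <f>_{p,E}, for 0 < p <= +oo *)
Definition average p E f : \bar R :=
  if p is r%:E then
    ((mu E)^-1 * \int[mu]_(x in E) (`|f x| `^ r)%:E) `^ r^-1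
  else ess_sup_on E (fun x => `|f x|%:E).

Definition sparse (eta : R) (S : set (set Rn)) : Prop :=
  S `<=` dyadic /\
  forall alpha, dyadic_shifts alpha ->
    exists E : set Rn -> set Rn,
      trivIset (S `&` dyadic_grid alpha) E /\
      forall Q, (S `&` dyadic_grid alpha) Q ->
        [/\ measurable (E Q), E Q `<=` Q & mu Q <= (eta^-1)%:E * mu (E Q)].

Definition weight w : Prop :=
  measurable_fun setT w /\ forall x, (0 < w x)%R.

Definition weighted w E : \bar R := \int[mu]_(x in E) (w x)%:E.

Definition A1_const w : \bar R :=
  ereal_sup [set average 1 Q w * (ess_inf_on Q (EFin \o w))^-1
            | Q in dyadic].

Definition A1 w : Prop := weight w /\ A1_const w < +oo.

Definition maximal f (x : Rn) : \bar R :=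
  ereal_sup [set average 1 B f | B in [set B | balls B /\ B x]].

Definition Ainfty_const w : \bar R :=
  ereal_sup [set (weighted w B)^-1 * \int[mu]_(x in B) maximal (w \_ B) x
            | B in balls].

(* Local integrability is required explicitly: a ball with w(B) = +oo would
   contribute +oo^-1 * +oo = 0 to the supremum. *)
Definition Ainfty w : Prop :=
  [/\ weight w, forall B, balls B -> weighted w B < +oo
    & Ainfty_const w < +oo].

(* Integration against the measure E |-> w(E) is integration of the product
   with w against mu. *)
Definition weighted_Lnorm w (p : R) f : \bar R :=
  (\int[mu]_x (`|f x| `^ p * w x)%:E) `^ p^-1.

Definition weighted_Lfun w (p : R) : set (Rn -> R) :=
  [set f | measurable_fun setT f /\ weighted_Lnorm w p f < +oo].

Definition weighted_weak_Lnorm w (p : R) f : \bar R :=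
  ereal_sup [set lambda%:E *
                 weighted w [set x | (lambda < `|f x|)%R] `^ p^-1
            | lambda in [set lambda : R | (0 < lambda)%R]].

Definition test_space D : Prop :=
  [/\ D (fun=> 0%R),
      forall (a : R) f g, D f -> D g -> D (fun x => a * f x + g x)%R
    & forall (p : R) w, (1 <= p)%R -> Ainfty w ->
        D `<=` weighted_Lfun w p /\
        forall f, weighted_Lfun w p f -> forall e : R, (0 < e)%R ->
          exists2 g, D g & weighted_Lnorm w p (fun x => f x - g x)%R < e%:E].

(* Linearity is up to mu-null sets. *)
Definition linear_on V T : Prop :=
  (forall f, V f -> measurable_fun setT (T f)) /\
  forall (a : R) f g, V f -> V g ->
    T (fun x => a * f x + g x)%R = (fun x => a * T f x + T g x)%R %[ae mu].

(* T is in S(p0, q0), with constants c and eta; the first conjunct says that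
   the pairing of T f and g makes sense. *)
Definition sparse_dominated D p0 q0 T (c eta : R) : Prop :=
  forall f g, D f -> D g ->
    mu.-integrable setT (fun x => (T f x * g x)%:E) /\
    exists S : set (set Rn), sparse eta S /\
      `|pairing (T f) g| <=
        c%:E * \esum_(Q in S)
          (average p0 Q f * average (hoelder_conjugate q0) Q g * mu Q).

(* An operator in S(p0, q0) is bounded on L^p for p0 < p < q0, and T' is its
   dual, acting on the dual space L^p'. That T' takes its values there has to
   be part of the definition: D is only assumed to be dense in Lebesgue spaces,
   so that D may be annihilated by a nonzero measurable function lying outside
   of all of them, and the pairing alone need not determine T'. *)
Definition dual_operator D p0 q0 T T' : Prop :=
  exists p : \bar R, p0 < p < q0 /\
    forall g, D g ->
      T' g \in Lfun mu (hoelder_conjugate p) /\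
      forall f, D f -> pairing (T f) g = pairing f (T' g).

Definition extends_to D V T T' : Prop :=
  linear_on V T' /\ forall f, D f -> T' f = T f %[ae mu].

End Spaces.

(* Main.v *)
Require Import Defs.
From HB Require Import structures.
From mathcomp Require Import all_boot all_order all_algebra.
From mathcomp Require Import all_classical all_reals all_analysis.
From mathcomp Require Import measurable_realfun ring lra.
Import numFieldNormedType.Exports.
Import Order.TTheory GRing.Theory Num.Theory.

(** Write [q] for the conjugate exponent of [q0], [s0 = 1/q0] (so that
    [1/q = 1 - s0]), [u] for the dual operator applied to a test function [g],
    and, for [lambda > 0], [E] for the set where [lambda w^(1-s0) < |u|] and
    [h = (|g|/lambda)^q].  On test functions the theorem amounts to
    [w(E) <= c A log(e + A1) \int h], where [A] and [A1] are the A_infinity and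
    A_1 constants of [w]; constants depending on the other data are dropped
    below.

    Exceptional set.  To a dyadic cube [Q] attach a ball [dilate Q] that
    contains it and is of comparable size.  Cubes with
    [w(dilate Q) < \int_Q h] are bad.  The maximal bad cubes of one grid are
    disjoint, so that the bad cubes cover a set of [w]-measure at most
    [3^n \int h] ([weighted_bad_sets]), which may be removed from [E].  Every
    dyadic cube that still meets [E] is good.

    Duality.  Pairing [u] with [phi = sgn(u) w^s0 1_E] gives at least
    [lambda w(E)].  The sparse bound of the operator extends from test functions
    to [phi] by density ([dual_bound]), and it leaves the sum over good sparse
    cubes of [<phi>_{p0,Q} <h>_Q^(1-s0) |Q|], up to the factor [lambda].

    Levels.  Group the good cubes by the integer part [k >= 0] of
    [log (w(dilate Q) / \int_Q h)].  The A_infinity condition says that the sum of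
    [w(dilate Q)] over the sparse cubes inside [P] is at most a multiple of
    [A w(dilate P)] ([Ainfty_packing]).  Inside one level [w(dilate Q)] and
    [\int_Q h] are proportional up to a factor [e], so the packing passes to
    [\int_Q h]: the sum over a level is at most [A \int h], whatever [k] is
    ([sum_level]).  For the first [k0] levels, with [k0] of the order of
    [log(e + A1)], Hoelder's inequality and the Carleson embedding theorem give
    [w(E)^s0 (k0 A \int h)^(1-s0)].  At a higher level the A_1 condition gives
    [<h>_Q <= A1 e^(-k) i], with [i] a lower bound of [w] on [Q].  A small power
    [eps] of this inequality is used: the factor [i^eps] is merged with [phi],
    which raises the power of [w] in it from [s0] to [s1 = s0 + eps], still less
    than [1/p0]; the factor [(A1 e^(-k))^eps] is summable in [k] and is bounded
    by one at [k0].  These levels contribute [w(E)^s1 (A \int h)^(1-s1)]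
    ([level_split_bound], [form_bound]).

    Conclusion on test functions.  With [V = w(E)] and [Y = k0 A \int h] one has
    [V <= M (V^s0 Y^(1-s0) + V^s1 Y^(1-s1))], which forces [V <= c Y]
    ([absorb]): this is [weak_bound].

    Extension.  For [w = 1] the weak bound makes the dual operator continuous from
    L^q to convergence in measure: along a fast sequence of test functions tending
    to [f], the images converge almost everywhere (Borel-Cantelli), and the limit
    depends on [f] alone, up to null sets.  By Fatou's lemma the limit inherits
    every weighted weak bound.  If [A] is infinite the inequality is void, except
    for [f = 0] almost everywhere, and then the image vanishes as well. *)

Set Implicit Arguments.
Unset Strict Implicit.
Unset Printing Implicit Defensive.

Local Open Scope classical_set_scope.
Local Open Scope ring_scope.

(** * Laminar families and sparse trees *)

Section FiniteFamilies.
Context {X : Type}.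
Implicit Types (s t : seq (set X)) (P Q : set X).

Definition laminar s := forall P Q, P \in s -> Q \in s ->
  [\/ P `<=` Q, Q `<=` P | P `&` Q = set0].

Definition maxima s := [seq P <- s | all (fun Q => `[< P `<=` Q >] ==> (Q == P)) s].

Lemma count_lt (I : eqType) (a b : pred I) (r : seq I) (i : I) :
  (forall j, a j -> b j) -> i \in r -> b i -> ~~ a i ->
  (count a r < count b r)%N.
Proof.
move=> ab + bi ai; elim: r => //= j r IH; rewrite inE => /predU1P[<-|/IH lt].
  by rewrite bi (negbTE ai) add0n add1n ltnS sub_count.
by rewrite -addnS leq_add//; case: (boolP (a j)) => // /ab ->.
Qed.

Lemma maxima_cover s Q : Q \in s -> exists2 P, P \in maxima s & Q `<=` P.
Proof.
have [m] := ubnP (count (fun P => `[< Q `<=` P >]) s).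
elim: m Q => // m IH Q; rewrite ltnS => leQ Qs.
case: (boolP (all (fun P => `[< Q `<=` P >] ==> (P == Q)) s)) => [maxQ|].
  by exists Q => //; rewrite mem_filter maxQ.
case/allPn => P Ps; rewrite negb_imply => /andP[/asboolP QP PQ].
have [||P' P's PP'] := IH P; [|by []|].
  apply: leq_trans leQ; apply: (count_lt (i := Q)) => //.
  - by move=> j /asboolP Pj; apply/asboolP; apply: subset_trans Pj.
  - by apply/asboolP.
  - by apply: contra PQ => /asboolP PQ'; apply/eqP/seteqP.
by exists P' => //; exact: subset_trans PP'.
Qed.

Lemma maxima_sub s P : P \in maxima s -> P \in s.
Proof. by rewrite mem_filter => /andP[]. Qed.

(** Two overlapping members of a laminar family are nested, so neither of two
    distinct maximal ones can meet the other. *)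
Lemma maxima_trivIset s : laminar s -> trivIset [set` maxima s] id.
Proof.
move=> ls P Q /= Pm Qm /set0P PQ.
have := ls P Q (maxima_sub Pm) (maxima_sub Qm).
move: Pm Qm; rewrite !mem_filter => /andP[/allP Pm Ps] /andP[/allP Qm Qs].
case=> [PsQ|QsP|PQ0]; last by rewrite PQ0 eqxx in PQ.
- by move: (Pm Q Qs); rewrite asboolT//= => /eqP.
- by move: (Qm P Ps); rewrite asboolT//= => /eqP.
Qed.

(** Each member lies below some maximal one, hence is counted at least once on
    the right. *)
Lemma sum_le_maxima (R : numDomainType) s (a : set X -> R) : (forall Q, 0 <= a Q) ->
  \sum_(Q <- s) a Q <=
  \sum_(P <- maxima s) \sum_(Q <- s | `[< Q `<=` P >]) a Q.
Proof.
move=> a0; rewrite (exchange_big_dep xpredT)//= !big_seq ler_sum// => Q Qs.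
have [P Pm QP] := maxima_cover Qs.
rewrite (big_rem P)//= asboolT// lerDl; exact: sumr_ge0.
Qed.

End FiniteFamilies.

(** An upper bound of the labels on a finite family gives the number of
    levels. *)
Lemma sum_levels (R : nmodType) (I : eqType) (s : seq I) (F : I -> R)
    (k : I -> nat) : exists K : nat,
  \sum_(i <- s) F i = \sum_(j < K) \sum_(i <- s | k i == j) F i.
Proof.
exists (\max_(i <- s) k i).+1.
rewrite (exchange_big_dep xpredT)//= big_seq [RHS]big_seq.
apply: eq_bigr => i si.
have lt_i : (k i < (\max_(i <- s) k i).+1)%N by rewrite ltnS leq_bigmax_seq.
rewrite (eq_bigl (fun j => j == Ordinal lt_i)) ?big_pred1_eq// => j.
by rewrite -val_eqE/= eq_sym.
Qed.

Section RealLemmas.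
Context {R : realType}.
Implicit Types (x y b c : R).

Lemma truncn_ln y (k := Num.truncn (ln y)) : 1 <= y ->
  expR 1 ^+ k <= y < expR 1 ^+ k.+1.
Proof.
move=> y1; have y0 : 0 < y by rewrite (lt_le_trans _ y1).
rewrite -!expRM_natl !mulr1 -{1 2}(lnK y0) ler_expR ltr_expR.
by apply: truncn_itv; rewrite ln_ge0.
Qed.

(** The terms below [y] are dominated by the last one among them, up to the
    ratio of the geometric series. *)
Lemma geometric_below (K : nat) c rho y : 0 <= c -> 1 < rho -> 0 <= y ->
  \sum_(k < K | c * rho ^+ k < y) c * rho ^+ k <= rho / (rho - 1) * y.
Proof.
move=> c0 rho1 y0; have r0 : 0 < rho - 1 by rewrite subr_gt0.
have ratio0 : 0 <= rho / (rho - 1) by rewrite divr_ge0// ltW// (lt_trans _ rho1).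
elim: K => [|K IH]; first by rewrite big_ord0 mulr_ge0.
rewrite big_mkcond big_ord_recr/= -big_mkcond/=; case: ifPn => [lt_y|_]; last by rewrite addr0.
apply: (@le_trans _ _ (rho / (rho - 1) * (c * rho ^+ K))); last by rewrite ler_wpM2l// ltW.
apply: (@le_trans _ _ (\sum_(k < K.+1) c * rho ^+ k)).
  rewrite big_ord_recr/= lerD2r big_mkcond ler_sum// => i _.
  by case: ifP => // _; rewrite mulr_ge0// exprn_ge0// ltW// (lt_trans _ rho1).
rewrite -mulr_sumr mulrCA ler_wpM2l// mulrAC -exprS ler_pdivlMr//.
by rewrite mulrC -subrX1 gerBl.
Qed.

(** Gives the scale from which positive averages over a finite family are
    measured by nonnegative integers. *)
Lemma exists_lower_bound (I : eqType) (s : seq I) (x : I -> R) :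
  exists2 b : R, 0 < b & {in s, forall i, 0 < x i -> b <= x i}.
Proof.
elim: s => [|i s [b b0 IH]]; first by exists 1.
exists (if 0 < x i then Num.min b (x i) else b).
  by case: ifP => // xi; rewrite lt_min b0.
move=> j; rewrite inE => /predU1P[-> xi|js xj].
  by rewrite xi ge_min lexx orbT.
by case: ifP => _; rewrite ?ge_min IH.
Qed.

End RealLemmas.

Section MeasureFamilies.
Context d (X : measurableType d) (R : realType) (mu : {measure set X -> \bar R}).
Implicit Types (s : seq (set X)) (P Q : set X) (eta r : R).
Local Open Scope ereal_scope.

Lemma sum_integral_trivIset (I : eqType) (s : seq I) (E : I -> set X) (D : set X)
    (phi : X -> \bar R) :
  uniq s -> trivIset [set` s] E -> measurable D ->
  (forall i, i \in s -> measurable (E i) /\ E i `<=` D) ->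
  measurable_fun D phi -> (forall x, D x -> 0 <= phi x) ->
  \sum_(i <- s) \int[mu]_(x in E i) phi x <= \int[mu]_(x in D) phi x.
Proof.
move=> us tE mD ED mphi phi0.
pose F i := if i \in s then E i else set0.
have FD i : F i `<=` D by rewrite /F; case: ifPn => [/ED[]//|_]; exact: sub0set.
have mF i : measurable (F i) by rewrite /F; case: ifPn => [/ED[]//|_].
have UD : \big[setU/set0]_(i <- s) F i `<=` D.
  by apply: (big_ind (fun A => A `<=` D)) => // A B AD BD x [/AD|/BD].
rewrite (_ : \sum_(i <- s) _ = \sum_(i <- s) \int[mu]_(x in F i) phi x); last first.
  by rewrite !big_seq; apply: eq_bigr => i si; rewrite /F si.
rewrite -ge0_integral_bigsetU//.
- apply: ge0_subset_integral => //; exact: bigsetU_measurable.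
- move=> i j /= si sj; rewrite /F si sj; exact: tE.
- exact: measurable_funS mphi.
- by move=> x /UD; exact: phi0.
Qed.

(** The part of a sparse collection that lies in one grid, cut down to a
    finite family: this is all that the estimates see of dyadic cubes. *)
Definition sparse_tree eta s := [/\ uniq s, laminar s,
  forall Q, Q \in s -> measurable Q /\ 0 < mu Q < +oo &
  exists E : set X -> set X, trivIset [set` s] E /\ forall Q, Q \in s ->
    [/\ measurable (E Q), E Q `<=` Q & mu Q <= (eta^-1)%:E * mu (E Q)]].

Lemma sparse_tree_filter eta s (p : pred (set X)) :
  sparse_tree eta s -> sparse_tree eta [seq Q <- s | p Q].
Proof.
have sub Q : Q \in [seq Q <- s | p Q] -> Q \in s.
  by rewrite mem_filter => /andP[].
move=> [us ls ms [E [tE EQ]]]; split.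
- by rewrite filter_uniq.
- by move=> P Q /sub + /sub; exact: ls.
- by move=> Q /sub; exact: ms.
- exists E; split; last by move=> Q /sub; exact: EQ.
  by apply: sub_trivIset tE => Q /= /sub.
Qed.

Local Notation m Q := (fine (mu Q)).

Lemma mass_fin s eta Q : sparse_tree eta s -> Q \in s -> mu Q = (m Q)%:E.
Proof.
move=> [_ _ ms _] /ms[_ /andP[Q0 Qy]]; rewrite fineK//.
by rewrite fin_numElt Qy andbT (lt_trans _ Q0)// ltNyr.
Qed.

Lemma mass_gt0 s eta Q : sparse_tree eta s -> Q \in s -> (0 < m Q)%R.
Proof. by move=> [_ _ ms _] /ms[_ ?]; exact: fine_gt0. Qed.

(** Below a maximal member the disjoint sets [E Q] fill at most the mass of
    that member. *)
Lemma sparse_packing eta s : (0 < eta)%R ->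
  sparse_tree eta s ->
  (\sum_(Q <- s) m Q <= eta^-1 * \sum_(P <- maxima s) m P)%R.
Proof.
move=> eta0 st; have [us _ ms [E [tE EQ]]] := st.
apply: le_trans (sum_le_maxima _ _) _; first by move=> Q; exact: fine_ge0.
rewrite mulr_sumr big_seq [leRHS]big_seq; apply: ler_sum => P /maxima_sub Ps.
rewrite -lee_fin EFinM -(mass_fin st Ps) -sumEFin -big_filter.
have [mP _] := ms _ Ps.
have inP Q : Q \in [seq Q <- s | `[< Q `<=` P >]] -> Q \in s /\ Q `<=` P.
  by rewrite mem_filter => /andP[/asboolP].
apply: (@le_trans _ _ (\sum_(Q <- [seq Q <- s | `[< Q `<=` P >]])
    (eta^-1)%:E * mu (E Q))).
  rewrite big_seq [leRHS]big_seq lee_sum// => Q /inP[Qs _].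
  by rewrite -(mass_fin st Qs); have [] := EQ _ Qs.
rewrite -ge0_sume_distrr//.
apply: lee_wpmul2l; first by rewrite lee_fin invr_ge0 ltW.
have mE Q : Q \in [seq Q <- s | `[< Q `<=` P >]] ->
    measurable (E Q) /\ E Q `<=` P.
  by move=> /inP[Qs QP]; have [mEQ EQQ _] := EQ _ Qs; split=> // x /EQQ /QP.
have -> : \sum_(Q <- [seq Q <- s | `[< Q `<=` P >]]) mu (E Q) =
    \sum_(Q <- [seq Q <- s | `[< Q `<=` P >]]) \int[mu]_(x in E Q) cst 1 x.
  rewrite big_seq [RHS]big_seq; apply: eq_bigr => Q /mE[mEQ _].
  by rewrite integral_cst// mul1e.
apply: le_trans (sum_integral_trivIset _ _ mP mE _ _) _ => //.
- by rewrite filter_uniq.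
- by apply: sub_trivIset tE => Q /= /inP[].
- by rewrite integral_cst// mul1e.
Qed.

Definition carleson_cst (eta r : R) : R :=
  ((2 * expR 1) `^ r * eta^-1 * (expR 1 `^ (r - 1) / (expR 1 `^ (r - 1) - 1)))%R.

Lemma carleson_cst_ge0 eta r : (0 < eta)%R -> (1 < r)%R -> (0 <= carleson_cst eta r)%R.
Proof.
move=> eta0 r1; have rho : (0 < expR 1 `^ (r - 1) - 1 :> R)%R.
  by rewrite subr_gt0 /powR gt_eqF ?expR_gt0// expRK mulr1 expR_gt1 subr_gt0.
rewrite /carleson_cst mulr_ge0//; last by rewrite divr_ge0 ?powR_ge0// ltW.
by rewrite mulr_ge0 ?powR_ge0// invr_ge0 ltW.
Qed.

(** Cutting [G] off at height [c] removes at most half of an average that is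
    at least [2 c]; what remains is summed over the disjoint maximal members,
    whose total mass controls the whole family by sparseness. *)
Lemma carleson_level eta s (G : X -> R) (c : R) : (0 < eta)%R -> (0 < c)%R ->
  sparse_tree eta s -> measurable_fun setT G -> (forall x, (0 <= G x)%R) ->
  {in s, forall Q, \int[mu]_(x in Q) (G x)%:E \is a fin_num /\
                   (2 * c <= fine (\int[mu]_(x in Q) (G x)%:E) / m Q)%R} ->
  (\sum_(Q <- s) m Q)%:E <=
    (eta^-1 / c)%:E * \int[mu]_x (if (c < G x)%R then G x else 0%R)%:E.
Proof.
move=> eta0 c0 st mG G0 avg.
pose phi x := (if (c < G x)%R then G x else 0%R)%:E.
have phi0 x : 0 <= phi x by rewrite /phi; case: ifP; rewrite lee_fin.
have mphi : measurable_fun setT phi.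
  apply/measurable_EFinP; apply: measurable_fun_ifT => //.
  exact: measurable_fun_ltr.
have mass Q : Q \in s -> (c * m Q)%:E <= \int[mu]_(x in Q) phi x.
  move=> Qs; have [Gfin avgQ] := avg _ Qs; have m0 := mass_gt0 st Qs.
  have [_ _ ms _] := st; have [mQ _] := ms _ Qs.
  move: avgQ; rewrite ler_pdivlMr// => avgQ.
  have : \int[mu]_(x in Q) (G x)%:E <= \int[mu]_(x in Q) phi x + (c * m Q)%:E.
    have -> : (c * m Q)%:E = \int[mu]_(x in Q) cst c%:E x.
      by rewrite integral_cst// EFinM -(mass_fin st Qs).
    rewrite -ge0_integralD//; last 2 first.
    - exact: measurable_funS mphi.
    - by move=> x _; rewrite lee_fin ltW.
    apply: ge0_le_integral => //.
    - by move=> x _; rewrite lee_fin.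
    - by apply/measurable_EFinP; exact: measurable_funTS.
    - by apply: emeasurable_funD => //; exact: measurable_funTS.
    - move=> x _; rewrite /phi /cst -EFinD lee_fin; case: ltP => //.
      + by rewrite lerDl ltW.
      + by rewrite add0r.
  rewrite -leeBlDr// -(fineK Gfin) -EFinB; apply: le_trans.
  by rewrite lee_fin; lra.
have : (\sum_(P <- maxima s) c * m P)%:E <= \int[mu]_x phi x.
  rewrite -sumEFin; apply: (@le_trans _ _ (\sum_(P <- maxima s) \int[mu]_(x in P) phi x)).
    by rewrite big_seq [leRHS]big_seq lee_sum// => P /maxima_sub; exact: mass.
  have [us ls ms _] := st; apply: sum_integral_trivIset => //.
  - by rewrite filter_uniq.
  - exact: maxima_trivIset.
  - by move=> P /maxima_sub/ms[].
rewrite -mulr_sumr => le_phi.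
apply: (@le_trans _ _ ((eta^-1 / c)%:E * (c * \sum_(P <- maxima s) m P)%:E)); last first.
  by apply: lee_wpmul2l => //; rewrite lee_fin divr_ge0 ?invr_ge0 ?ltW.
rewrite -EFinM lee_fin mulrA mulfVK ?gt_eqF//; exact: sparse_packing.
Qed.

End MeasureFamilies.

(** * The Carleson embedding theorem *)

Lemma measurable_powRr d (X : measurableType d) (R : realType) (D : set X)
    (f : X -> R) (r : R) :
  measurable_fun D f -> measurable_fun D (fun x => f x `^ r).
Proof. exact: (@measurableT_comp _ _ _ _ _ _ (@powR R ^~ r)). Qed.

Section CarlesonEmbedding.
Context d (X : measurableType d) (R : realType) (mu : {measure set X -> \bar R}).
Implicit Types (s : seq (set X)) (P Q : set X) (eta r : R).
Local Open Scope ereal_scope.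
Local Notation m Q := (fine (mu Q)).

(** Sorting the members by the size of their averages reduces the sum to one
    use of [carleson_level] per level. At a point [y] the truncations of [G]
    that survive are those at heights below [G y], and the weights attached to
    them form a geometric sum of size [G y `^ (r - 1)]. *)
Lemma carleson_embedding eta r s (G : X -> R) : (0 < eta)%R -> (1 < r)%R ->
  sparse_tree mu eta s -> measurable_fun setT G -> (forall x, (0 <= G x)%R) ->
  (\sum_(Q <- s) (fine (\int[mu]_(x in Q) (G x)%:E) / m Q) `^ r * m Q)%:E <=
  (carleson_cst eta r)%:E * \int[mu]_x (G x `^ r)%:E.
Proof.
move=> eta0 r1 st mG G0.
pose x Q := (fine (\int[mu]_(x in Q) (G x)%:E) / m Q)%R.
have x0 Q : (0 <= x Q)%R.
  by rewrite /x divr_ge0 ?fine_ge0// integral_ge0// => y _; rewrite lee_fin.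
have [b b0 bx] := exists_lower_bound s x.
(* averages within a factor [e] share a level; dividing by [b] makes the
   logarithm nonnegative, and zero averages contribute nothing *)
pose k Q := Num.truncn (ln (x Q / b)).
pose s' := [seq Q <- s | (0 < x Q)%R].
pose F Q := (x Q `^ r * m Q)%R.
have r0 : (r != 0)%R by rewrite gt_eqF// (lt_trans _ r1).
have -> : (\sum_(Q <- s) F Q = \sum_(Q <- s') F Q)%R.
  rewrite big_filter [RHS]big_mkcond; apply: eq_bigr => Q _.
  by case: ifPn => //; rewrite lt_neqAle x0 andbT negbK => /eqP x00;
     rewrite /F -x00 powR0// mul0r.
have [K ->] := sum_levels s' F k.
(* half of the smallest average on level [j], as needed by [carleson_level] *)
pose c j : R := (b / 2 * expR 1 ^+ j)%R.
have c0 j : (0 < c j)%R by rewrite mulr_gt0 ?divr_gt0// exprn_gt0// expR_gt0.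
pose phi j y : R := if (c j < G y)%R then G y else 0%R.
have phi0 j y : (0 <= phi j y)%R by rewrite /phi; case: ifP.
have mphi j : measurable_fun setT (phi j).
  by apply: measurable_fun_ifT => //; exact: measurable_fun_ltr.
have e0 : (0 < expR 1 :> R)%R by exact: expR_gt0.
have s'P Q : Q \in s' -> Q \in s /\ (b * expR 1 ^+ k Q <= x Q < b * expR 1 ^+ (k Q).+1)%R.
  rewrite mem_filter => /andP[xQ Qs]; split => //.
  have [|k1 k2] := andP (@truncn_ln _ (x Q / b) _).
    by rewrite ler_pdivlMr// mul1r bx.
  by apply/andP; split; rewrite mulrC -?ler_pdivlMr -?ltr_pdivrMr.
have [A AE A0] : exists2 A : R, A = ((2 * expR 1) `^ r * eta^-1)%R & (0 <= A)%R.
  by exists ((2 * expR 1) `^ r * eta^-1)%R; rewrite // mulr_ge0 ?powR_ge0// invr_ge0 ltW.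
have level j : (\sum_(Q <- s' | k Q == j) F Q)%:E <=
    (A * c j `^ (r - 1))%:E * \int[mu]_y (phi j y)%:E.
  pose sj := [seq Q <- s' | k Q == j].
  have stj : sparse_tree mu eta sj by do 2 apply: sparse_tree_filter.
  have sjP Q : Q \in sj -> [/\ Q \in s', (2 * c j <= x Q)%R & (x Q <= 2 * expR 1 * c j)%R].
    rewrite mem_filter => /andP[/eqP kj /[dup] Qs' /s'P[_ /andP[]]].
    rewrite kj exprS /c => le1 le2; split => //.
      by apply: le_trans le1; rewrite mulrA mulrCA mulfV// mulr1.
    by apply: (le_trans (ltW le2)); rewrite le_eqVlt; apply/orP; left; apply/eqP; field.
  have /(carleson_level eta0 (c0 j) stj mG G0) lev : {in sj, forall Q,
     \int[mu]_(x in Q) (G x)%:E \is a fin_num /\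
     (2 * c j <= fine (\int[mu]_(x in Q) (G x)%:E) / m Q)%R}.
    move=> Q /sjP[+ le1 _]; rewrite mem_filter => /andP[xQ _]; split => //.
    rewrite ge0_fin_numE ?integral_ge0//; last by move=> y _; rewrite lee_fin.
    rewrite ltNge leye_eq; apply: contraTN xQ => /eqP inf.
    by rewrite /x inf/= mul0r ltxx.
  apply: (@le_trans _ _ ((2 * expR 1 * c j) `^ r * \sum_(Q <- sj) m Q)%:E).
    rewrite lee_fin -big_filter mulr_sumr big_seq [leRHS]big_seq ler_sum// => Q Qj.
    have [_ _ le2] := sjP _ Qj; rewrite ler_wpM2r ?fine_ge0//.
    apply: ge0_ler_powR; rewrite ?nnegrE//; first by rewrite (le_trans _ (ltW r1)).
    by apply: mulr_ge0 (ltW (c0 j)); rewrite mulr_ge0 ?(ltW e0).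
  rewrite EFinM; apply: le_trans (lee_wpmul2l _ lev) _.
    by rewrite lee_fin powR_ge0.
  rewrite muleA -EFinM le_eqVlt; apply/orP; left; apply/eqP; congr (_%:E * _).
  rewrite powRM ?(ltW (c0 j)) ?mulr_ge0 ?(ltW e0)//.
  by rewrite -(mulr_powRB1 (ltW (c0 j)) (lt_trans ltr01 r1)) AE; field; rewrite !gt_eqF.
have term0 j y : (0 <= A * c j `^ (r - 1) * phi j y)%R.
  by apply: mulr_ge0 (phi0 _ _); apply: mulr_ge0 (powR_ge0 _ _).
rewrite -sumEFin; apply: (@le_trans _ _ (\sum_(j < K)
    \int[mu]_y (A * c j `^ (r - 1) * phi j y)%:E)).
  apply: lee_sum => j _; apply: le_trans (level j) _.
  rewrite -ge0_integralZl_EFin//.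
  - by move=> y _; rewrite lee_fin.
  - exact/measurable_EFinP.
  - by rewrite mulr_ge0 ?powR_ge0.
rewrite -ge0_integral_sum//; last 2 first.
- by move=> j; apply/measurable_EFinP; apply: measurable_funM.
- by move=> j y _; rewrite lee_fin.
have rho1 : (1 < expR 1 `^ (r - 1) :> R)%R.
  by rewrite /powR gt_eqF// expRK mulr1 expR_gt1 subr_gt0.
have cst0 : (0 <= carleson_cst eta r)%R by exact: carleson_cst_ge0.
have mGr : measurable_fun setT (fun y => G y `^ r)%R.
  exact: measurable_powRr.
rewrite -ge0_integralZl_EFin//; last 2 first.
- by move=> y _; rewrite lee_fin powR_ge0.
- exact/measurable_EFinP.
apply: ge0_le_integral => //.
- by move=> y _; apply: sume_ge0 => j _; rewrite lee_fin.
- by apply: emeasurable_sum => j; apply/measurable_EFinP; apply: measurable_funM.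
- by apply/measurable_EFinP; apply: measurable_funM.
move=> y _; rewrite sumEFin lee_fin.
have [G00|Gpos] := leP (G y) 0%R.
  rewrite big1; first by apply: mulr_ge0 (powR_ge0 _ _).
  move=> j _.
  by rewrite /phi ltNge (le_trans G00 (ltW (c0 j))) mulr0.
apply: (@le_trans _ _ (A * G y * \sum_(j < K | ((b / 2) `^ (r - 1) * (expR 1 `^ (r - 1)) ^+ j
   < G y `^ (r - 1))%R) ((b / 2) `^ (r - 1) * (expR 1 `^ (r - 1)) ^+ j))%R).
  rewrite mulr_sumr [leRHS]big_mkcond ler_sum// => j _.
  have cE : (c j `^ (r - 1) = (b / 2) `^ (r - 1) * (expR 1 `^ (r - 1)) ^+ j)%R.
    rewrite /c [LHS]powRM ?divr_ge0 ?exprn_ge0 ?(ltW b0) ?(ltW e0)//; congr (_ * _)%R.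
    by rewrite -(powR_mulrn _ (ltW e0)) -(powR_mulrn _ (powR_ge0 _ _)) powRAC.
  rewrite /phi; case: (ltP (c j) (G y)) => cG; last first.
    by rewrite mulr0; case: ifP => // _; rewrite !mulr_ge0 ?powR_ge0 ?exprn_ge0 ?powR_ge0 ?(ltW Gpos)//.
  rewrite -cE ifT; last by rewrite gt0_ltr_powR ?nnegrE ?subr_gt0 ?(ltW Gpos) ?(ltW (c0 j)).
  by rewrite mulrAC.
have := geometric_below K (powR_ge0 (b / 2) (r - 1)) rho1 (powR_ge0 (G y) (r - 1)).
move=> /(ler_wpM2l (mulr_ge0 A0 (ltW Gpos))) /le_trans; apply.
rewrite -(mulr_powRB1 (ltW Gpos) (lt_trans ltr01 r1)) /carleson_cst -AE.
by rewrite le_eqVlt; apply/orP; left; apply/eqP; ring.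
Qed.

End CarlesonEmbedding.

(** * Euclidean balls *)

Section Geometry.
Context {R : realType} {n : nat}.
Implicit Types (x y z : 'rV[R]_n) (k : int) (m : 'rV[int]_n) (r : R).
Local Notation Rn := (euclidean R n).

Definition edist x y : R := Num.sqrt (\sum_(i < n) (y 0 i - x 0 i) ^+ 2).

Lemma cauchy_schwarz_sum (a b : 'I_n -> R) :
  \sum_i a i * b i <=
  Num.sqrt (\sum_i a i ^+ 2) * Num.sqrt (\sum_i b i ^+ 2).
Proof.
set A := Num.sqrt (\sum_i a i ^+ 2); set B := Num.sqrt (\sum_i b i ^+ 2).
have sq0 (c : 'I_n -> R) : 0 <= \sum_i c i ^+ 2 by rewrite sumr_ge0// => i _; exact: sqr_ge0.
have A2 : A ^+ 2 = \sum_i a i ^+ 2 by rewrite sqr_sqrtr.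
have B2 : B ^+ 2 = \sum_i b i ^+ 2 by rewrite sqr_sqrtr.
have zero (c : 'I_n -> R) : Num.sqrt (\sum_i c i ^+ 2) = 0 -> forall i, c i = 0.
  move=> /eqP; rewrite sqrtr_eq0 => le0 i.
  have /eqP : \sum_i c i ^+ 2 = 0 by apply/eqP; rewrite eq_le le0 sq0.
  rewrite psumr_eq0 => [|j _]; last exact: sqr_ge0.
  by move=> /allP/(_ i (mem_index_enum _))/=; rewrite sqrf_eq0 => /eqP.
have [A0|A0] := eqVneq A 0.
  by rewrite A0 mul0r big1// => i _; rewrite (zero _ A0) mul0r.
have [B0|B0] := eqVneq B 0.
  by rewrite B0 mulr0 big1// => i _; rewrite (zero _ B0) mulr0.
have Ap : 0 < A by rewrite lt_neqAle eq_sym A0 sqrtr_ge0.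
have Bp : 0 < B by rewrite lt_neqAle eq_sym B0 sqrtr_ge0.
have : \sum_i 2 * (a i * b i) <= \sum_i (a i ^+ 2 * (B / A) + b i ^+ 2 * (A / B)).
  apply: ler_sum => i _; rewrite -subr_ge0.
  have -> : a i ^+ 2 * (B / A) + b i ^+ 2 * (A / B) - 2 * (a i * b i) =
     (a i * B - b i * A) ^+ 2 / (A * B) by field; rewrite A0 B0.
  by rewrite divr_ge0 ?sqr_ge0// mulr_ge0 ?ltW.
rewrite big_split/= -!mulr_suml -A2 -B2 -mulr_sumr.
have -> : A ^+ 2 * (B / A) + B ^+ 2 * (A / B) = 2 * (A * B) by field; rewrite A0 B0.
by rewrite ler_pM2l.
Qed.

Lemma edist_triangle y x z : edist x z <= edist x y + edist y z.
Proof.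
rewrite /edist; set A := Num.sqrt (\sum_i (y 0 i - x 0 i) ^+ 2).
set B := Num.sqrt (\sum_i (z 0 i - y 0 i) ^+ 2).
have sq0 (c : 'I_n -> R) : 0 <= \sum_i c i ^+ 2 by rewrite sumr_ge0// => i _; exact: sqr_ge0.
rewrite -(@ler_pXn2r _ 2)// ?nnegrE ?addr_ge0 ?sqrtr_ge0//.
rewrite sqr_sqrtr// sqrrD !sqr_sqrtr//.
have := cauchy_schwarz_sum (fun i => y 0 i - x 0 i) (fun i => z 0 i - y 0 i).
rewrite -/A -/B => /(ler_wpM2l (ler0n R 2)) CS.
apply: (@le_trans _ _ (\sum_i (y 0 i - x 0 i) ^+ 2 +
  2 * (\sum_i (y 0 i - x 0 i) * (z 0 i - y 0 i)) + \sum_i (z 0 i - y 0 i) ^+ 2)).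
  rewrite mulr_sumr -!big_split/=; apply: ler_sum => i _.
  by rewrite le_eqVlt; apply/orP; left; apply/eqP; ring.
by rewrite lerD2r lerD2l (le_trans CS)// mulr_natl.
Qed.

Lemma le_coord_edist x y i : `|y 0 i - x 0 i| <= edist x y.
Proof.
rewrite -sqrtr_sqr ler_wsqrtr// (bigD1 i)//= lerDl sumr_ge0// => j _.
exact: sqr_ge0.
Qed.

Lemma edist_le x y r : 0 <= r -> (forall i, `|y 0 i - x 0 i| <= r) ->
  edist x y <= n%:R * r.
Proof.
move=> r0 le_r; rewrite -(@ler_pXn2r _ 2)// ?nnegrE ?sqrtr_ge0 ?mulr_ge0//.
rewrite sqr_sqrtr; last by rewrite sumr_ge0// => i _; exact: sqr_ge0.
apply: (@le_trans _ _ (\sum_(i < n) r ^+ 2)).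
  apply: ler_sum => i _; rewrite -real_normK ?num_real//.
  by rewrite ler_pXn2r ?nnegrE.
rewrite sumr_const card_ord exprMn -[leLHS]mulr_natl ler_wpM2r ?sqr_ge0//.
by rewrite -natrX ler_nat; case: (n) => // p; rewrite expnS expn1 leq_pmulr.
Qed.

Lemma eballE x r : eball x r = [set y : 'rV[R]_n | edist x y < r].
Proof. by []. Qed.

Lemma eball_sub x y r s : edist x y + r <= s -> eball y r `<=` eball x s.
Proof.
move=> le_s z; rewrite /eball /= -!/(edist _ _) => yz.
by rewrite (le_lt_trans (edist_triangle y x z))// (lt_le_trans _ le_s)// ltrD2l.
Qed.

Lemma open_eball x r : open (eball x r : set 'rV[R]_n).
Proof.
rewrite openE => y /= yr; apply/nbhs_ballP.
pose e := (r - edist x y) / n.+1%:R.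
have e0 : 0 < e by rewrite divr_gt0// subr_gt0.
exists e => //= z [_ yz]; rewrite /eball /= -/(edist _ _).
rewrite (le_lt_trans (edist_triangle y x z))// -ltrBrDl.
apply: (@le_lt_trans _ _ (n%:R * e)).
  by apply: edist_le (ltW e0) _ => i; rewrite distrC; apply: ltW; exact: (yz 0 i).
rewrite /e mulrA mulrAC gtr_pMl ?subr_gt0//.
by rewrite ltr_pdivrMr// mul1r ltr_nat.
Qed.

Lemma measurable_open (U : set Rn) : open (U : set 'rV[R]_n) -> measurable U.
Proof. exact: sub_sigma_algebra. Qed.

Lemma measurable_eball x r : measurable (eball x r : set Rn).
Proof. by apply: measurable_open; exact: open_eball. Qed.

Lemma bigcup_eball : \bigcup_N eball (0 : 'rV[R]_n) N%:R = [set: Rn].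
Proof.
apply/seteqP; split => // y _; exists (Num.truncn (edist 0 y)).+1 => //=.
by rewrite /eball/= -/(edist 0 y) truncnS_gt.
Qed.

Lemma eball_nondecreasing : nondecreasing_seq (fun N => eball (0 : 'rV[R]_n) N%:R).
Proof.
move=> N M NM; apply/subsetPset; apply: eball_sub.
rewrite (_ : edist 0 0 = 0) ?add0r ?ler_nat//.
by rewrite /edist big1 ?sqrtr0// => i _; rewrite subrr expr0n.
Qed.

End Geometry.

(** * Dyadic cubes *)

Section Cubes.
Context {R : realType} {n : nat}.
Implicit Types (x y z alpha : 'rV[R]_n) (k : int) (m : 'rV[int]_n) (r : R).
Local Notation Rn := (euclidean R n).

Definition side k : R := 2 ^ (- k).

Definition corner (alpha : 'rV[R]_n) k m : 'rV[R]_n :=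
  side k *: (map_mx intr m + (-1) ^ k *: alpha).

Lemma side_gt0 k : 0 < side k. Proof. by rewrite exprz_gt0. Qed.

Lemma sideD k (j : nat) : side k = 2 ^+ j * side (k + j%:Z).
Proof.
by rewrite /side opprD expfzDr// mulrCA -[X in _ * (_ * X)]invr_expz -exprnP mulfV ?mulr1// expf_neq0.
Qed.

Lemma cornerE alpha k m i :
  corner alpha k m 0 i = side k * ((m 0 i)%:~R + (-1) ^ k * alpha 0 i).
Proof. by rewrite !mxE. Qed.

Lemma dyadic_cubeE alpha k m : dyadic_cube alpha k m =
  [set y : 'rV[R]_n | forall i, corner alpha k m 0 i <= y 0 i < corner alpha k m 0 i + side k].
Proof.
have s0 := side_gt0 k.
apply/seteqP; split => [_ [u uQ <-] i|y yQ].
  have -> : (2 ^ (- k) *: (u + map_mx intr m + (-1) ^ k *: alpha)) 0 i =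
      corner alpha k m 0 i + side k * u 0 i.
    by rewrite cornerE !mxE -/(side k); ring.
  have /andP[u0 u1] := uQ i.
  by rewrite lerDl mulr_ge0 ?(ltW s0)//= ltrD2l gtr_pMr.
exists ((side k)^-1 *: (y - corner alpha k m)).
  move=> i; rewrite !mxE; have /andP[y0 y1] := yQ i.
  rewrite mulr_ge0 ?invr_ge0 ?(ltW s0)/= ?subr_ge0//; last by move: y0; rewrite cornerE.
  rewrite mulrC ltr_pdivrMr// mul1r ltrBlDl; move: y1; by rewrite cornerE.
rewrite -/(side k) -addrA scalerDr scalerA mulfV ?gt_eqF// scale1r.
by rewrite subrK.
Qed.

Lemma corner_in alpha k m : dyadic_cube alpha k m (corner alpha k m).
Proof. by rewrite dyadic_cubeE => i; rewrite lexx ltrDl side_gt0. Qed.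

Lemma measurable_dyadic_cube alpha k m : measurable (dyadic_cube alpha k m : set Rn).
Proof.
have mlt i c : measurable ([set y : 'rV[R]_n | y 0 i < c] : set Rn).
  apply: measurable_open.
  rewrite [X in open X](_ : _ = (fun y : 'rV[R]_n => y 0 i) @^-1` [set t | t < c])//.
  by apply: open_comp => [y _|]; [exact: coord_continuous|exact: open_lt].
rewrite dyadic_cubeE [X in measurable X](_ : _ = \bigcap_(i in [set: 'I_n])
   (~` [set y : 'rV[R]_n | y 0 i < corner alpha k m 0 i] `&`
    [set y : 'rV[R]_n | y 0 i < corner alpha k m 0 i + side k])).
  apply: fin_bigcap_measurable => // i _; apply: measurableI => //.
  exact: measurableC.
apply/seteqP; split => [y yQ i _|y yQ i] /=.
  by have /andP[] := yQ i; split => //; apply/negP; rewrite -leNgt.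
by have [/= /negP] := yQ i Logic.I; rewrite -leNgt => -> ->.
Qed.

(** This makes the generations of one shifted grid compatible: the sign of the
    shift alternates, and three times a shift is integral. *)
Lemma third_shift (j : nat) : exists z : int, (-1) ^+ j - 2 ^+ j = 3 * z :> int.
Proof.
elim: j => [|j [z IH]]; first by exists 0.
exists (-1 * z - 2 ^+ j); rewrite !exprS mulrBr mulrCA -IH; ring.
Qed.

Lemma corner_diff alpha k (j : nat) m m' : dyadic_shifts alpha ->
  forall i, exists z : int, corner alpha (k + j%:Z) m' 0 i - corner alpha k m 0 i
    = side (k + j%:Z) * z%:~R.
Proof.
move=> sa i; have [z zE] := third_shift j.
have [a aE] : exists a : int, alpha 0 i * 3 = a%:~R.
  have := sa i; rewrite !inE => /or3P[]/eqP->.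
  - by exists 0; rewrite mul0r.
  - by exists 1; field.
  - by exists 2; field.
have [b bE] : exists b : int, (-1) ^ k = b%:~R :> R.
  have : ((-1) ^ k : R) ^+ 2 == 1 by rewrite expr2 -expfzMl mulrNN mulr1 exp1rz.
  by rewrite sqrf_eq1 => /orP[]/eqP->; [exists 1|exists (-1)].
exists (m' 0 i - 2 ^+ j * m 0 i + b * a * z).
rewrite !cornerE (sideD k j) expfzDr ?oppr_eq0 ?oner_eq0// -exprnP bE.
have zR : (-1) ^+ j = 2 ^+ j + 3 * z%:~R :> R.
  have : ((-1) ^+ j - 2 ^+ j)%:~R = (3 * z)%:~R :> R by rewrite zE.
  by rewrite intrB intrM !rmorphXn/= rmorphN/= => /eqP; rewrite subr_eq addrC => /eqP.
rewrite zR !rmorphD/= !rmorphM/= rmorphN/= rmorphM/= rmorphXn/= -aE.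
ring.
Qed.

(** Corners of the finer generation differ from those of the coarser one by
    integer multiples of the finer side, so a fine cube cannot straddle the
    boundary of a coarse one. *)
Lemma dyadic_nested alpha k (j : nat) m m' : dyadic_shifts alpha ->
  dyadic_cube alpha (k + j%:Z) m' `<=` dyadic_cube alpha k m \/
  dyadic_cube alpha k m `&` dyadic_cube alpha (k + j%:Z) m' = set0.
Proof.
move=> sa; have [->|/set0P[y [yP yQ]]] := eqVneq (dyadic_cube alpha k m `&`
  dyadic_cube alpha (k + j%:Z) m') set0; first by right.
left; move: yP yQ; rewrite !dyadic_cubeE /= => yP yQ u uQ i.
have [z zE] := corner_diff k j m m' sa i.
have /andP[P1 P2] := yP i; have /andP[Q1 Q2] := yQ i; have /andP[u1 u2] := uQ i.
have s0 := side_gt0 (k + j%:Z).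
set s := side (k + j%:Z) in zE s0 Q2 u2 *.
have skE : side k = s * (2 ^+ j)%:~R by rewrite (sideD k j) mulrC rmorphXn.
have : -1 < z.
  rewrite -(ltr_int R) -(ltr_pM2l s0) -zE mulrN1; lra.
have : z < 2 ^+ j.
  by rewrite -(ltr_int R) -(ltr_pM2l s0) -zE -skE; lra.
rewrite -!lezD1 addNr -(ler_int R) -(ler_pM2l s0) intrD mulrDr mulr1 -skE -zE => z1.
rewrite -(ler_int R) -(ler_pM2l s0) -zE mulr0 => z2.
by apply/andP; split; lra.
Qed.

Lemma add_const_mxE x c i : (x + const_mx c) 0 i = x 0 i + c.
Proof. by rewrite !mxE. Qed.

Lemma side_le alpha k k' m m' : (0 < n)%N ->
  dyadic_cube alpha k m `<=` dyadic_cube alpha k' m' -> side k <= side k'.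
Proof.
move=> n0 sub; rewrite leNgt; apply/negP => lt.
pose i0 := Ordinal n0.
have := sub _ (corner_in alpha k m); rewrite dyadic_cubeE => /(_ i0)/andP[c1 c2].
have : dyadic_cube alpha k m (corner alpha k m + const_mx (side k')).
  rewrite dyadic_cubeE => i; rewrite add_const_mxE lerDl ltrD2l lt.
  by rewrite ltW// side_gt0.
move=> /sub; rewrite dyadic_cubeE => /(_ i0); rewrite add_const_mxE => /andP[_].
by move: c1 c2; lra.
Qed.

Lemma dyadic_laminar alpha (s : seq (set Rn)) : dyadic_shifts alpha ->
  (forall Q, Q \in s -> dyadic_grid alpha Q) -> laminar s.
Proof.
move=> sa sg P Q /sg[k [m ->]] /sg[k' [m' ->]].
have [kk'|k'k] := leP k k'.
  have [j ->] : exists j : nat, k' = k + j%:Z.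
    by exists `|k' - k|%N; rewrite gez0_abs ?subr_ge0// subrKC.
  by have [?|?] := dyadic_nested k j m m' sa; [apply: Or32|apply: Or33].
have [j ->] : exists j : nat, k = k' + j%:Z.
  by exists `|k - k'|%N; rewrite gez0_abs ?subr_ge0 ?(ltW k'k)// subrKC.
have [?|?] := dyadic_nested k' j m' m sa; [by apply: Or31|apply: Or33].
by rewrite setIC.
Qed.

End Cubes.

(** * Dyadic cubes and doubling measures *)

Section DoublingCubes.
Context {R : realType} {n : nat}.
Implicit Types (x y z alpha : 'rV[R]_n) (k : int) (m : 'rV[int]_n) (r C : R).
Local Notation Rn := (euclidean R n).
Implicit Types (P Q : set Rn).

Lemma exists_side r : 0 < r -> exists k, r < side k <= 2 * r.
Proof.
move=> r0; pose e := Num.floor (ln r / ln 2).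
exists (- (e + 1)).
have l2 : 0 < ln 2 :> R by rewrite ln_gt0// ltr1n.
have pE (z : int) : (2 : R) ^ z = expR (z%:~R * ln 2).
  by rewrite -powR_intmul// /powR pnatr_eq0.
have -> : side (- (e + 1)) = 2 * expR (e%:~R * ln 2) :> R.
  by rewrite /side opprK pE intrD mulrDl mul1r expRD lnK ?posrE// mulrC.
rewrite ler_pM2l//; apply/andP; split.
  rewrite -{1}(lnK r0) -{1}(@lnK _ (2 : R)) ?posrE// -expRD ltr_expR.
  rewrite -{1}[ln 2]mul1r -mulrDl -ltr_pdivrMr//.
  by have := floorD1_gt (ln r / ln 2); rewrite intrD addrC.
by rewrite -[leRHS](lnK r0) ler_expR -ler_pdivlMr// floor_le_tmp.
Qed.

(** The one-third trick: coordinatewise, among the endpoints of the three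
    shifted grids there is one that leaves a margin of a third of the side on
    the right of a given point. *)
Lemma ball_in_dyadic_cube x r : 0 < r -> exists alpha k m,
  [/\ dyadic_shifts alpha, eball x r `<=` dyadic_cube alpha k m & side k <= 12 * r].
Proof.
move=> r0; have [|k /andP[k1 k2]] := @exists_side (6 * r); first by rewrite mulr_gt0.
have s0 := side_gt0 (R := R) k.
have sgn : (-1) ^ k = 1 :> R \/ (-1) ^ k = -1 :> R.
  have : ((-1) ^ k : R) ^+ 2 == 1 by rewrite expr2 -expfzMl mulrNN mulr1 exp1rz.
  by rewrite sqrf_eq1 => /orP[]/eqP->; [left|right].
have coord i : exists am : R * int, am.1 \in [:: 0; 1 / 3; 2 / 3] /\
   (am.2%:~R + (-1) ^ k * am.1 <= (x 0 i - r) / side k) /\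
   ((x 0 i - r) / side k + 1 / 3 <= am.2%:~R + (-1) ^ k * am.1 + 1).
  set t := (x 0 i - r) / side k; pose f := Num.floor t.
  have f1 : f%:~R <= t by exact: floor_le_tmp.
  have f2 : t < f%:~R + 1 by have := floorD1_gt t; rewrite intrD.
  have [le1|gt1] := leP (t + 1 / 3) (f%:~R + 1).
    by exists (0, f); rewrite /= !inE eqxx mulr0 addr0.
  case: sgn => ->.
    by exists (1 / 3, f); rewrite /= !inE eqxx orbT; split => //; split; lra.
  exists (2 / 3, f + 1); rewrite /= !inE eqxx !orbT intrD; split => //; split; lra.
have [am amP] := choice coord.
exists (\row_i (am i).1), k, (\row_i (am i).2); split.
- by move=> i; rewrite mxE; have [] := amP i.
- move=> y yx; rewrite dyadic_cubeE => i.
  have [_ []] := amP i.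
  have : `|y 0 i - x 0 i| < r by apply: le_lt_trans (le_coord_edist x y i) yx.
  rewrite ltr_norml => /andP[y1 y2].
  rewrite cornerE !mxE; set c := (_ + _ * _).
  rewrite ler_pdivlMr// -lerBrDr ler_pdivrMr// => c1 c2.
  apply/andP; split; first by rewrite mulrC; lra.
  move: c2; rewrite -addrA [c + _]addrC mulrDl mulrDl => c2.
  rewrite mulrC [c * _]mulrC; rewrite [c * _]mulrC in c2.
  have : 1 * side k - 1 / 3 * side k > 4 * r - 0 * side k by lra.
  by lra.
- by lra.
Qed.

(** A cube is only a set here; its generation and position are recovered by
    choice. *)
Definition cube_index alpha Q : int * 'rV[int]_n :=
  xget (0, 0) [set km | Q = dyadic_cube alpha km.1 km.2].

(** The radius is twice the bound on the diameter given by [edist_corner],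
    which is what makes [dilate_mono] hold. *)
Definition dilate alpha Q : set Rn :=
  eball (corner alpha (cube_index alpha Q).1 (cube_index alpha Q).2)
        (2 * n%:R * side (cube_index alpha Q).1).

Lemma cube_indexP alpha Q : dyadic_grid alpha Q -> exists k m,
  Q = dyadic_cube alpha k m /\
  dilate alpha Q = eball (corner alpha k m) (2 * n%:R * side k).
Proof.
move=> [k [m QE]].
exists (cube_index alpha Q).1, (cube_index alpha Q).2; split => //.
rewrite /cube_index; case: xgetP => [km _ //|/(_ (k, m))/=].
by rewrite QE.
Qed.

Hypothesis n0 : (0 < n)%N.

Let n1 : 1 <= n%:R :> R. Proof. by rewrite ler1n. Qed.

Lemma dilate_ball alpha Q : dyadic_grid alpha Q -> balls (dilate alpha Q).
Proof.
move=> /cube_indexP[k [m [_ ->]]]; exists (corner alpha k m), (2 * n%:R * side k).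
by split=> //; rewrite !mulr_gt0 ?side_gt0// ltr0n.
Qed.

Lemma edist_corner alpha k m y : dyadic_cube alpha k m y ->
  edist (corner alpha k m) y <= n%:R * side k.
Proof.
rewrite dyadic_cubeE => yQ; apply: edist_le (ltW (side_gt0 _)) _ => i.
by have /andP[? ?] := yQ i; rewrite ger0_norm ?subr_ge0// lerBlDl ltW.
Qed.

Lemma sub_dilate alpha Q : dyadic_grid alpha Q -> Q `<=` dilate alpha Q.
Proof.
move=> /cube_indexP[k [m [-> ->]]] y /edist_corner; rewrite eballE/= => le_y.
have s0 := side_gt0 (R := R) k.
apply: le_lt_trans le_y _; rewrite -mulrA ltr_pMl ?ltr1n// mulr_gt0//.
by rewrite ltr0n.
Qed.

(** A strictly smaller cube of the same grid has at most half the side, so the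
    distance between the corners plus the smaller radius stays below the
    larger radius. *)
Lemma dilate_mono alpha Q P : dyadic_shifts alpha ->
  dyadic_grid alpha Q -> dyadic_grid alpha P -> Q `<=` P ->
  dilate alpha Q `<=` dilate alpha P.
Proof.
move=> sa gQ gP QP.
have [->//|/eqP QnP] := eqVneq Q P.
have [k [m [QE ->]]] := cube_indexP gQ.
have [k' [m' [PE ->]]] := cube_indexP gP.
have Qc : Q (corner alpha k m) by rewrite QE; exact: corner_in.
have s0 := side_gt0 (R := R) k; have s0' := side_gt0 (R := R) k'.
have le_side : side k <= side k' :> R.
  by apply: (@side_le _ _ alpha _ _ m m') => //; rewrite -QE -PE.
have [k'k|kk'] := leP k' k; last first.
  have kE : k' = k + (`|k' - k|%N)%:Z by rewrite gez0_abs ?subr_ge0 ?(ltW kk')// subrKC.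
  move: le_side; rewrite (sideD k `|k' - k|%N) -kE ger_pMl//.
  rewrite lt_geF// exprn_egt1 ?ltr1n//.
  by rewrite absz_eq0 subr_eq0 gt_eqF.
have kE : k = k' + (`|k - k'|%N)%:Z by rewrite gez0_abs ?subr_ge0// subrKC.
have [j0|j0] := eqVneq `|k - k'|%N 0%N.
  rewrite j0 addr0 in kE; exfalso.
  have [PQ|dis] := dyadic_nested k 0 m m' sa.
    apply: QnP; apply/seteqP; split => //.
    by move: PQ; rewrite addr0 {1}kE -PE -QE.
  have : (dyadic_cube alpha k m `&` dyadic_cube alpha (k + 0%:Z) m') (corner alpha k m).
    by rewrite addr0; split; rewrite -?QE// {1}kE -PE; exact: QP.
  by rewrite dis.
have side2 : 2 * side k <= side k' :> R.
  rewrite (sideD k' `|k - k'|%N) -kE ler_pM2r//.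
  by rewrite -[leLHS]expr1 ler_eXn2l ?ltr1n// lt0n.
apply: eball_sub; apply: (@le_trans _ _ (n%:R * side k' + n%:R * (2 * side k))).
  rewrite lerD// ?edist_corner//; first by rewrite -PE; exact: QP.
  by rewrite mulrCA mulrA.
have := ler_wpM2l (le_trans ler01 n1) side2; lra.
Qed.

Variable mu : {measure set Rn -> \bar R}.
Hypothesis mu_balls : forall B, balls B -> (0 < mu B < +oo)%E.

Let mu_eball x r : 0 < r -> (0 < mu (eball x r) < +oo)%E.
Proof. by move=> r0; apply: mu_balls; exists x, r. Qed.

Lemma dyadic_cube_mass alpha Q : dyadic_grid alpha Q ->
  measurable Q /\ (0 < mu Q < +oo)%E.
Proof.
move=> gQ; have [k [m [QE _]]] := cube_indexP gQ.
have mQ : measurable Q by rewrite QE; exact: measurable_dyadic_cube.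
have s0 := side_gt0 (R := R) k.
split => //; apply/andP; split.
  pose c := corner alpha k m + const_mx (side k / 2).
  have /andP[c0 _] := mu_eball c (divr_gt0 s0 (ltr0Sn R 1)).
  apply: (lt_le_trans c0); apply: le_measure; rewrite ?inE//.
    exact: measurable_eball.
  rewrite QE dyadic_cubeE eballE => y /= yc i.
  have := le_lt_trans (le_coord_edist c y i) yc.
  rewrite add_const_mxE ltr_norml => /andP[y1 y2]; apply/andP; split; lra.
have /mu_balls/andP[_] := dilate_ball gQ; apply: le_lt_trans.
apply: le_measure; rewrite ?inE//; last exact: sub_dilate.
by have [x [r [_ ->]]] := dilate_ball gQ; exact: measurable_eball.
Qed.

Variable C : R.
Hypothesis C1 : 1 <= C.
Hypothesis muC : doubling_with mu C.

Lemma doubling_iter x r (N : nat) : 0 < r ->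
  (mu (eball x (2 ^+ N * r)) <= (C ^+ N)%:E * mu (eball x r))%E.
Proof.
move=> r0; elim: N => [|N IH]; first by rewrite !expr0 mul1r mul1e.
rewrite exprS -mulrA; apply: le_trans (muC _ _) _; first by rewrite mulr_gt0// exprn_gt0.
rewrite exprS EFinM -muleA; apply: lee_wpmul2l => //.
by rewrite lee_fin (le_trans ler01).
Qed.

(** The one-third trick puts the dilate into a cube of side at most [24 n]
    times the side of [Q]. Its diameter is at most [48 n ^ 2] half sides of
    [Q], and [60 n ^ 2] doublings of the ball inscribed in [Q] cover that. *)
Lemma dilate_in_dyadic_cube alpha Q : dyadic_grid alpha Q ->
  exists Q' : set Rn, [/\ dyadic Q', dilate alpha Q `<=` Q' &
    (mu Q' <= (C ^+ (60 * n ^ 2))%:E * mu Q)%E].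
Proof.
move=> gQ; have [mQ _] := dyadic_cube_mass gQ.
have [k [m [QE dQ]]] := cube_indexP gQ.
have s0 := side_gt0 (R := R) k.
have r0 : 0 < 2 * n%:R * side k :> R by rewrite !mulr_gt0// ltr0n.
have [beta [l [p [sb sub le_side]]]] := ball_in_dyadic_cube (corner alpha k m) r0.
exists (dyadic_cube beta l p); split.
- by exists beta => //; exists l, p.
- by rewrite dQ.
pose c := corner alpha k m + const_mx (side k / 2).
have Qc : eball c (side k / 2) `<=` Q.
  rewrite QE dyadic_cubeE eballE => y /= yc i.
  have := le_lt_trans (le_coord_edist c y i) yc.
  rewrite add_const_mxE ltr_norml => /andP[y1 y2]; apply/andP; split; lra.
have cQ' : dyadic_cube beta l p c.
  apply: sub; rewrite -dQ; apply: sub_dilate => //; apply: Qc.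
  rewrite eballE/= /edist big1 ?sqrtr0 ?divr_gt0// => i _.
  by rewrite subrr expr0n.
have Q'c : dyadic_cube beta l p `<=` eball c (2 ^+ (60 * n ^ 2) * (side k / 2)).
  move=> y; move: cQ'; rewrite dyadic_cubeE eballE /= => cQ' yQ'.
  apply: (@le_lt_trans _ _ (n%:R * side l)).
    apply: edist_le (ltW (side_gt0 _)) _ => i.
    have /andP[? ?] := cQ' i; have /andP[? ?] := yQ' i.
    by rewrite ler_norml; apply/andP; split; lra.
  have : (60 * n ^ 2)%:R < 2 ^+ (60 * n ^ 2) :> R.
    by rewrite -natrX ltr_nat ltn_expl.
  rewrite -(ltr_pM2r (divr_gt0 s0 (ltr0Sn R 1))); apply: le_lt_trans.
  have := ler_wpM2l (le_trans ler01 n1) le_side.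
  rewrite natrM natrX => /le_trans; apply.
  have : 0 <= n%:R ^+ 2 * side k :> R by rewrite mulr_ge0 ?sqr_ge0// ltW.
  rewrite expr2; nra.
apply: (@le_trans _ _ (mu (eball c (2 ^+ (60 * n ^ 2) * (side k / 2))))).
  apply: le_measure => //; rewrite inE; [exact: measurable_dyadic_cube|exact: measurable_eball].
apply: le_trans (doubling_iter _ _ _) _; first by rewrite divr_gt0.
apply: lee_wpmul2l; first by rewrite lee_fin exprn_ge0// (le_trans ler01).
by apply: le_measure; rewrite ?inE//; exact: measurable_eball.
Qed.

End DoublingCubes.

(** The infimum that defines the doubling dimension is attained, since for a
    fixed ball the doubling inequality is a closed condition on the constant. *)
Lemma doubling_dimP (R : realType) (n : nat) (mu : {measure set euclidean R n -> \bar R}) :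
  doubling_measure mu ->
  1 <= 2 `^ doubling_dim mu /\ doubling_with mu (2 `^ doubling_dim mu).
Proof.
move=> [mub [C0 C0P]].
have mueb (x : 'rV[R]_n) r : 0 < r -> (0 < mu (eball x r) < +oo)%E.
  by move=> r0; apply: mub; exists x, r.
have muE (x : 'rV[R]_n) r : 0 < r -> exists2 t : R, 0 < t & mu (eball x r) = t%:E.
  move=> /(mueb x); case: (mu _) => [t| |]; rewrite ?lte_fin ?andbF//.
  by move=> /andP[t0 _]; exists t.
pose S := [set C | doubling_with mu C].
have S1 C : S C -> 1 <= C.
  move=> SC; have := SC 0 1 ltr01.
  have [t t0 tE] := muE 0 1 ltr01.
  have : (mu (eball (0 : 'rV[R]_n) 1) <= mu (eball (0 : 'rV[R]_n) (2 * 1)))%E.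
    apply: le_measure; rewrite ?inE; try exact: measurable_eball.
    apply: eball_sub; rewrite (_ : edist 0 0 = 0) ?add0r ?mulr1 ?ler1n//.
    by rewrite /edist big1 ?sqrtr0// => i _; rewrite subrr expr0n.
  move=> /le_trans /[apply]; rewrite tE -EFinM lee_fin.
  by rewrite -ler_pdivrMr// divff// gt_eqF.
have S0 : S !=set0 by exists C0.
have inf1 : 1 <= inf S by apply: lb_le_inf.
have IE : 2 `^ doubling_dim mu = inf S.
  rewrite /powR pnatr_eq0 /doubling_dim mulfVK ?lnK ?posrE ?(lt_le_trans _ inf1)//.
  by rewrite gt_eqF// ln_gt0// ltr1n.
rewrite IE; split=> // x r r0.
have [a a0 aE] := muE x r r0; have [|b b0 bE] := muE x (2 * r); first by rewrite mulr_gt0.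
rewrite aE bE -EFinM lee_fin -ler_pdivrMr//; apply: lb_le_inf => // C SC.
by rewrite ler_pdivrMr// -lee_fin EFinM -aE -bE; exact: SC.
Qed.

(** * Sums over the levels of a sparse tree *)

(** Young's inequality after normalizing both sums to one; a vanishing sum
    forces all terms to vanish. *)
Lemma holder_sum (R : realType) (I : eqType) (s : seq I) (a b m : I -> R) (t : R) :
  0 <= t < 1 -> (forall i, 0 <= a i) -> (forall i, 0 <= b i) ->
  (forall i, 0 <= m i) ->
  \sum_(i <- s) a i `^ t * b i `^ (1 - t) * m i <=
  (\sum_(i <- s) a i * m i) `^ t * (\sum_(i <- s) b i * m i) `^ (1 - t).
Proof.
move=> /andP[t0 t1] a0 b0 m0.
have [->|tn0] := eqVneq t 0.
  rewrite powRr0 mul1r subr0 powRr1 ?sumr_ge0// => [|i _]; last by rewrite mulr_ge0.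
  by apply: ler_sum => i _; rewrite powRr0 mul1r powRr1.
have tp : 0 < t by rewrite lt_neqAle eq_sym tn0.
have t1p : 0 < 1 - t by rewrite subr_gt0.
set A := \sum_(i <- s) a i * m i; set B := \sum_(i <- s) b i * m i.
have A0 : 0 <= A by rewrite sumr_ge0// => i _; rewrite mulr_ge0.
have B0 : 0 <= B by rewrite sumr_ge0// => i _; rewrite mulr_ge0.
have young x y : 0 <= x -> 0 <= y -> x `^ t * y `^ (1 - t) <= t * x + (1 - t) * y.
  move=> x0 y0.
  have := @conjugate_powR _ (x `^ t) (y `^ (1 - t)) t^-1 (1 - t)^-1.
  rewrite !invrK -!powRrM !mulfV ?gt_eqF// !powRr1// subrKC => /(_ (powR_ge0 _ _) (powR_ge0 _ _)).
  by rewrite !invr_gt0 [x * _]mulrC [y * _]mulrC => ->.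
have key A' B' : 0 < A' -> 0 < B' -> A <= A' -> B <= B' ->
    \sum_(i <- s) a i `^ t * b i `^ (1 - t) * m i <= A' `^ t * B' `^ (1 - t).
  move=> A'0 B'0 AA' BB'.
  have : \sum_(i <- s) (a i / A') `^ t * (b i / B') `^ (1 - t) * m i <= 1.
    apply: (@le_trans _ _ (t * (A / A') + (1 - t) * (B / B'))); last first.
      have : A / A' <= 1 by rewrite ler_pdivrMr// mul1r.
      have : B / B' <= 1 by rewrite ler_pdivrMr// mul1r.
      by nra.
    rewrite /A /B !mulr_suml !mulr_sumr -big_split/=; apply: ler_sum => i _.
    have xA : 0 <= a i / A' by rewrite divr_ge0// ltW.
    have xB : 0 <= b i / B' by rewrite divr_ge0// ltW.
    apply: le_trans (ler_wpM2r (m0 i) (young _ _ xA xB)) _.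
    by rewrite le_eqVlt; apply/orP; left; apply/eqP; ring.
  have -> : \sum_(i <- s) (a i / A') `^ t * (b i / B') `^ (1 - t) * m i =
      (\sum_(i <- s) a i `^ t * b i `^ (1 - t) * m i) / (A' `^ t * B' `^ (1 - t)).
    rewrite mulr_suml; apply: eq_bigr => i _.
    have inv x r : 0 <= x -> x^-1 `^ r = (x `^ r)^-1.
      by move=> x0; rewrite -[x^-1]powR_inv1// -powRrM mulN1r powRN.
    have [A'p B'p] : 0 <= A' /\ 0 <= B' by rewrite !ltW.
    rewrite !powRM ?invr_ge0// !inv// invfM; ring.
  by rewrite ler_pdivrMr ?mul1r// mulr_gt0 ?powR_gt0.
have zero (c : I -> R) : (forall i, 0 <= c i) -> \sum_(i <- s) c i * m i = 0 ->
    {in s, forall i, c i = 0 \/ m i = 0}.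
  move=> c0 /eqP; rewrite psumr_eq0 => [/allP sum0 i si|i _]; last by rewrite mulr_ge0.
  by have := sum0 i si; rewrite /= mulf_eq0 => /orP[]/eqP; [left|right].
have [Az|An] := eqVneq A 0.
  rewrite Az powR0// mul0r big1_seq// => i /= si.
  by have [->|->] := zero a a0 Az i si; rewrite ?powR0 ?mul0r ?mulr0.
have [Bz|Bn] := eqVneq B 0.
  rewrite Bz powR0 ?gt_eqF// mulr0 big1_seq// => i /= si.
  by have [->|->] := zero b b0 Bz i si; rewrite ?powR0 ?gt_eqF ?mulr0 ?mul0r.
by apply: key; rewrite // lt_neqAle eq_sym ?An ?Bn.
Qed.

Section SparseForms.
Context d (X : measurableType d) (R : realType) (mu : {measure set X -> \bar R}).
Implicit Types (s : seq (set X)) (P Q : set X) (eta : R).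
Local Notation m Q := (fine (mu Q)).

Lemma fine_gt0_fin_num (x : \bar R) : 0 < fine x -> x \is a fin_num.
Proof. by case: x => //=; rewrite ltxx. Qed.

(** An infinite integral counts as zero. *)
Definition ravg (G : X -> R) Q : R := fine (\int[mu]_(x in Q) (G x)%:E)%E / m Q.

Lemma ravg_ge0 G Q : (forall x, 0 <= G x) -> 0 <= ravg G Q.
Proof.
move=> G0; rewrite divr_ge0 ?fine_ge0// integral_ge0// => y _.
by rewrite lee_fin.
Qed.

(** Hoelder's inequality with exponents [t^-1] and [(1 - t)^-1], where the
    factor with the averages of [G] is then bounded by the Carleson embedding. *)
Lemma carleson_holder eta s (G : X -> R) (tau t I : R) (y : set X -> R) :
  0 < eta -> 0 < t -> t < tau -> tau <= 1 -> sparse_tree mu eta s ->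
  measurable_fun setT G -> (forall x, 0 <= G x) -> (forall Q, 0 <= y Q) ->
  (\int[mu]_x (G x `^ (tau / t))%:E <= I%:E)%E ->
  \sum_(Q <- s) ravg G Q `^ tau * y Q `^ (1 - t) * m Q <=
  (carleson_cst eta (tau / t) * I) `^ t * (\sum_(Q <- s) y Q * m Q) `^ (1 - t).
Proof.
move=> eta0 t0 t_tau tau1 st mG G0 y0 le_I.
have r1 : 1 < tau / t by rewrite ltr_pdivlMr// mul1r.
have CE := carleson_embedding eta0 r1 st mG G0.
have cst0 := carleson_cst_ge0 eta0 r1.
have le_sum : \sum_(Q <- s) ravg G Q `^ (tau / t) * m Q <= carleson_cst eta (tau / t) * I.
  rewrite -lee_fin; apply: le_trans CE _; rewrite [leRHS]EFinM.
  by apply: lee_wpmul2l => //; rewrite lee_fin.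
apply: (@le_trans _ _ (\sum_(Q <- s) (ravg G Q `^ (tau / t)) `^ t * y Q `^ (1 - t) * m Q)).
  apply: ler_sum => Q _; by rewrite -powRrM divfK// gt_eqF.
have t01 : 0 <= t < 1 by rewrite ltW//= (lt_le_trans t_tau).
apply: le_trans (holder_sum s t01 _ y0 _) _.
- by move=> Q; exact: powR_ge0.
- by move=> Q; exact: fine_ge0.
rewrite ler_wpM2r ?powR_ge0// ge0_ler_powR ?(ltW t0) ?nnegrE//.
- by rewrite sumr_ge0// => Q _; rewrite mulr_ge0 ?powR_ge0 ?fine_ge0.
- by apply: le_trans le_sum; rewrite sumr_ge0// => Q _; rewrite mulr_ge0 ?powR_ge0 ?fine_ge0.
Qed.

Section Levels.
Variables (eta : R) (s : seq (set X)) (W : set X -> R) (h : X -> R) (K H : R).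
Hypothesis st : sparse_tree mu eta s.
Hypotheses (mh : measurable_fun setT h) (h0 : forall x, 0 <= h x).
Hypothesis hH : (\int[mu]_x (h x)%:E <= H%:E)%E.
Hypothesis W0 : forall Q, Q \in s -> 0 < W Q.
Hypothesis K0 : 0 <= K.
Hypothesis packW : forall P, P \in s ->
  \sum_(Q <- s | `[< Q `<=` P >]) W Q <= K * W P.
Local Notation hm Q := (fine (\int[mu]_(x in Q) (h x)%:E)%E).
Hypothesis good : forall Q, Q \in s -> 0 < hm Q <= W Q.

Definition level Q := Num.truncn (ln (W Q / hm Q)).

Lemma levelP Q : Q \in s ->
  expR 1 ^+ level Q * hm Q <= W Q < expR 1 ^+ (level Q).+1 * hm Q.
Proof.
move=> Qs; have /andP[hQ hW] := good Qs.
have /truncn_ln : 1 <= W Q / hm Q by rewrite ler_pdivlMr// mul1r.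
by rewrite ler_pdivlMr// ltr_pdivrMr.
Qed.

Let H_ge0 : 0 <= H.
Proof.
rewrite -lee_fin; apply: le_trans hH; apply: integral_ge0 => x _.
by rewrite lee_fin.
Qed.

(** Inside a level the masses [W Q] and [hm Q] are proportional up to a factor
    [e], so the packing condition for [W] passes to [hm]; over the disjoint
    maximal members [hm] sums to at most [H]. The level [j] disappears from
    the bound. *)
Lemma sum_level j : \sum_(Q <- s | level Q == j) hm Q <= expR 1 * K * H.
Proof.
have e0 i : 0 < expR 1 ^+ i :> R by rewrite exprn_gt0// expR_gt0.
pose sj := [seq Q <- s | level Q == j].
have inj Q : Q \in sj -> Q \in s /\ level Q = j by rewrite mem_filter => /andP[/eqP].
have [us ls ms _] := sparse_tree_filter (fun Q => level Q == j) st.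
have W0' Q : 0 <= Num.max 0 (W Q) by rewrite le_max lexx.
have mP P : P \in maxima sj -> measurable P /\ P `<=` [set: X].
  by move=> /maxima_sub /ms[].
have maxH := sum_integral_trivIset mu (phi := EFin \o h) (filter_uniq _ us)
  (maxima_trivIset ls) measurableT mP.
have {}maxH : \sum_(P <- maxima sj) hm P <= H.
  rewrite -lee_fin -sumEFin; apply: le_trans hH; apply: le_trans (maxH _ _).
  - rewrite big_seq [leRHS]big_seq lee_sum// => P /maxima_sub/inj[Ps _].
    by have /andP[/fine_gt0_fin_num hP _] := good Ps; rewrite fineK.
  - exact/measurable_EFinP.
  - by move=> x _; rewrite lee_fin.
have : expR 1 ^+ j * \sum_(Q <- s | level Q == j) hm Q <=
    K * (expR 1 ^+ j.+1 * \sum_(P <- maxima sj) hm P).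
  rewrite mulr_sumr.
  apply: (@le_trans _ _ (\sum_(Q <- s | level Q == j) Num.max 0 (W Q))).
    rewrite big_seq_cond [leRHS]big_seq_cond ler_sum// => Q /andP[Qs /eqP <-].
    by have /andP[+ _] := levelP Qs; rewrite le_max orbC => ->.
  rewrite -big_filter; apply: le_trans (sum_le_maxima _ W0') _.
  rewrite !mulr_sumr big_seq [leRHS]big_seq ler_sum// => P /maxima_sub/inj[Ps Pj].
  apply: (@le_trans _ _ (K * W P)).
    apply: le_trans (packW Ps).
    rewrite big_filter_cond big_mkcondl/= big_seq_cond [leRHS]big_seq_cond.
    apply: ler_sum => Q /andP[Qs _]; rewrite (max_idPr (ltW (W0 Qs))).
    by case: ifP => // _; exact: ltW (W0 Qs).
  rewrite ler_wpM2l//; have /andP[_ /ltW] := levelP Ps.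
  by rewrite Pj.
set T := \sum_(P <- maxima sj) _ in maxH *; set S := \sum_(Q <- s | _) _.
have -> : K * (expR 1 ^+ j.+1 * T) = expR 1 ^+ j * (expR 1 * K * T) by rewrite exprS; ring.
rewrite ler_pM2l// => /le_trans; apply.
by rewrite ler_wpM2l// mulr_ge0// expR_ge0.
Qed.

Lemma sum_head (k0 : nat) :
  \sum_(Q <- s | (level Q < k0)%N) hm Q <= k0%:R * (expR 1 * K * H).
Proof.
have -> : \sum_(Q <- s | (level Q < k0)%N) hm Q =
    \sum_(j < k0) \sum_(Q <- s | level Q == j) hm Q.
  rewrite [RHS](exchange_big_dep (fun Q => (level Q < k0)%N))/=; last first.
    by move=> j Q _ /eqP ->.
  apply: eq_bigr => Q lt_k.
  rewrite (eq_bigl (fun j => j == Ordinal lt_k)) ?big_pred1_eq// => j.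
  by rewrite -val_eqE/= eq_sym.
apply: (@le_trans _ _ (\sum_(j < k0) expR 1 * K * H)).
  by apply: ler_sum => j _; exact: sum_level.
by rewrite sumr_const card_ord mulr_natl.
Qed.

(** On level [j] the factor [(hm Q / W Q) `^ delta] is at most
    [e ^ (- j delta)], so the uniform bounds of [sum_level] are summed
    geometrically. *)
Lemma sum_tail (k0 : nat) (delta : R) : 0 < delta ->
  \sum_(Q <- s | (k0 <= level Q)%N) hm Q * (hm Q / W Q) `^ delta <=
  (expR 1 ^+ k0)^-1 `^ delta * (1 - (expR 1)^-1 `^ delta)^-1 * (expR 1 * K * H).
Proof.
move=> delta0; set q := (expR 1)^-1 `^ delta.
have e0 : 0 < expR 1 :> R by exact: expR_gt0.
have q0 : 0 <= q by exact: powR_ge0.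
have q1 : q < 1.
  rewrite /q -expRN /powR gt_eqF ?expR_gt0// expRK mulrN1.
  by rewrite expR_lt1 oppr_lt0.
have qn i : (expR 1 ^+ i)^-1 `^ delta = q ^+ i.
  rewrite -exprVn -powR_mulrn ?invr_ge0 ?(ltW e0)// powRAC powR_mulrn//.
have C0 : 0 <= expR 1 * K * H by rewrite !mulr_ge0// ltW.
have [M ->] : exists M, \sum_(Q <- s | (k0 <= level Q)%N) hm Q * (hm Q / W Q) `^ delta =
   \sum_(j < M) \sum_(Q <- [seq Q <- s | (k0 <= level Q)%N] | (level Q - k0)%N == j)
     hm Q * (hm Q / W Q) `^ delta.
  rewrite -big_filter; exact: sum_levels.
apply: (@le_trans _ _ (\sum_(j < M) q ^+ k0 * q ^+ j * (expR 1 * K * H))).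
  apply: ler_sum => j _; rewrite -exprD.
  apply: (@le_trans _ _ (\sum_(Q <- s | level Q == (k0 + j)%N) hm Q * q ^+ (k0 + j))).
    rewrite big_filter_cond big_seq_cond [leRHS]big_seq_cond.
    rewrite (eq_bigl (fun Q => (Q \in s) && (level Q == k0 + j)%N)); last first.
      move=> Q; congr (_ && _); apply/andP/eqP => [[le_k /eqP <-]|->].
        by rewrite subnKC.
      by rewrite leq_addr addKn eqxx.
    apply: ler_sum => Q /andP[Qs /eqP kQ].
    have /andP[hQ _] := good Qs; have /andP[le_W _] := levelP Qs.
    rewrite ler_wpM2l ?(ltW hQ)// -qn ge0_ler_powR ?(ltW delta0) ?nnegrE ?invr_ge0 ?exprn_ge0 ?(ltW e0)//.
      by rewrite divr_ge0 ?ltW ?W0.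
    rewrite -kQ ler_pdivrMr ?W0// mulrC ler_pdivlMr ?exprn_gt0//.
    by rewrite mulrC.
  rewrite -mulr_suml mulrC ler_wpM2l ?exprn_ge0//; exact: sum_level.
rewrite -mulr_suml ler_wpM2r// -mulr_sumr qn ler_wpM2l ?exprn_ge0//.
rewrite -[leRHS]mul1r ler_pdivlMr ?subr_gt0// -opprB mulrN mulrC -subrX1 opprB.
by rewrite gerBl exprn_ge0.
Qed.

End Levels.
End SparseForms.

(** * Splitting a sparse sum at a level *)

Section CoreBound.
Context d (X : measurableType d) (R : realType) (mu : {measure set X -> \bar R}).
Implicit Types (s : seq (set X)) (P Q : set X) (eta : R).
Local Notation m Q := (fine (mu Q)).

Variables (eta : R) (s : seq (set X)) (W : set X -> R) (h : X -> R) (K H : R).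
Hypothesis st : sparse_tree mu eta s.
Hypotheses (mh : measurable_fun setT h) (h0 : forall x, 0 <= h x).
Hypothesis hH : (\int[mu]_x (h x)%:E <= H%:E)%E.
Hypothesis W0 : forall Q, Q \in s -> 0 < W Q.
Hypothesis K0 : 0 <= K.
Hypothesis packW : forall P, P \in s ->
  \sum_(Q <- s | `[< Q `<=` P >]) W Q <= K * W P.
Local Notation hm Q := (fine (\int[mu]_(x in Q) (h x)%:E)%E).
Hypothesis good : forall Q, Q \in s -> hm Q <= W Q.

Variables (f i : set X -> R) (V0 V1 s0 eps c1 : R).
Local Notation s1 := (s0 + eps).
Hypotheses (f0 : forall Q, 0 <= f Q) (i0 : forall Q, 0 <= i Q).
Hypotheses (s00 : 0 <= s0) (eps0 : 0 < eps) (s11 : s1 < 1).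
Hypotheses (c10 : 0 <= c1) (V00 : 0 <= V0) (V10 : 0 <= V1).
Hypothesis Wi : forall Q, Q \in s -> W Q <= c1 * i Q * m Q.
Hypothesis HC0 : forall (p : pred (set X)) (y : set X -> R), (forall Q, 0 <= y Q) ->
  \sum_(Q <- s | p Q) f Q * y Q `^ (1 - s0) * m Q <=
  V0 * (\sum_(Q <- s | p Q) y Q * m Q) `^ (1 - s0).
Hypothesis HC1 : forall (p : pred (set X)) (y : set X -> R), (forall Q, 0 <= y Q) ->
  \sum_(Q <- s | p Q) f Q * i Q `^ eps * y Q `^ (1 - s1) * m Q <=
  V1 * (\sum_(Q <- s | p Q) y Q * m Q) `^ (1 - s1).

(** The geometric series of [sum_tail], with the exponent used in
    [level_split_bound], times the factor [e] of [sum_level]. *)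
Definition tail_cst : R :=
  (1 - (expR 1)^-1 `^ (eps / (1 - s1)))^-1 * expR 1.

(** Below [k0] the levels are counted. Above it, [c1 i] bounds the ratio of
    [W Q] to the mass of [Q], so that [ravg h <= c1 i (hm / W)] there; a power
    [eps] of this is traded against the exponent of [ravg h], and
    [(hm / W) `^ eps <= e ^ (- k0 eps)] absorbs the constant [c1]. *)
Lemma level_split_bound (k0 : nat) : c1 <= expR 1 ^+ k0 ->
  \sum_(Q <- s) f Q * ravg mu h Q `^ (1 - s0) * m Q <=
  V0 * (k0%:R * (expR 1 * K * H)) `^ (1 - s0) + V1 * (tail_cst * K * H) `^ (1 - s1).
Proof.
move=> c1k0.
have hm0 Q : 0 <= hm Q.
  by rewrite fine_ge0// integral_ge0// => x _; rewrite lee_fin.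
have H0 : 0 <= H.
  by rewrite -lee_fin; apply: le_trans hH; apply: integral_ge0 => x _; rewrite lee_fin.
have s0lt : 0 < 1 - s0 by rewrite subr_gt0 (lt_trans _ s11)// ltrDl.
have s1lt : 0 < 1 - s1 by rewrite subr_gt0.
have e0 : 0 < expR 1 :> R by exact: expR_gt0.
pose pos Q := 0 < hm Q.
pose sp := [seq Q <- s | pos Q].
have spP Q : Q \in sp -> Q \in s /\ pos Q by rewrite mem_filter => /andP[].
have stp : sparse_tree mu eta sp by exact: sparse_tree_filter.
have packWp P : P \in sp -> \sum_(Q <- sp | `[< Q `<=` P >]) W Q <= K * W P.
  move=> /spP[Ps _]; apply: le_trans (packW Ps).
  rewrite big_filter_cond big_mkcondl/= big_seq_cond [leRHS]big_seq_cond.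
  apply: ler_sum => Q /andP[Qs _].
  by case: ifP => // _; exact: ltW (W0 Qs).
have W0p Q : Q \in sp -> 0 < W Q by move=> /spP[/W0].
have goodp Q : Q \in sp -> 0 < hm Q <= W Q by move=> /spP[Qs hQ]; apply/andP; split => //; exact: good.
pose lev Q := level mu W h Q.
have -> : \sum_(Q <- s) f Q * ravg mu h Q `^ (1 - s0) * m Q =
    \sum_(Q <- s | pos Q) f Q * ravg mu h Q `^ (1 - s0) * m Q.
  rewrite [RHS]big_mkcond; apply: eq_bigr => Q _.
  case: ifPn => //; rewrite /pos lt_neqAle hm0 andbT negbK => /eqP hQ.
  by rewrite /ravg -hQ mul0r powR0 ?mulr0 ?mul0r// gt_eqF.
rewrite (bigID (fun Q => (lev Q < k0)%N))/=; apply: lerD.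
  apply: le_trans (HC0 _ (fun Q => ravg_ge0 mu Q h0)) _.
  rewrite ler_wpM2l// ge0_ler_powR ?(ltW s0lt) ?nnegrE//.
  - by rewrite sumr_ge0// => Q _; rewrite mulr_ge0 ?ravg_ge0 ?fine_ge0.
  - by rewrite !mulr_ge0// ltW.
  - have := @sum_head _ _ _ mu eta sp W h K H stp mh h0 hH W0p K0 packWp goodp k0.
    rewrite big_filter_cond; apply: le_trans.
    rewrite big_seq_cond [leRHS]big_seq_cond ler_sum// => Q /andP[Qs _].
    by rewrite /ravg mulfVK// gt_eqF// (mass_gt0 st Qs).
set delta := eps / (1 - s1).
have delta0 : 0 < delta by rewrite divr_gt0.
pose a Q := hm Q / W Q.
pose y Q := if Q \in s then ravg mu h Q * a Q `^ delta else 0.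
have y0 Q : 0 <= y Q by rewrite /y; case: ifP => // _; rewrite mulr_ge0 ?powR_ge0 ?ravg_ge0.
apply: (@le_trans _ _ (c1 `^ eps * \sum_(Q <- s | pos Q && ~~ (lev Q < k0)%N)
   f Q * i Q `^ eps * y Q `^ (1 - s1) * m Q)).
  rewrite mulr_sumr big_seq_cond [leRHS]big_seq_cond ler_sum// => Q /and3P[Qs hQ _].
  rewrite !mulrA ler_wpM2r ?fine_ge0//.
  have mQ := mass_gt0 st Qs; have WQ := W0 Qs.
  have r0 : 0 < ravg mu h Q by rewrite /ravg divr_gt0.
  have a0 : 0 < a Q by rewrite divr_gt0.
  (* split off the power [eps] of the average of [h], and use [Wi] on it *)
  have -> : 1 - s0 = eps + (1 - s1) by ring.
  rewrite powRD; last by rewrite (gt_eqF r0) implybT.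
  rewrite /y Qs [(_ * _) `^ (1 - s1)]powRM ?(ltW r0) ?powR_ge0//.
  rewrite -[(a Q `^ delta) `^ _]powRrM /delta divfK ?gt_eqF//.
  have : ravg mu h Q `^ eps <= c1 `^ eps * i Q `^ eps * a Q `^ eps.
    have le_r : ravg mu h Q <= c1 * i Q * a Q.
      rewrite /ravg /a ler_pdivrMr//.
      have -> : c1 * i Q * (hm Q / W Q) * m Q = hm Q * (c1 * i Q * m Q / W Q) by ring.
      by rewrite -[leLHS]mulr1 ler_pM2l// ler_pdivlMr// mul1r; exact: Wi.
    rewrite -powRM// -powRM ?(ltW a0) ?(mulr_ge0 c10 (i0 Q))//.
    apply: ge0_ler_powR; rewrite ?nnegrE ?(ltW eps0) ?(ltW r0)//.
    exact: le_trans (ltW r0) le_r.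
  move=> /(ler_wpM2l (f0 Q)) /(ler_wpM2r (powR_ge0 (ravg mu h Q) (1 - s1))).
  rewrite -!mulrA => /le_trans; apply.
  by rewrite le_eqVlt; apply/orP; left; apply/eqP; ring.
apply: le_trans (ler_wpM2l (powR_ge0 _ _) (HC1 _ y0)) _.
rewrite mulrCA ler_wpM2l//.
have le_tail : \sum_(Q <- s | pos Q && ~~ (lev Q < k0)%N) y Q * m Q <=
    (expR 1 ^+ k0)^-1 `^ delta * (tail_cst * K * H).
  have := @sum_tail _ _ _ mu eta sp W h K H stp mh h0 hH W0p K0 packWp goodp k0 delta delta0.
  rewrite /tail_cst -/delta -!mulrA big_filter_cond; apply: le_trans.
  rewrite [leRHS](eq_bigl (fun Q => pos Q && ~~ (lev Q < k0)%N)); last first.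
    by move=> Q; rewrite /lev leqNgt.
  rewrite big_seq_cond [leRHS]big_seq_cond ler_sum// => Q /andP[Qs _].
  by rewrite /y Qs /ravg /a mulrAC mulfVK// gt_eqF// (mass_gt0 st Qs).
have tail0 : 0 <= tail_cst.
  rewrite /tail_cst mulr_ge0 ?(ltW e0)// invr_ge0 subr_ge0 -/delta.
  by rewrite -expRN /powR gt_eqF ?expR_gt0// expRK mulrN1 expR_le1 oppr_le0 ltW.
have TKH : 0 <= tail_cst * K * H by apply: mulr_ge0 => //; apply: mulr_ge0.
have ek0 : 0 < expR 1 ^+ k0 :> R by rewrite exprn_gt0.
apply: (@le_trans _ _ (c1 `^ eps * ((expR 1 ^+ k0)^-1 `^ delta * (tail_cst * K * H)) `^ (1 - s1))).
  rewrite ler_wpM2l ?powR_ge0// ge0_ler_powR ?(ltW s1lt) ?nnegrE//.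
  - by rewrite sumr_ge0// => Q _; rewrite mulr_ge0 ?fine_ge0.
  - by rewrite mulr_ge0 ?powR_ge0.
rewrite powRM ?powR_ge0// -[(_ `^ delta) `^ _]powRrM /delta divfK ?gt_eqF//.
rewrite mulrA -powRM ?invr_ge0 ?(ltW ek0)//.
rewrite -[leRHS]mul1r ler_wpM2r ?powR_ge0//.
have one : 1 = 1 `^ eps :> R by rewrite powR1.
rewrite [leRHS]one; apply: ge0_ler_powR; rewrite ?nnegrE ?(ltW eps0)//.
  by rewrite divr_ge0// ltW.
by rewrite ler_pdivrMr// mul1r.
Qed.

End CoreBound.

(** * The A_1 condition *)

Lemma A1_const_ge0 (R : realType) (n : nat) (mu : {measure set euclidean R n -> \bar R})
  (w : euclidean R n -> R) : weight w -> (0 <= A1_const mu w)%E.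
Proof.
move=> ww; have dQ : dyadic (dyadic_cube (0 : 'rV[R]_n) 0 0).
  by exists 0 => [j|]; [rewrite mxE inE eqxx|exists 0, 0].
apply: le_trans (ereal_sup_ubound _); last by exists (dyadic_cube (0 : 'rV[R]_n) 0 0).
rewrite mule_ge0 ?poweR_ge0// inve_ge0; apply: ereal_sup_ubound.
by apply: aeW => x _; rewrite lee_fin ltW// ww.2.
Qed.

Lemma ln_A1_ge1 (R : realType) (n : nat) (mu : {measure set euclidean R n -> \bar R})
  (w : euclidean R n -> R) : weight w -> 1 <= ln (expR 1 + fine (A1_const mu w)).
Proof.
move=> ww; have A0 : 0 <= fine (A1_const mu w) by apply: fine_ge0; exact: A1_const_ge0.
by rewrite -[leLHS](expRK 1) ler_ln ?posrE ?ltr_wpDr ?expR_gt0// lerDl.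
Qed.

Section Weights.
Context {R : realType} {n : nat}.
Local Notation Rn := (euclidean R n).
Variable mu : {measure set Rn -> \bar R}.
Implicit Types (P Q B : set Rn) (alpha : 'rV[R]_n).
Hypothesis n0 : (0 < n)%N.
Hypothesis mu_balls : forall B, balls B -> (0 < mu B < +oo)%E.
Variable C : R.
Hypothesis C1 : 1 <= C.
Hypothesis muC : doubling_with mu C.
Variable w : Rn -> R.
Hypothesis ww : weight w.
Local Open Scope ereal_scope.

Lemma measurable_ball B : balls B -> measurable B.
Proof. by move=> [x [r [_ ->]]]; exact: measurable_eball. Qed.

Let mw D : measurable_fun D (EFin \o w).
Proof. by apply/measurable_EFinP; apply: measurable_funTS; exact: ww.1. Qed.

Let w0 x : 0 <= (w x)%:E. Proof. by rewrite lee_fin ltW// ww.2. Qed.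

Lemma weighted_ge0 D : 0 <= weighted mu w D.
Proof. by apply: integral_ge0 => x _. Qed.

Lemma le_weighted D D' : measurable D -> measurable D' -> D `<=` D' ->
  weighted mu w D <= weighted mu w D'.
Proof. by move=> mD mD'; apply: ge0_subset_integral => //; exact: mw. Qed.

Lemma weighted_gt0 D : measurable D -> 0 < mu D -> 0 < weighted mu w D.
Proof.
move=> mD D0; rewrite lt_neqAle weighted_ge0 andbT; apply: contraTneq D0 => wD0.
have : \int[mu]_(x in D) `|(EFin \o w) x| = 0.
  by rewrite [RHS]wD0; apply: eq_integral => x _; apply: gee0_abs; exact: w0.
move=> /(ae_eq_integral_abs mu mD (@mw D))[N [mN N0 subN]].
rewrite -leNgt -N0; apply: le_measure; rewrite ?inE// => x Dx.
by apply: subN => /= /(_ Dx) /eqP; rewrite eqe gt_eqF// ww.2.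
Qed.

Lemma average1E B : (0 < mu B < +oo) -> average mu 1 B w = (mu B)^-1 * weighted mu w B.
Proof.
move=> /andP[B0 By]; rewrite /average invr1 poweRe1.
  by congr (_ * _); apply: eq_integral => x _; rewrite powRr1// ger0_norm// ltW// ww.2.
by rewrite mule_ge0 ?inve_ge0 ?(ltW B0)// integral_ge0.
Qed.

(** The essential infimum is a supremum of lower bounds that hold almost
    everywhere; half of it is such a bound, which accounts for the factor 2. *)
Lemma A1_ess_inf Q : A1_const mu w < +oo -> dyadic Q ->
  exists i : R, [/\ (0 < i)%R, {ae mu, forall x, Q x -> (i <= w x)%R} &
    weighted mu w Q <= (2 * fine (A1_const mu w) * i)%:E * mu Q].
Proof.
move=> Ay [alpha sa gQ]; have [mQ /[dup] Q0y /andP[Q0 Qy]] := dyadic_cube_mass n0 mu_balls gQ.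
have muQ : mu Q = (fine (mu Q))%:E by rewrite fineK// ge0_fin_numE// ltW.
have m0 : (0 < fine (mu Q))%R by rewrite fine_gt0// Q0.
set A := A1_const mu w in Ay *.
have : average mu 1 Q w * (ess_inf_on mu Q (EFin \o w))^-1 <= A.
  by apply: ereal_sup_ubound; exists Q => //; exists alpha.
rewrite average1E//; set e := ess_inf_on _ _ _ => leA.
have wQ0 := weighted_gt0 mQ Q0.
have avg0 : 0 < (mu Q)^-1 * weighted mu w Q.
  by rewrite mule_gt0// muQ inver gt_eqF// lte_fin invr_gt0.
have e0 : 0 <= e.
  by apply: ereal_sup_ubound; apply: aeW => x _; exact: w0.
have eQ y : y%:E < e -> {ae mu, forall x, Q x -> (y <= w x)%R}.
  move=> /ereal_sup_gt[z zS yz]; apply: filterS zS => x zx Qx.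
  by rewrite -lee_fin (le_trans (ltW yz))// zx.
have ey : e < +oo.
  rewrite ltNge leye_eq; apply/negP => /eqP ey.
  have : {ae mu, forall x, forall N : nat, Q x -> (N%:R <= w x)%R}.
    by apply: ae_foralln => N; apply: eQ; rewrite ey ltry.
  move=> [N [mN N0 subN]]; move: Q0; rewrite ltNge => /negP; apply.
  rewrite -N0; apply: le_measure; rewrite ?inE// => x Qx; apply: subN => /= wx.
  have := wx (Num.truncn (w x)).+1 Qx; rewrite leNgt => /negP; apply.
  exact: truncnS_gt.
have e_fin : e = (fine e)%:E by rewrite fineK// ge0_fin_numE.
have ep : (0 < fine e)%R.
  rewrite lt_neqAle fine_ge0// andbT; apply/eqP => ez.
  move: leA; rewrite e_fin -ez inve0 gt0_muley// leye_eq => /eqP Ainf.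
  by rewrite Ainf ltxx in Ay.
move: leA; rewrite e_fin inver gt_eqF// => leA.
have A0 : 0 <= A.
  by apply: le_trans leA; rewrite mule_ge0 ?(ltW avg0)// lee_fin invr_ge0 ltW.
have A_fin : A = (fine A)%:E by rewrite fineK// ge0_fin_numE.
(* strictly below [e], hence a lower bound almost everywhere *)
exists (fine e / 2)%R; split; first by rewrite divr_gt0.
  by apply: eQ; rewrite e_fin lte_fin ltr_pdivrMr// ltr_pMr// ltr1n.
have avg_fin : weighted mu w Q \is a fin_num.
  rewrite ge0_fin_numE ?weighted_ge0// ltNge leye_eq; apply/negP => /eqP wy.
  move: leA; rewrite wy muQ inver gt_eqF// gt0_muley ?lte_fin ?invr_gt0//.
  rewrite gt0_mulye ?lte_fin ?invr_gt0// leye_eq => /eqP Ainf.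
  by rewrite Ainf ltxx in Ay.
move: leA; rewrite -(fineK avg_fin) A_fin muQ inver gt_eqF//= -!EFinM !lee_fin.
rewrite ler_pdivrMr// mulrC ler_pdivrMr// => /le_trans; apply.
by rewrite le_eqVlt; apply/orP; left; apply/eqP; field.
Qed.

(** A ball lies in a dyadic cube, and a finite A_1 constant leaves no room for
    a cube of infinite weight. *)
Lemma A1_weighted_ball B : A1_const mu w < +oo -> balls B -> weighted mu w B < +oo.
Proof.
move=> Ay /[dup] /measurable_ball mB [x [r [r0 BE]]].
have [alpha [k [m [sa sub _]]]] := ball_in_dyadic_cube x r0.
have dQ : dyadic (dyadic_cube alpha k m) by exists alpha => //; exists k, m.
have [i [i0 _ le_w]] := A1_ess_inf Ay dQ.
apply: (@le_lt_trans _ _ (weighted mu w (dyadic_cube alpha k m))).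
  by apply: le_weighted => //; [exact: measurable_dyadic_cube|rewrite BE].
apply: le_lt_trans le_w _.
have [|_ /andP[_ Qy]] := @dyadic_cube_mass _ _ n0 mu mu_balls alpha (dyadic_cube alpha k m).
  by exists k, m.
by rewrite -(@fineK _ (mu _)) ?ge0_fin_numE// -EFinM ltry.
Qed.

(** The dilate is contained in a dyadic cube of comparable mass, to which the
    A_1 condition applies. *)
Lemma A1_dilate alpha Q : A1_const mu w < +oo -> dyadic_grid alpha Q ->
  exists i : R, [/\ (0 <= i)%R, {ae mu, forall x, Q x -> (i <= w x)%R} &
    weighted mu w (dilate alpha Q) <=
    (2 * fine (A1_const mu w) * C ^+ (60 * n ^ 2) * i)%:E * mu Q].
Proof.
move=> Ay gQ; have [Q' [dQ' sub muQ']] := dilate_in_dyadic_cube n0 mu_balls C1 muC gQ.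
have [i [i0 wi le_w]] := A1_ess_inf Ay dQ'.
have mQ' : measurable Q'.
  by case: dQ' => beta _ /(dyadic_cube_mass n0 mu_balls)[].
have B0 := A1_const_ge0 mu ww.
exists i; split; first exact: ltW.
- by apply: filterS wi => x + /(sub_dilate n0 gQ) /sub => /[apply].
- apply: (@le_trans _ _ (weighted mu w Q')).
    by apply: le_weighted => //; apply: measurable_ball; exact: dilate_ball.
  apply: le_trans le_w _.
  have -> : (2 * fine (A1_const mu w) * C ^+ (60 * n ^ 2) * i)%:E =
     (2 * fine (A1_const mu w) * i)%:E * (C ^+ (60 * n ^ 2))%:E.
    by rewrite -EFinM; congr EFin; ring.
  rewrite -muleA; apply: lee_wpmul2l => //.
  by rewrite lee_fin !mulr_ge0 ?(ltW i0)// fine_ge0.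
Qed.

(** The maximal function is lower semicontinuous because balls are open. *)
Lemma measurable_maximal (f : Rn -> R) : measurable_fun setT (maximal mu f).
Proof.
apply: (measurability _ (ErealGenOInfty.measurableE R)).
move=> /= _ [_ [a ->]] <-; apply: measurableI => //; apply: measurable_open.
rewrite preimage_itvoy (_ : [set _ | _] = \bigcup_(B in
    [set B | balls B /\ a%:E < average mu 1 B f]) (B : set 'rV[R]_n)).
  by apply: bigcup_open => B [[x [r [_ ->]]] _]; exact: open_eball.
apply/seteqP; split => x /=.
  by move=> /ereal_sup_gt[_ [B [bB Bx] <-] aB]; exists B.
move=> [B [bB aB] Bx]; apply: (lt_le_trans aB).
by apply: ereal_sup_ubound; exists B.
Qed.

Lemma maximal_ge0 (f : Rn -> R) x : 0 <= maximal mu f x.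
Proof.
apply: (@le_trans _ _ (average mu 1 (eball x 1) f)); first exact: poweR_ge0.
apply: ereal_sup_ubound; exists (eball x 1) => //; split.
  by exists x, 1%R.
by rewrite eballE /= /edist big1 ?sqrtr0// => i _; rewrite subrr expr0n.
Qed.

End Weights.

(** * Sparse collections and the A_infinity condition *)

Section SparseCollections.
Context {R : realType} {n : nat}.
Local Notation Rn := (euclidean R n).
Variable mu : {measure set Rn -> \bar R}.
Implicit Types (P Q B : set Rn) (alpha : 'rV[R]_n) (S : set (set Rn)) (eta : R).
Hypothesis n0 : (0 < n)%N.
Hypothesis mu_balls : forall B, balls B -> (0 < mu B < +oo)%E.

Lemma sparse_sparse_tree eta S alpha (s : seq (set Rn)) :
  sparse mu eta S -> dyadic_shifts alpha -> uniq s ->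
  (forall Q, Q \in s -> (S `&` dyadic_grid alpha) Q) -> sparse_tree mu eta s.
Proof.
move=> [_ sS] sa us sg; have [E [tE EQ]] := sS alpha sa; split => //.
- by apply: dyadic_laminar sa _ => Q /sg[].
- by move=> Q /sg[_]; exact: dyadic_cube_mass.
- exists E; split; last by move=> Q /sg; exact: EQ.
  by apply: sub_trivIset tE => Q /= /sg.
Qed.

Definition shift_of (f : {ffun 'I_n -> 'I_3}) : 'rV[R]_n := \row_i ((f i)%:R / 3).

Lemma shift_ofP f : dyadic_shifts (shift_of f).
Proof.
move=> i; rewrite mxE; case: (f i) => -[|[|[|//]]] /= _.
- by rewrite mul0r inE eqxx.
- by rewrite !inE eqxx orbT.
- by rewrite !inE eqxx !orbT.
Qed.

Lemma shift_of_surj alpha : dyadic_shifts alpha -> exists f, alpha = shift_of f.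
Proof.
move=> sa; have coord i : exists j : 'I_3, alpha 0 i = j%:R / 3.
  have := sa i; rewrite !inE => /or3P[]/eqP->.
  - by exists ord0; rewrite mul0r.
  - by exists (@Ordinal 3 1 isT).
  - by exists (@Ordinal 3 2 isT).
have [f fE] := choice coord; exists [ffun i => f i].
by apply/rowP => i; rewrite mxE ffunE fE.
Qed.

(** There are [3 ^ n] grids, and a sum of nonnegative terms is the supremum of
    its finite partial sums. *)
Lemma esum_dyadic_le (a : set Rn -> \bar R) S (M : R) : (forall Q, 0 <= a Q)%E ->
  S `<=` dyadic ->
  (forall alpha, dyadic_shifts alpha -> forall s : seq (set Rn), uniq s ->
    (forall Q, Q \in s -> (S `&` dyadic_grid alpha) Q) ->
    \sum_(Q <- s) a Q <= M%:E)%E ->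
  (\esum_(Q in S) a Q <= (3 ^+ n * M)%:E)%E.
Proof.
move=> a0 Sd leM; apply: ge_ereal_sup => _ [F [finF FS] <-].
rewrite fsbig_finite//; set s := finmap.enum_fset _.
have us : uniq s by exact: finmap.fset_uniq.
have sF Q : Q \in s -> F Q by rewrite /s in_fset_set// inE.
apply: (@le_trans _ _ (\sum_(f : {ffun 'I_n -> 'I_3})
    \sum_(Q <- s | `[< dyadic_grid (shift_of f) Q >]) a Q)%E).
  rewrite (exchange_big_dep xpredT)//= big_seq [leRHS]big_seq lee_sum// => Q Qs.
  have [alpha sa gQ] := Sd _ (FS _ (sF _ Qs)).
  have [f fE] := shift_of_surj sa.
  rewrite (bigD1 f)/=; last by apply/asboolP; rewrite -fE.
  by rewrite leeDl// sume_ge0.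
apply: (@le_trans _ _ (\sum_(f : {ffun 'I_n -> 'I_3}) M%:E)%E).
  apply: lee_sum => f _; rewrite -big_filter; apply: leM (shift_ofP f) _ _ _.
    by rewrite filter_uniq.
  move=> Q; rewrite mem_filter => /andP[/asboolP gQ Qs]; split => //.
  exact: FS (sF _ Qs).
by rewrite sumEFin sumr_const card_ffun !card_ord -natrX mulr_natl.
Qed.

End SparseCollections.

Section AinftyPacking.
Context {R : realType} {n : nat}.
Local Notation Rn := (euclidean R n).
Variable mu : {measure set Rn -> \bar R}.
Implicit Types (P Q B : set Rn) (alpha : 'rV[R]_n).
Hypothesis n0 : (0 < n)%N.
Hypothesis mu_balls : forall B, balls B -> (0 < mu B < +oo)%E.
Variable C : R.
Hypothesis C1 : 1 <= C.
Hypothesis muC : doubling_with mu C.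
Variable w : Rn -> R.
Hypothesis ww : weight w.
Hypothesis wB : forall B, balls B -> (weighted mu w B < +oo)%E.
Local Open Scope ereal_scope.

Lemma weighted_ball B : balls B ->
  exists2 b : R, (0 < b)%R & weighted mu w B = b%:E.
Proof.
move=> bB; have /andP[B0 _] := mu_balls bB.
have := weighted_gt0 ww (measurable_ball bB) B0; have := wB bB.
case: (weighted mu w B) => [b| |]//; rewrite lte_fin => _ b0.
by exists b.
Qed.

Lemma Ainfty_ball B : balls B ->
  \int[mu]_(x in B) maximal mu (w \_ B) x <= Ainfty_const mu w * weighted mu w B.
Proof.
move=> bB; have [b b0 bE] := weighted_ball bB.
have : (weighted mu w B)^-1 * \int[mu]_(x in B) maximal mu (w \_ B) x <= Ainfty_const mu w.
  by apply: ereal_sup_ubound; exists B.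
by rewrite bE inver gt_eqF// lee_pdivrMl// muleC.
Qed.

Lemma average_restrict Q B : Q `<=` B -> average mu 1 Q (w \_ B) = average mu 1 Q w.
Proof.
move=> QB; rewrite /average; congr ((_ * _) `^ _).
by apply: eq_integral => x /set_mem Qx; rewrite patchE mem_set//; exact: QB.
Qed.

(** On a ball the maximal function of the restricted weight is at least its
    average over that ball. *)
Lemma Ainfty_ge1 : 1 <= Ainfty_const mu w.
Proof.
pose B : set Rn := eball 0 1.
have bB : balls B by exists 0%R, 1%R.
have mB := measurable_ball bB.
have [b b0 bE] := weighted_ball bB; have /andP[B0 By] := mu_balls bB.
have muB : mu B = (fine (mu B))%:E by rewrite fineK// ge0_fin_numE// ltW.
have m0 : (0 < fine (mu B))%R by rewrite fine_gt0// B0.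
have : weighted mu w B <= \int[mu]_(x in B) maximal mu (w \_ B) x.
  apply: (@le_trans _ _ (\int[mu]_(x in B) cst (average mu 1 B w) x)).
    rewrite integral_cst// average1E ?B0// bE muB inver gt_eqF// -!EFinM lee_fin.
    by rewrite mulrAC mulVf ?mul1r// gt_eqF.
  apply: ge0_le_integral => //.
  - by move=> x _; exact: poweR_ge0.
  - apply: measurable_funTS; exact: measurable_maximal.
  - move=> x Bx; rewrite /cst -(@average_restrict B B)//.
    by apply: ereal_sup_ubound; exists B.
move=> /le_trans /(_ (Ainfty_ball bB)); rewrite bE.
by rewrite -{1}[b%:E]mul1e lee_pmul2r// lte_fin.
Qed.

(** On [E Q] the maximal function of [w] restricted to the dilate of [P] is at
    least the average of [w] over the dilate of [Q]. The sets [E Q] being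
    disjoint, these contributions sum to at most the integral in the
    definition of the A_infinity constant. *)
Lemma Ainfty_packing eta (s : seq (set Rn)) alpha P : (0 < eta)%R ->
  sparse_tree mu eta s -> dyadic_shifts alpha ->
  (forall Q, Q \in s -> dyadic_grid alpha Q) -> P \in s ->
  Ainfty_const mu w < +oo ->
  (\sum_(Q <- s | `[< Q `<=` P >]) fine (weighted mu w (dilate alpha Q)) <=
   eta^-1 * C ^+ (60 * n ^ 2) * fine (Ainfty_const mu w) *
   fine (weighted mu w (dilate alpha P)))%R.
Proof.
move=> eta0 st sa sg Ps Ay.
set Cn := (C ^+ (60 * n ^ 2))%R.
have Cn0 : (0 < Cn)%R by rewrite exprn_gt0// (lt_le_trans ltr01).
have A_fin : Ainfty_const mu w \is a fin_num.
  by rewrite ge0_fin_numE// (le_trans _ Ainfty_ge1).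
have bP := dilate_ball n0 (sg _ Ps); have [p p0 pE] := weighted_ball bP.
have [us ls ms [E [tE EQ]]] := st.
pose W Q := fine (weighted mu w (dilate alpha Q)).
have WE Q : Q \in s -> weighted mu w (dilate alpha Q) = (W Q)%:E /\ (0 < W Q)%R.
  by move=> /sg/(dilate_ball n0)/weighted_ball[b b0 bE]; rewrite /W bE.
have low Q x : Q \in s -> Q `<=` P -> E Q x ->
    (W Q / (Cn * fine (mu Q)))%:E <= maximal mu (w \_ (dilate alpha P)) x.
  move=> Qs QP Ex; have [_ EQQ _] := EQ _ Qs; have gQ := sg _ Qs.
  have bQ := dilate_ball n0 gQ; have /andP[B0 By] := mu_balls bQ.
  have sub := dilate_mono n0 sa gQ (sg _ Ps) QP.
  apply: (@le_trans _ _ (average mu 1 (dilate alpha Q) (w \_ (dilate alpha P)))); last first.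
    apply: ereal_sup_ubound; exists (dilate alpha Q) => //; split => //.
    by apply: sub_dilate => //; exact: EQQ.
  rewrite average_restrict// average1E ?B0// (WE _ Qs).1.
  have [Q' [dQ' sub' muQ']] := dilate_in_dyadic_cube n0 mu_balls C1 muC gQ.
  have mQ' : measurable Q' by case: dQ' => beta _ /(dyadic_cube_mass n0 mu_balls)[].
  have : mu (dilate alpha Q) <= (Cn * fine (mu Q))%:E.
    apply: (@le_trans _ _ (mu Q')).
      by apply: le_measure; rewrite ?inE//; exact: measurable_ball.
    by rewrite EFinM -(mass_fin st Qs).
  have muB : mu (dilate alpha Q) = (fine (mu (dilate alpha Q)))%:E.
    by rewrite fineK// ge0_fin_numE// ltW.
  have m0 : (0 < fine (mu (dilate alpha Q)))%R by rewrite fine_gt0// B0.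
  rewrite muB lee_fin inver gt_eqF// -EFinM lee_fin => le_m.
  rewrite mulrC ler_wpM2r ?(ltW (WE _ Qs).2)// lef_pV2 ?posrE//.
  by rewrite mulr_gt0// (mass_gt0 st Qs).
pose r := [seq Q <- s | `[< Q `<=` P >]].
have rP Q : Q \in r -> Q \in s /\ Q `<=` P by rewrite mem_filter => /andP[/asboolP].
have mE Q : Q \in r -> measurable (E Q) /\ E Q `<=` dilate alpha P.
  move=> /rP[Qs QP]; have [mEQ EQQ _] := EQ _ Qs; split => // x /EQQ /QP.
  exact: sub_dilate (sg _ Ps) _.
have : \sum_(Q <- r) \int[mu]_(x in E Q) maximal mu (w \_ (dilate alpha P)) x <=
    Ainfty_const mu w * weighted mu w (dilate alpha P).
  apply: le_trans (Ainfty_ball bP).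
  apply: sum_integral_trivIset => //.
  - by rewrite filter_uniq.
  - by apply: sub_trivIset tE => Q /= /rP[].
  - exact: measurable_ball.
  - by apply: measurable_funTS; exact: measurable_maximal.
  - by move=> x _; exact: maximal_ge0.
move=> le_A.
rewrite -big_filter -/r -lee_fin -sumEFin.
apply: (@le_trans _ _ (\sum_(Q <- r) (eta^-1 * Cn)%:E *
    \int[mu]_(x in E Q) maximal mu (w \_ (dilate alpha P)) x)).
  rewrite big_seq [leRHS]big_seq lee_sum// => Q /[dup] /mE[mEQ _] /rP[Qs QP].
  have [_ _ le_m] := EQ _ Qs; have [_ W0] := WE _ Qs; have m0 := mass_gt0 st Qs.
  apply: (@le_trans _ _ ((eta^-1 * Cn)%:E * ((W Q / (Cn * fine (mu Q)))%:E * mu (E Q)))).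
    rewrite EFinM -muleA [Cn%:E * _]muleA -EFinM muleCA [eta^-1%:E * _]muleC -/(W Q).
    apply: (@le_trans _ _ ((Cn * (W Q / (Cn * fine (mu Q))))%:E * mu Q)).
      rewrite (mass_fin st Qs) -EFinM lee_fin le_eqVlt; apply/orP; left; apply/eqP.
      by field; rewrite !gt_eqF.
    rewrite [mu (E Q) * _]muleC; apply: lee_wpmul2l => //.
    by rewrite lee_fin !mulr_ge0 ?invr_ge0 ?mulr_ge0 ?(ltW Cn0) ?(ltW W0) ?(ltW m0).
  apply: lee_wpmul2l; first by rewrite lee_fin mulr_ge0 ?invr_ge0 ?ltW.
  rewrite -integral_cst//; apply: ge0_le_integral => //.
  - by move=> x _; rewrite lee_fin !mulr_ge0 ?invr_ge0 ?mulr_ge0 ?(ltW Cn0) ?(ltW W0) ?(ltW m0).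
  - by apply: measurable_funTS; exact: measurable_maximal.
  - by move=> x; exact: low.
rewrite -ge0_sume_distrr//; last first.
  by move=> Q _; apply: integral_ge0 => x _; exact: maximal_ge0.
apply: (@le_trans _ _ ((eta^-1 * Cn)%:E * (Ainfty_const mu w * weighted mu w (dilate alpha P)))).
  by apply: lee_wpmul2l => //; rewrite lee_fin mulr_ge0 ?invr_ge0 ?ltW.
by rewrite pE -(fineK A_fin) -!EFinM lee_fin /= !mulrA.
Qed.

End AinftyPacking.

(** * Sparse forms on a weighted set *)

Lemma powR_le1D (R : realType) (x r : R) : 0 <= x -> 0 <= r -> r <= 1 -> x `^ r <= 1 + x.
Proof.
move=> x0 r0 r1; have [x1|x1] := leP x 1; last first.
  by apply: le_trans (ler1_powR (ltW x1) r1) _; rewrite lerDr.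
have : x `^ r <= 1 `^ r by apply: ge0_ler_powR; rewrite ?nnegrE.
by rewrite powR1 => /le_trans; apply; rewrite lerDl.
Qed.

(** If [V > Y] the second term on the right dominates the first one, and
    [V `^ s1] can be divided out. *)
Lemma absorb (R : realType) (s0 s1 M V Y : R) : 0 <= s0 -> s0 < s1 -> s1 < 1 ->
  0 <= M -> 0 <= V -> 0 <= Y ->
  V <= M * (V `^ s0 * Y `^ (1 - s0) + V `^ s1 * Y `^ (1 - s1)) ->
  V <= Num.max 1 ((2 * M) `^ (1 - s1)^-1) * Y.
Proof.
move=> s00 s01 s11 M0 V0 Y0 le_V.
have s1p : 0 < 1 - s1 by rewrite subr_gt0.
have s0p : 0 < 1 - s0 by rewrite subr_gt0 (lt_trans s01).
set c := Num.max _ _; have c1 : 1 <= c by rewrite le_max lexx.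
have [VY|YV] := leP V Y.
  by apply: le_trans VY _; rewrite ler_peMl.
have Vp : 0 < V by exact: le_lt_trans YV.
have [Yz|Yn] := eqVneq Y 0.
  move: le_V; rewrite Yz !powR0 ?gt_eqF// !mulr0 addr0 mulr0 => le0.
  by move: Vp; rewrite ltNge le0.
have Yp : 0 < Y by rewrite lt_neqAle eq_sym Yn.
have le01 : V `^ s0 * Y `^ (1 - s0) <= V `^ s1 * Y `^ (1 - s1).
  have -> : s1 = s0 + (s1 - s0) by ring.
  have -> : 1 - s0 = (1 - (s0 + (s1 - s0))) + (s1 - s0) by ring.
  rewrite [V `^ (_ + _)]powRD ?(gt_eqF Vp) ?implybT//.
  rewrite [Y `^ (_ + _)]powRD ?(gt_eqF Yp) ?implybT//.
  rewrite -mulrA ler_wpM2l ?powR_ge0// mulrC ler_wpM2r ?powR_ge0//.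
  by rewrite ge0_ler_powR ?nnegrE ?subr_ge0 ?(ltW s01) ?(ltW YV).
have le_V1 : V <= 2 * M * (V `^ s1 * Y `^ (1 - s1)).
  apply: le_trans le_V _; rewrite [2 * M]mulrC -mulrA ler_wpM2l//.
  by rewrite mulr_natl mulr2n lerD2r.
have le_V2 : V `^ (1 - s1) <= 2 * M * Y `^ (1 - s1).
  have VE : V = V `^ (1 - s1) * V `^ s1.
    by rewrite -powRD ?subrK ?powRr1// (gt_eqF Vp) implybT.
  have : V `^ (1 - s1) * V `^ s1 <= 2 * M * Y `^ (1 - s1) * V `^ s1.
    by rewrite -VE -mulrA [Y `^ _ * _]mulrC.
  by rewrite ler_pM2r// powR_gt0.
have : (V `^ (1 - s1)) `^ (1 - s1)^-1 <= (2 * M * Y `^ (1 - s1)) `^ (1 - s1)^-1.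
  apply: ge0_ler_powR; rewrite ?nnegrE ?powR_ge0 ?mulr_ge0 ?powR_ge0//.
  by rewrite invr_ge0 ltW.
rewrite -powRrM mulfV ?gt_eqF// powRr1// powRM ?powR_ge0 ?mulr_ge0//.
rewrite -powRrM mulfV ?gt_eqF// powRr1// => /le_trans; apply.
by rewrite ler_wpM2r// le_max lexx orbT.
Qed.

Section FormBound.
Context {R : realType} {n : nat}.
Local Notation Rn := (euclidean R n).
Variable mu : {measure set Rn -> \bar R}.
Implicit Types (P Q B : set Rn) (alpha : 'rV[R]_n).
Hypothesis n0 : (0 < n)%N.
Hypothesis mu_balls : forall B, balls B -> (0 < mu B < +oo)%E.
Variable C : R.
Hypothesis C1 : 1 <= C.
Hypothesis muC : doubling_with mu C.
Variable w : Rn -> R.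
Hypothesis ww : weight w.
Hypothesis A1w : (A1_const mu w < +oo)%E.
Hypothesis Ay : (Ainfty_const mu w < +oo)%E.
Local Notation A1c := (fine (A1_const mu w)).
Local Notation Ac := (fine (Ainfty_const mu w)).
Local Notation Cn := (C ^+ (60 * n ^ 2)).

Variables (eta p0 s0 : R).
Hypotheses (eta0 : 0 < eta) (p01 : 1 <= p0) (s00 : 0 <= s0) (s0p0 : s0 < p0^-1).
Local Notation tau := (p0^-1).
(** Half of the room between [s0] and [1/p0]: the raised exponent must stay
    below [1/p0] for the Carleson embedding to apply. *)
Definition gain : R := (p0^-1 - s0) / 2.
Local Notation s1 := (s0 + gain).

(** At [t = 0] the embedding is replaced by the trivial bound of the averages
    of a function bounded by one. *)
Definition embedding_cst (t : R) : R := if t == 0 then 1 else carleson_cst eta (tau / t) `^ t.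

Variables (h phi : Rn -> R) (E : set Rn) (H V : R).
Hypotheses (mh : measurable_fun setT h) (h0 : forall x, 0 <= h x).
Hypothesis hH : (\int[mu]_x (h x)%:E <= H%:E)%E.
Hypotheses (mE : measurable E) (wE : weighted mu w E = V%:E).
Hypotheses (mphi : measurable_fun setT phi).
Hypothesis phiE : forall x, `|phi x| <= if x \in E then w x `^ s0 else 0.

Let tau0 : 0 < tau. Proof. by rewrite invr_gt0 (lt_le_trans ltr01). Qed.
Let tau1 : tau <= 1. Proof. by rewrite invf_le1// (lt_le_trans ltr01). Qed.
Let gain0 : 0 < gain. Proof. by rewrite divr_gt0// subr_gt0. Qed.
Let s1tau : s1 < tau. Proof. by have := s0p0; rewrite /gain; lra. Qed.
Let s1_gt0 : 0 < s1. Proof. by rewrite ltr_wpDl. Qed.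
Let V0 : 0 <= V. Proof. by rewrite -lee_fin -wE; exact: weighted_ge0. Qed.
Let H0 : 0 <= H.
Proof.
by rewrite -lee_fin; apply: le_trans hH; apply: integral_ge0 => x _; rewrite lee_fin.
Qed.
Let p00 : 0 < p0. Proof. exact: lt_le_trans p01. Qed.

Let mabs_phi : measurable_fun setT (fun x => `|phi x|).
Proof. exact: measurableT_comp. Qed.

Lemma integral_le_weightedE (G : Rn -> R) : measurable_fun setT G ->
  (forall x, 0 <= G x) -> (forall x, G x <= if x \in E then w x else 0) ->
  (\int[mu]_x (G x)%:E <= V%:E)%E.
Proof.
move=> mG G0 GE; rewrite -wE /weighted [leRHS]integral_mkcond.
apply: ge0_le_integral => //.
- by move=> x _; rewrite lee_fin.
- exact/measurable_EFinP.
- apply/(measurable_restrictT _ _).1 => //; apply/measurable_EFinP.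
  by apply: measurable_funTS; exact: ww.1.
- move=> x _; rewrite /patch; have := GE x; case: ifP => _; rewrite lee_fin//.
Qed.

Let G0 x := `|phi x| `^ p0.
Let mG0 : measurable_fun setT G0. Proof. exact: measurable_powRr. Qed.
Let G0_ge0 x : 0 <= G0 x. Proof. exact: powR_ge0. Qed.

(** The bound [phi <= w `^ s0] on [E] makes the power of [phi] in the Carleson
    embedding integrate to [w(E)]. *)
Lemma form_head (s : seq (set Rn)) (y : set Rn -> R) : sparse_tree mu eta s ->
  (forall Q, 0 <= y Q) ->
  \sum_(Q <- s) ravg mu G0 Q `^ tau * y Q `^ (1 - s0) * fine (mu Q) <=
  embedding_cst s0 * V `^ s0 * (\sum_(Q <- s) y Q * fine (mu Q)) `^ (1 - s0).
Proof.
move=> st y0; rewrite /embedding_cst; have [s0z|s0n] := eqVneq s0 0.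
  rewrite s0z powRr0 mulr1 subr0 powRr1; last first.
    by rewrite sumr_ge0// => Q _; rewrite mulr_ge0 ?fine_ge0.
  rewrite mul1r big_seq [leRHS]big_seq ler_sum// => Q Qs.
  rewrite ler_wpM2r ?fine_ge0// powRr1// ler_piMl//.
  have one t : 1 = 1 `^ t :> R by rewrite powR1.
  rewrite [leRHS](one tau); apply: ge0_ler_powR; rewrite ?nnegrE ?(ltW tau0) ?ravg_ge0//.
  rewrite ler_pdivrMr ?(mass_gt0 st Qs)// mul1r.
  have [_ _ ms _] := st; have [mQ /andP[Q0 Qy]] := ms _ Qs.
  have le_mu : (\int[mu]_(x in Q) (G0 x)%:E <= mu Q)%E.
    rewrite -[leRHS]mul1e -integral_cst//; apply: ge0_le_integral => //.
    - by move=> x _; rewrite lee_fin.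
    - by apply/measurable_EFinP; exact: measurable_funTS.
    - move=> x _; rewrite lee_fin [leRHS](one p0); apply: ge0_ler_powR; rewrite ?nnegrE ?(ltW p00)//.
      by have := phiE x; rewrite s0z powRr0; case: ifP => // _ /le_trans; apply.
  apply: fine_le => //; rewrite ge0_fin_numE//; first exact: le_lt_trans le_mu Qy.
  by apply: integral_ge0 => x _; rewrite lee_fin.
have s0p : 0 < s0 by rewrite lt_neqAle eq_sym s0n.
rewrite -powRM//; last by apply: carleson_cst_ge0 => //; rewrite ltr_pdivlMr// mul1r.
apply: carleson_holder => //.
apply: integral_le_weightedE => [|x|x]; [exact: measurable_powRr|exact: powR_ge0|].
rewrite /G0 -powRrM mulrA mulfV ?gt_eqF// mul1r.
have -> : (if x \in E then w x else 0) = (if x \in E then w x `^ s0 else 0) `^ s0^-1.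
  by case: ifP => _; rewrite -?powRrM ?mulfV ?powRr1 ?powR0 ?invr_eq0 ?(ltW (ww.2 x)).
apply: ge0_ler_powR; rewrite ?nnegrE ?invr_ge0//.
by case: ifP => // _; exact: powR_ge0.
Qed.

(** Since [i Q <= w] on [Q], the factor [i Q `^ gain] can be moved inside the
    average, where it is absorbed by [w `^ gain]. The new function is of the
    same kind as [phi], with [s1] in place of [s0]. *)
Lemma form_tail (s : seq (set Rn)) (y i : set Rn -> R) : sparse_tree mu eta s ->
  (forall Q, 0 <= y Q) -> (forall Q, 0 <= i Q) ->
  (forall Q, Q \in s -> {ae mu, forall x, Q x -> i Q <= w x}) ->
  \sum_(Q <- s) ravg mu G0 Q `^ tau * i Q `^ gain * y Q `^ (1 - s1) * fine (mu Q) <=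
  embedding_cst s1 * V `^ s1 * (\sum_(Q <- s) y Q * fine (mu Q)) `^ (1 - s1).
Proof.
move=> st y0 i0 iw; rewrite /embedding_cst gt_eqF//.
pose F x := if x \in E then w x else 0.
have F0 x : 0 <= F x by rewrite /F; case: ifP => // _; rewrite ltW// ww.2.
have mF : measurable_fun setT F.
  apply: measurable_fun_ifT => //; last exact: ww.1.
  by apply: (measurable_fun_bool true); rewrite setTI preimage_mem_true.
pose G1 x := F x `^ (s1 * p0).
have mG1 : measurable_fun setT G1 by exact: measurable_powRr.
have G10 x : 0 <= G1 x by exact: powR_ge0.
rewrite -powRM//; last by apply: carleson_cst_ge0 => //; rewrite ltr_pdivlMr// mul1r.
have intG1 : (\int[mu]_x (G1 x `^ (tau / s1))%:E <= V%:E)%E.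
  apply: integral_le_weightedE => [|x|x]; [exact: measurable_powRr|exact: powR_ge0|].
  rewrite /G1 -powRrM (_ : s1 * p0 * (tau / s1) = 1) ?powRr1//.
  by field; rewrite !gt_eqF.
apply: le_trans (carleson_holder eta0 s1_gt0 s1tau tau1 st mG1 G10 y0 intG1).
rewrite big_seq [leRHS]big_seq ler_sum// => Q Qs.
rewrite ler_wpM2r ?fine_ge0// ler_wpM2r ?powR_ge0//.
have [_ _ ms _] := st; have [mQ /andP[Q0 Qy]] := ms _ Qs.
pose c := i Q `^ (gain * p0).
have c0 : 0 <= c by exact: powR_ge0.
have s1p0 : 0 <= s1 * p0 by rewrite mulr_ge0// ltW.
have -> : i Q `^ gain = c `^ tau by rewrite /c -powRrM mulfK// gt_eqF.
rewrite -powRM ?ravg_ge0//; apply: ge0_ler_powR; rewrite ?nnegrE ?ravg_ge0 ?(ltW tau0)//.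
  by apply: mulr_ge0 c0; exact: ravg_ge0.
rewrite /ravg mulrAC ler_wpM2r ?invr_ge0 ?fine_ge0//.
have int0 (G : Rn -> R) : (forall x, 0 <= G x) -> (0 <= \int[mu]_(x in Q) (G x)%:E)%E.
  by move=> G_ge0; apply: integral_ge0 => x _; rewrite lee_fin.
have [fin0|/negbTE nfin0] := boolP (\int[mu]_(x in Q) (G0 x)%:E \is a fin_num)%E; last first.
  have := int0 _ G0_ge0; move: nfin0; case: (\int[mu]_(x in Q) (G0 x)%:E)%E => //= _ _.
  by rewrite mul0r fine_ge0// int0.
have le_int : ((fine (\int[mu]_(x in Q) (G0 x)%:E)%E * c)%:E <= \int[mu]_(x in Q) (G1 x)%:E)%E.
  rewrite EFinM fineK// muleC -ge0_integralZl_EFin//; last 2 first.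
  - by move=> x _; rewrite lee_fin.
  - by apply/measurable_EFinP; exact: measurable_funTS.
  apply: ae_ge0_le_integral => //.
  - by move=> x _; rewrite lee_fin mulr_ge0.
  - by apply/measurable_EFinP; apply: measurable_funTS; exact: measurable_funM.
  - by move=> x _; rewrite lee_fin.
  - by apply/measurable_EFinP; exact: measurable_funTS.
  apply: filterS (iw _ Qs) => x ix Qx; rewrite -EFinM lee_fin /G0 /G1 /F /c.
  have := phiE x; case: ifP => xE => phix; last first.
    have /eqP : `|phi x| = 0 by apply/eqP; rewrite eq_le phix normr_ge0.
    by rewrite normr_eq0 => /eqP ->; rewrite normr0 [0 `^ p0]powR0 ?(gt_eqF p00)// mulr0; exact: powR_ge0.
  have -> : w x `^ (s1 * p0) = w x `^ (gain * p0) * (w x `^ s0) `^ p0.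
    by rewrite -powRrM -powRD ?(gt_eqF (ww.2 x)) ?implybT//; congr powR; ring.
  apply: ler_pM; rewrite ?powR_ge0//; apply: ge0_ler_powR; rewrite ?nnegrE ?powR_ge0 ?(ltW p00)//.
  - by rewrite mulr_ge0// ltW.
  - by rewrite ltW// ww.2.
  - exact: ix.
suff fin1 : (\int[mu]_(x in Q) (G1 x)%:E)%E \is a fin_num.
  by rewrite -lee_fin (fineK fin1).
rewrite ge0_fin_numE; last exact: int0.
have : (\int[mu]_(x in Q) (G1 x)%:E <= \int[mu]_(x in Q) (1 + (F x)%:E))%E.
  apply: ge0_le_integral => //.
  - by move=> x _; rewrite lee_fin.
  - by apply/measurable_EFinP; exact: measurable_funTS.
  - by apply: emeasurable_funD => //; apply/measurable_EFinP; exact: measurable_funTS.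
  - move=> x _; rewrite -EFinD lee_fin /G1.
    have s1p01 : s1 * p0 <= 1 by rewrite -ler_pdivlMr// mul1r ltW.
    exact: powR_le1D.
move=> /le_lt_trans; apply.
rewrite ge0_integralD//; last 2 first.
- by move=> x _; rewrite lee_fin.
- by apply/measurable_EFinP; exact: measurable_funTS.
rewrite (integral_cst mu mQ 1) mul1e lte_add_pinfty//.
apply: (@le_lt_trans _ _ (\int[mu]_x (F x)%:E)%E).
  apply: ge0_subset_integral => //; first exact/measurable_EFinP.
  by move=> x _; rewrite lee_fin.
by apply: le_lt_trans (integral_le_weightedE mF F0 _) (ltry V).
Qed.

(** A cube that does not meet [E] contributes nothing, and the others are
    good. The bounds required by [level_split_bound] are the A_infinity
    packing, the A_1 condition on dilates, and [form_head] and [form_tail]. *)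
Lemma form_bound alpha (s : seq (set Rn)) (k0 : nat) :
  dyadic_shifts alpha -> (forall Q, Q \in s -> dyadic_grid alpha Q) ->
  sparse_tree mu eta s ->
  (forall Q x, Q \in s -> Q x -> E x ->
     (\int[mu]_(y in Q) (h y)%:E <= weighted mu w (dilate alpha Q))%E) ->
  2 * A1c * Cn <= expR 1 ^+ k0 ->
  \sum_(Q <- s) ravg mu G0 Q `^ tau * ravg mu h Q `^ (1 - s0) * fine (mu Q) <=
  embedding_cst s0 * V `^ s0 * (k0%:R * (expR 1 * (eta^-1 * Cn * Ac) * H)) `^ (1 - s0) +
  embedding_cst s1 * V `^ s1 * (tail_cst s0 gain * (eta^-1 * Cn * Ac) * H) `^ (1 - s1).
Proof.
move=> sa sg st goodE c1k0; set K := eta^-1 * Cn * Ac.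
have wB B : balls B -> (weighted mu w B < +oo)%E by exact: A1_weighted_ball.
pose W Q := fine (weighted mu w (dilate alpha Q)).
pose good Q := fine (\int[mu]_(y in Q) (h y)%:E)%E <= W Q.
have carl0 t : 0 <= t -> t < tau -> 0 <= embedding_cst t.
  by move=> t0 tt; rewrite /embedding_cst; case: ifP => // _; exact: powR_ge0.
pose sgd := [seq Q <- s | good Q].
have stg : sparse_tree mu eta sgd by exact: sparse_tree_filter.
have sgdP Q : Q \in sgd -> good Q /\ Q \in s by rewrite mem_filter => /andP.
have -> : \sum_(Q <- s) ravg mu G0 Q `^ tau * ravg mu h Q `^ (1 - s0) * fine (mu Q) =
  \sum_(Q <- sgd) ravg mu G0 Q `^ tau * ravg mu h Q `^ (1 - s0) * fine (mu Q).
  rewrite big_filter [RHS]big_mkcond; apply: eq_big_seq => Q Qs.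
  case: ifPn => // /negP bad.
  have Q0 x : Q x -> ~ E x.
    move=> Qx Ex; apply: bad; rewrite /good /W fine_le//; last exact: goodE Qs Qx Ex.
    - have := goodE _ _ Qs Qx Ex; rewrite ge0_fin_numE; last first.
        by apply: integral_ge0 => y _; rewrite lee_fin.
      by move=> /le_lt_trans; apply; apply: wB; apply: dilate_ball => //; exact: sg.
    - rewrite ge0_fin_numE ?weighted_ge0//; apply: wB.
      by apply: dilate_ball => //; exact: sg.
  rewrite {1}/ravg (_ : (\int[mu]_(x in Q) (G0 x)%:E = 0)%E) ?mul0r ?powR0 ?gt_eqF ?mul0r//.
  rewrite integral0_eq// => x Qx; have := phiE x.
  rewrite memNset; last exact: Q0.
  by rewrite normr_le0 /G0 => /eqP ->; rewrite normr0 powR0// gt_eqF.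
have /choice[i iP] Q : exists i : R, 0 <= i /\ (Q \in s ->
   {ae mu, forall x, Q x -> i <= w x} /\
   (weighted mu w (dilate alpha Q) <= (2 * A1c * Cn * i)%:E * mu Q)%E).
  have [Qs|Qs] := boolP (Q \in s); last by exists 0; rewrite lexx.
  have [i [i0 iw le_w]] := A1_dilate n0 mu_balls C1 muC ww A1w (sg _ Qs).
  by exists i; split.
have A1_ge0 : 0 <= A1c.
  by apply: fine_ge0; exact: A1_const_ge0.
have Cn0 : 0 <= Cn by rewrite exprn_ge0// (le_trans ler01).
apply: (@level_split_bound _ _ _ mu eta sgd W h K H stg mh h0 hH _ _ _ _ (fun Q => ravg mu G0 Q `^ tau)
   i _ _ s0 gain (2 * A1c * Cn)) => //.
- move=> Q /sgdP[_ Qs]; have [b b0 bE] := weighted_ball mu_balls ww wB (dilate_ball n0 (sg _ Qs)).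
  by rewrite /W bE.
- by rewrite !mulr_ge0 ?invr_ge0 ?(ltW eta0)// fine_ge0// (le_trans _ (Ainfty_ge1 mu_balls ww wB)).
- move=> P /sgdP[_ Ps]; have := Ainfty_packing n0 mu_balls C1 muC ww wB eta0 st sa sg Ps Ay.
  apply: le_trans; rewrite big_filter_cond big_mkcondl/=.
  apply: ler_sum => Q _; rewrite /W; case: ifP => // _.
  by rewrite fine_ge0// weighted_ge0.
- by move=> Q /sgdP[].
- by move=> Q; exact: powR_ge0.
- by move=> Q; have [] := iP Q.
- exact: lt_le_trans s1tau tau1.
- by rewrite !mulr_ge0.
- by rewrite mulr_ge0 ?carl0 ?powR_ge0.
- by rewrite mulr_ge0 ?carl0 ?powR_ge0// ltW.
- move=> Q /sgdP[_ Qs]; have [i0 /(_ Qs)[_]] := iP Q.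
  have [b b0 bE] := weighted_ball mu_balls ww wB (dilate_ball n0 (sg _ Qs)).
  by rewrite /W bE (mass_fin st Qs) -EFinM lee_fin.
- by move=> p y y0; rewrite -[X in X <= _]big_filter -[X in _ <= _ * X `^ _]big_filter; apply: form_head => //; exact: sparse_tree_filter.
- move=> p y y0; rewrite -[X in X <= _]big_filter -[X in _ <= _ * X `^ _]big_filter; apply: form_tail => //.
  + exact: sparse_tree_filter.
  + by move=> Q; have [] := iP Q.
  + by move=> Q; rewrite mem_filter => /andP[_ /sgdP[_ Qs]]; have [_ /(_ Qs)[]] := iP Q.
Qed.

End FormBound.

(** * Averages, powers and test functions *)

Lemma powRD_le (R : realType) (x y r : R) : 0 <= x -> 0 <= y -> 0 <= r ->
  (x + y) `^ r <= 2 `^ r * (x `^ r + y `^ r).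
Proof.
move=> x0 y0 r0; have [xy|yx] := leP x y.
  apply: (@le_trans _ _ ((2 * y) `^ r)).
    by apply: ge0_ler_powR; rewrite ?nnegrE ?addr_ge0 ?mulr_ge0//; lra.
  by rewrite powRM// ler_wpM2l ?powR_ge0// lerDr powR_ge0.
apply: (@le_trans _ _ ((2 * x) `^ r)).
  by apply: ge0_ler_powR; rewrite ?nnegrE ?addr_ge0 ?mulr_ge0//; lra.
by rewrite powRM// ler_wpM2l ?powR_ge0// lerDl powR_ge0.
Qed.

Lemma powR_quasi_add (R : realType) (x y z p : R) : 1 <= p ->
  0 <= x -> 0 <= y -> 0 <= z -> z <= 2 `^ p * (x + y) ->
  z `^ p^-1 <= 4 * (x `^ p^-1 + y `^ p^-1).
Proof.
move=> p1 x0 y0 z0 le_z; have p0 : 0 < p by rewrite (lt_le_trans ltr01).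
have pV0 : 0 <= p^-1 by rewrite invr_ge0 ltW.
have pV1 : p^-1 <= 1 by rewrite invf_le1.
apply: (@le_trans _ _ ((2 `^ p * (x + y)) `^ p^-1)).
  by apply: ge0_ler_powR; rewrite ?nnegrE// (le_trans z0).
rewrite powRM ?powR_ge0 ?addr_ge0// -powRrM mulfV ?gt_eqF// powRr1//.
apply: (@le_trans _ _ (2 * (2 `^ p^-1 * (x `^ p^-1 + y `^ p^-1)))).
  by rewrite ler_wpM2l// powRD_le.
rewrite mulrA ler_wpM2r ?addr_ge0 ?powR_ge0//.
have : 2 `^ p^-1 <= 2 :> R by rewrite -[leRHS]powRr1// ler_powR// ler1n.
lra.
Qed.

Section Averages.
Context {R : realType} {n : nat}.
Local Notation Rn := (euclidean R n).
Variable mu : {measure set Rn -> \bar R}.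
Implicit Types (P Q B : set Rn) (alpha : 'rV[R]_n) (f g : Rn -> R) (p r : R).
Local Open Scope ereal_scope.

Definition pint p f : \bar R := \int[mu]_x (`|f x| `^ p)%:E.

Lemma pint_ge0 p f : 0 <= pint p f.
Proof. by apply: integral_ge0 => x _; rewrite lee_fin powR_ge0. Qed.

Lemma measurable_pabs p f D : measurable_fun setT f ->
  measurable_fun D (fun x => `|f x| `^ p)%R.
Proof.
move=> mf; apply: measurable_funTS; apply: measurable_powRr.
exact: measurableT_comp.
Qed.

Lemma pint_fin p f : pint p f < +oo ->
  exists2 a : R, (0 <= a)%R & pint p f = a%:E.
Proof.
move: (pint_ge0 p f); case: (pint p f) => [a| |]//.
by rewrite lee_fin => a0 _; exists a.
Qed.

(** The constant is crude: only smallness and finiteness are drawn from it. *)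
Lemma pint_lin p (a : R) f g : (0 <= p)%R ->
  measurable_fun setT f -> measurable_fun setT g ->
  pint p (fun x => a * f x + g x)%R <=
  (2 `^ p)%:E * ((`|a| `^ p)%:E * pint p f + pint p g).
Proof.
move=> p0 mf mg; rewrite /pint.
have mpf := @measurable_pabs p f setT mf; have mpg := @measurable_pabs p g setT mg.
rewrite -ge0_integralZl_EFin//; last exact/measurable_EFinP.
rewrite -ge0_integralD//; last 2 first.
- by apply: measurable_funeM; exact/measurable_EFinP.
- exact/measurable_EFinP.
rewrite -ge0_integralZl_EFin//; last 2 first.
- by move=> x _; rewrite -EFinM -EFinD lee_fin addr_ge0// mulr_ge0 ?powR_ge0.
- apply: emeasurable_funD; last exact/measurable_EFinP.
  by apply: measurable_funeM; exact/measurable_EFinP.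
apply: ge0_le_integral => //.
- apply/measurable_EFinP; apply: measurable_pabs.
  by apply: measurable_funD => //; exact: measurable_funM.
- apply: measurable_funeM; apply: emeasurable_funD; last exact/measurable_EFinP.
  by apply: measurable_funeM; exact/measurable_EFinP.
move=> x _; rewrite -EFinM lee_fin -powRM//.
apply: le_trans (powRD_le _ _ p0) => //.
apply: ge0_ler_powR; rewrite ?nnegrE//.
by rewrite -normrM ler_normD.
Qed.

Lemma pint_lin_lty p (a : R) f g : (0 <= p)%R ->
  measurable_fun setT f -> measurable_fun setT g ->
  pint p f < +oo -> pint p g < +oo -> pint p (fun x => a * f x + g x)%R < +oo.
Proof.
move=> p0 mf mg fp gp; apply: le_lt_trans (pint_lin a p0 mf mg) _.
have [x _ ->] := pint_fin fp; have [y _ ->] := pint_fin gp.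
by rewrite -!EFinM ltry.
Qed.

Lemma pint_local_lty p r f Q : (0 <= r)%R -> (r <= p)%R -> measurable_fun setT f ->
  measurable Q -> mu Q < +oo -> pint p f < +oo ->
  \int[mu]_(x in Q) (`|f x| `^ r)%:E < +oo.
Proof.
move=> r0 rp mf mQ Qy fp.
have mp := measurable_pabs; apply: (@le_lt_trans _ _ (\int[mu]_(x in Q) (1 + (`|f x| `^ p)%:E))).
  apply: ge0_le_integral => //.
  - by apply/measurable_EFinP; exact: mp.
  - by apply: emeasurable_funD => //; apply/measurable_EFinP; exact: mp.
  - move=> x _; rewrite -EFinD lee_fin.
    have [f1|f1] := leP `|f x|%R 1%R.
      have : (`|f x| `^ r <= 1 `^ r)%R by apply: ge0_ler_powR; rewrite ?nnegrE.
      by rewrite powR1 => /le_trans; apply; rewrite lerDl powR_ge0.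
    apply: (@le_trans _ _ (`|f x| `^ p)%R); last by rewrite lerDr.
    by apply: ler_powR => //; exact: ltW.
rewrite ge0_integralD//; last by apply/measurable_EFinP; exact: mp.
rewrite (integral_cst mu mQ 1) mul1e lte_add_pinfty//.
apply: le_lt_trans fp; apply: ge0_subset_integral => //.
by apply/measurable_EFinP; exact: mp.
Qed.

Lemma averageE p Q f : (0 < p)%R -> 0 < mu Q < +oo ->
  \int[mu]_(x in Q) (`|f x| `^ p)%:E < +oo ->
  average mu p%:E Q f = (ravg mu (fun x => `|f x| `^ p) Q `^ p^-1)%:E.
Proof.
move=> p0 /andP[Q0 Qy] fin.
have Qf : mu Q \is a fin_num by rewrite ge0_fin_numE ?(ltW Q0).
have m0 : (0 < fine (mu Q))%R by rewrite fine_gt0// Q0.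
rewrite /average /ravg -[in mu Q](fineK Qf) inver gt_eqF// -poweR_EFin; congr (_ `^ _).
rewrite -[X in _ * X]fineK ?ge0_fin_numE ?integral_ge0//.
by rewrite -EFinM mulrC.
Qed.

Lemma ravg_scale (c : R) f Q : (0 <= c)%R -> measurable Q -> measurable_fun setT f ->
  (forall x, (0 <= f x)%R) -> ravg mu (fun x => c * f x)%R Q = (c * ravg mu f Q)%R.
Proof.
move=> c0 mQ mf f0; rewrite /ravg mulrA; congr (_ / _)%R.
under eq_integral do rewrite EFinM.
rewrite ge0_integralZl_EFin//; last 2 first.
- by move=> x _; rewrite lee_fin.
- by apply/measurable_EFinP; exact: measurable_funTS.
have : 0 <= \int[mu]_(x in Q) (f x)%:E by apply: integral_ge0 => x _; rewrite lee_fin.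
case: (\int[mu]_(x in Q) (f x)%:E) => [r| |]//= _.
have [->|cn] := eqVneq c 0%R; first by rewrite mul0e mul0r.
have cp : 0 < c%:E by rewrite lte_fin lt_neqAle eq_sym cn c0.
by rewrite gt0_muley//= mulr0.
Qed.

(** A quasi-triangle inequality with a crude constant, which suffices for the
    approximation argument of [dual_bound]. *)
Lemma ravg_add p Q f g : (1 <= p)%R -> measurable Q ->
  measurable_fun setT f -> measurable_fun setT g ->
  \int[mu]_(x in Q) (`|f x| `^ p)%:E < +oo ->
  \int[mu]_(x in Q) (`|g x| `^ p)%:E < +oo ->
  (ravg mu (fun x => `|f x + g x| `^ p) Q `^ p^-1 <=
   4 * (ravg mu (fun x => `|f x| `^ p) Q `^ p^-1 + ravg mu (fun x => `|g x| `^ p) Q `^ p^-1))%R.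
Proof.
move=> p1 mQ mf mg f_fin g_fin.
have p0 : (0 < p)%R by rewrite (lt_le_trans ltr01).
have int_fin (k : Rn -> R) : \int[mu]_(x in Q) (`|k x| `^ p)%:E < +oo ->
    \int[mu]_(x in Q) (`|k x| `^ p)%:E \is a fin_num.
  by move=> kf; rewrite ge0_fin_numE ?integral_ge0.
have le1 : (ravg mu (fun x => `|f x + g x| `^ p) Q <=
    2 `^ p * (ravg mu (fun x => `|f x| `^ p) Q + ravg mu (fun x => `|g x| `^ p) Q))%R.
  rewrite /ravg -mulrDl mulrA ler_wpM2r ?invr_ge0 ?fine_ge0//.
  have le_int : \int[mu]_(x in Q) (`|f x + g x| `^ p)%:E <=
      (2 `^ p * (fine (\int[mu]_(x in Q) (`|f x| `^ p)%:E) + fine (\int[mu]_(x in Q) (`|g x| `^ p)%:E)))%:E.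
    rewrite EFinM EFinD (fineK (int_fin _ f_fin)) (fineK (int_fin _ g_fin)) -ge0_integralD//; last 2 first.
    - by apply/measurable_EFinP; exact: measurable_pabs.
    - by apply/measurable_EFinP; exact: measurable_pabs.
    rewrite -ge0_integralZl_EFin//; last 2 first.
    - by move=> x _; rewrite -EFinD lee_fin addr_ge0.
    - by apply: emeasurable_funD; apply/measurable_EFinP; exact: measurable_pabs.
    apply: ge0_le_integral => //.
    - apply/measurable_EFinP; apply: measurable_pabs; exact: measurable_funD.
    - apply: measurable_funeM; apply: emeasurable_funD; apply/measurable_EFinP; exact: measurable_pabs.
    - move=> x _; rewrite -EFinD -EFinM lee_fin.
      apply: le_trans (powRD_le (normr_ge0 _) (normr_ge0 _) (ltW p0)).
      by apply: ge0_ler_powR; rewrite ?nnegrE ?addr_ge0 ?(ltW p0)// ler_normD.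
  have fg_fin : \int[mu]_(x in Q) (`|f x + g x| `^ p)%:E \is a fin_num.
    rewrite ge0_fin_numE; first exact: le_lt_trans le_int (ltry _).
    by apply: integral_ge0 => x _; rewrite lee_fin powR_ge0.
  by rewrite -lee_fin (fineK fg_fin).
by apply: powR_quasi_add; rewrite // ravg_ge0.
Qed.

End Averages.

Section TestSpace.
Context {R : realType} {n : nat}.
Local Notation Rn := (euclidean R n).
Variable mu : {measure set Rn -> \bar R}.
Implicit Types (P Q B : set Rn) (f g : Rn -> R) (p r : R).
Hypothesis mu_balls : forall B, balls B -> (0 < mu B < +oo)%E.
Local Open Scope ereal_scope.

Lemma weight1 : weight (fun _ : Rn => 1%R).
Proof. by split. Qed.

Lemma weighted1 D : measurable D -> weighted mu (fun=> 1%R) D = mu D.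
Proof. by move=> mD; rewrite /weighted (integral_cst mu mD 1) mul1e. Qed.

(** Lets the test functions be used in unweighted Lebesgue spaces. *)
Lemma Ainfty1 : Ainfty mu (fun=> 1%R).
Proof.
split; first exact: weight1.
  move=> B bB; rewrite weighted1; last exact: measurable_ball.
  by have /andP[] := mu_balls bB.
apply: (@le_lt_trans _ _ 1); last exact: ltry.
apply: ge_ereal_sup => _ [B bB <-].
have mB := measurable_ball bB; have /andP[B0 By] := mu_balls bB.
have muB A : 0 < mu A -> mu A < +oo -> (mu A)^-1 * mu A = 1.
  move=> A0 Ay; have Af : mu A \is a fin_num by rewrite ge0_fin_numE ?(ltW A0).
  have m0 : (0 < fine (mu A))%R by rewrite fine_gt0// A0.
  by rewrite -(fineK Af) inver gt_eqF// -EFinM mulVf// gt_eqF.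
have le1 x : maximal mu ((fun _ : Rn => 1%R : R) \_ B) x <= 1.
  apply: ge_ereal_sup => _ [B' [bB' _] <-].
  have mB' := measurable_ball bB'; have /andP[B'0 B'y] := mu_balls bB'.
  rewrite /average invr1 poweRe1; last first.
    by rewrite mule_ge0 ?inve_ge0 ?(ltW B'0)// integral_ge0.
  rewrite -(muB _ B'0 B'y); apply: lee_wpmul2l; first by rewrite inve_ge0 ltW.
  rewrite -[leRHS]mul1e -integral_cst//.
  apply: ge0_le_integral => //.
    apply/measurable_EFinP; apply: measurable_pabs.
    by apply/(measurable_restrictT _ _).1.
  move=> y _; rewrite lee_fin powRr1// patchE; case: ifP => _; rewrite ?normr0 ?normr1//.
rewrite weighted1// -(muB _ B0 By); apply: lee_wpmul2l; first by rewrite inve_ge0 ltW.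
rewrite -[leRHS]mul1e -integral_cst//; apply: ge0_le_integral => //.
- by move=> x _; exact: maximal_ge0.
- by apply: measurable_funTS; exact: measurable_maximal.
Qed.

Variable D : set (Rn -> R).
Hypothesis tD : test_space mu D.

Let Lnorm1 p f : weighted_Lnorm mu (fun=> 1%R) p f = (pint mu p f) `^ p^-1.
Proof. by congr (_ `^ _); apply: eq_integral => x _; rewrite mulr1. Qed.

Lemma test_Lp p g : (1 <= p)%R -> D g -> measurable_fun setT g /\ pint mu p g < +oo.
Proof.
move=> p1 Dg; have [_ _ /(_ p _ p1 Ainfty1)[/(_ _ Dg)[mg +] _]] := tD.
rewrite Lnorm1 => /lty_poweRy lty; split => //; apply: lty.
by rewrite invr_eq0 gt_eqF// (lt_le_trans ltr01).
Qed.

Lemma test_dense p f (e : R) : (1 <= p)%R -> measurable_fun setT f ->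
  pint mu p f < +oo -> (0 < e)%R ->
  exists2 g, D g & pint mu p (fun x => f x - g x)%R < e%:E.
Proof.
move=> p1 mf fp e0; have p0 : (0 < p)%R by rewrite (lt_le_trans ltr01).
have [_ _ /(_ p _ p1 Ainfty1)[_]] := tD.
have fL : weighted_Lfun mu (fun=> 1%R) p f by split => //; rewrite Lnorm1 poweR_lty.
move=> /(_ f fL (e `^ p^-1)%R); rewrite powR_gt0// => /(_ isT)[g Dg].
rewrite Lnorm1 => lt_e; exists g => //.
have I0 := pint_ge0 mu p (fun x => f x - g x)%R.
have := lt_e; have : pint mu p (fun x => f x - g x)%R < +oo.
  apply: (@lty_poweRy _ _ p^-1); first by rewrite invr_eq0 gt_eqF.
  by apply: lt_trans lt_e _; exact: ltry.
move: I0; case: (pint _ _ _) => [r| |]//; rewrite !lee_fin => r0 _.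
rewrite poweR_EFin !lte_fin; apply: contraTT; rewrite -!leNgt => er.
by apply: ge0_ler_powR; rewrite ?nnegrE ?invr_ge0 ?(ltW p0) ?(ltW e0).
Qed.

End TestSpace.

(** * Sparse domination by density *)

Section Duality.
Context {R : realType} {n : nat}.
Local Notation Rn := (euclidean R n).
Variable mu : {measure set Rn -> \bar R}.
Implicit Types (P Q B : set Rn) (f g u phi psi : Rn -> R) (p r : R).
Local Open Scope ereal_scope.

Lemma LnormE p f : 'N[mu]_p%:E[EFin \o f] = (pint mu p f) `^ p^-1.
Proof. by rewrite unlock. Qed.

Lemma integral_abs_holder p p' f g : (0 < p)%R -> (0 < p')%R ->
  (p^-1 + p'^-1 = 1)%R -> measurable_fun setT f -> measurable_fun setT g ->
  \int[mu]_x `|(f x * g x)%:E| <= (pint mu p f) `^ p^-1 * (pint mu p' g) `^ p'^-1.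
Proof.
move=> p0 p'0 pp' mf mg; have := hoelder mu mf mg p0 p'0 pp'.
by rewrite Lnorm1 !LnormE.
Qed.

Lemma integrable_holder p p' f g : (0 < p)%R -> (0 < p')%R ->
  (p^-1 + p'^-1 = 1)%R -> measurable_fun setT f -> measurable_fun setT g ->
  pint mu p f < +oo -> pint mu p' g < +oo ->
  mu.-integrable setT (fun x => (f x * g x)%:E).
Proof.
move=> p0 p'0 pp' mf mg fp gp; apply/integrableP; split.
  by apply/measurable_EFinP; exact: measurable_funM.
apply: le_lt_trans (integral_abs_holder p0 p'0 pp' mf mg) _.
have [a _ ->] := pint_fin fp; have [b _ ->] := pint_fin gp.
by rewrite !poweR_EFin -EFinM ltry.
Qed.

Hypothesis n0 : (0 < n)%N.
Hypothesis mu_balls : forall B, balls B -> (0 < mu B < +oo).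

Variables (eta p0 q t : R).
Hypotheses (eta0 : (0 < eta)%R) (p01 : (1 <= p0)%R) (q1 : (1 <= q)%R).
Hypotheses (t0 : (0 < t)%R) (tp0 : (t < p0^-1)%R) (tq : (1 - t < q^-1)%R).
Local Notation p := (t^-1)%R.
Local Notation p' := ((1 - t)^-1)%R.

Let p00 : (0 < p0)%R. Proof. exact: lt_le_trans p01. Qed.
Let q0 : (0 < q)%R. Proof. exact: lt_le_trans q1. Qed.
Let t1 : (t < 1)%R. Proof. by rewrite (lt_le_trans tp0)// invf_le1. Qed.
Let pp0 : (p0 < p)%R. Proof. by rewrite -(invrK p0) ltf_pV2 ?posrE ?invr_gt0. Qed.
Let p'q : (q < p')%R. Proof. by rewrite -(invrK q) ltf_pV2 ?posrE ?invr_gt0// subr_gt0. Qed.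
Let t'0 : (0 < 1 - t)%R. Proof. by rewrite subr_gt0. Qed.

Definition form_term f g Q : \bar R :=
  average mu p0%:E Q f * average mu q%:E Q g * mu Q.

Lemma form_term_ge0 f g Q : 0 <= form_term f g Q.
Proof. by rewrite !mule_ge0 ?poweR_ge0. Qed.

Definition form_Lp_cst (a b : R) : R :=
  (3 ^+ n * ((carleson_cst eta (p0^-1 / t) * a) `^ t *
             (carleson_cst eta (p' / q) * b) `^ (1 - t)))%R.

(** Both averages are controlled by the Carleson embedding, because [p0 < p]
    and [q < p']. *)
Lemma form_Lp_bound f g (a b : R) S : measurable_fun setT f -> measurable_fun setT g ->
  pint mu p f = a%:E -> pint mu p' g = b%:E -> sparse mu eta S ->
  \esum_(Q in S) form_term f g Q <= (form_Lp_cst a b)%:E.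
Proof.
move=> mf mg fa gb sS; apply: esum_dyadic_le => [Q||alpha sa s us sP].
- exact: form_term_ge0.
- by case: sS.
have st : sparse_tree mu eta s by apply: sparse_sparse_tree n0 mu_balls _ _ _ _ sS sa us sP.
have [_ _ ms _] := st.
have fy : pint mu p f < +oo by rewrite fa ltry.
have gy : pint mu p' g < +oo by rewrite gb ltry.
pose G x := (`|f x| `^ p0)%R; pose y Q := (ravg mu (fun x => `|g x| `^ q) Q `^ (p' / q))%R.
have mG : measurable_fun setT G by exact: measurable_pabs.
have G0 x : (0 <= G x)%R by exact: powR_ge0.
have termE Q : Q \in s -> form_term f g Q =
    (ravg mu G Q `^ p0^-1 * y Q `^ (1 - t) * fine (mu Q))%:E.
  move=> Qs; have [mQ Q0y] := ms _ Qs; have /andP[Q0 Qy] := Q0y.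
  have f1 : \int[mu]_(x in Q) (`|f x| `^ p0)%:E < +oo.
    exact: pint_local_lty (ltW p00) (ltW pp0) mf mQ Qy fy.
  have g1 : \int[mu]_(x in Q) (`|g x| `^ q)%:E < +oo.
    exact: pint_local_lty (ltW q0) (ltW p'q) mg mQ Qy gy.
  have e : (p' / q * (1 - t) = q^-1)%R by rewrite mulrAC mulVf ?mul1r// gt_eqF.
  rewrite /form_term (averageE p00 Q0y f1) (averageE q0 Q0y g1) (mass_fin st Qs).
  by rewrite -!EFinM /y -powRrM e.
rewrite big_seq (eq_bigr _ termE) -big_seq sumEFin lee_fin.
have intG : (\int[mu]_x (G x `^ (p0^-1 / t))%:E <= a%:E)%E.
  rewrite -fa /pint le_eqVlt; apply/orP; left; apply/eqP; apply: eq_integral => x _.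
  by rewrite /G -powRrM mulrA mulfV ?gt_eqF// mul1r.
have tp0' : (p0^-1 <= 1)%R by rewrite invf_le1.
apply: le_trans (carleson_holder eta0 t0 tp0 tp0' st mG G0 _ intG) _.
  by move=> Q; exact: powR_ge0.
rewrite ler_wpM2l ?powR_ge0//.
have r1 : (1 < p' / q)%R by rewrite ltr_pdivlMr// mul1r.
have mg1 : measurable_fun setT (fun x => `|g x| `^ q)%R by exact: measurable_pabs.
have := carleson_embedding eta0 r1 st mg1 (fun x => powR_ge0 _ _).
have -> : \int[mu]_x ((`|g x| `^ q) `^ (p' / q))%:E = b%:E.
  rewrite -gb /pint; apply: eq_integral => x _.
  by rewrite -powRrM mulrC divfK// gt_eqF.
rewrite -EFinM lee_fin => le_y.
have y0 : (0 <= \sum_(Q <- s) y Q * fine (mu Q))%R.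
  by rewrite sumr_ge0// => Q _; rewrite mulr_ge0 ?powR_ge0 ?fine_ge0.
by apply: ge0_ler_powR; rewrite ?nnegrE ?(ltW t'0)// (le_trans y0).
Qed.

(** Applied to a test function [psi] close to [phi], it moves the sparse form
    of [psi] to that of [phi] at the cost of a form that is small by
    [form_Lp_bound]. *)
Lemma form_add phi psi g S : measurable_fun setT phi -> measurable_fun setT psi ->
  measurable_fun setT g -> pint mu p phi < +oo -> pint mu p psi < +oo ->
  pint mu p' g < +oo -> sparse mu eta S ->
  \esum_(Q in S) form_term psi g Q <=
  4%:E * (\esum_(Q in S) form_term phi g Q +
          \esum_(Q in S) form_term (fun x => psi x - phi x)%R g Q).
Proof.
move=> mphi mpsi mg phip psip gp sS.
set d := (fun x => psi x - phi x)%R.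
have md : measurable_fun setT d by exact: measurable_funB.
have dp : pint mu p d < +oo.
  rewrite (_ : d = (fun x => -1 * phi x + psi x)%R).
    by apply: pint_lin_lty; rewrite // invr_ge0 ltW.
  by apply/funext => x; rewrite /d mulN1r addrC.
have S_dyadic Q : S Q -> measurable Q /\ 0 < mu Q < +oo.
  by move=> /(proj1 sS)[alpha _]; exact: dyadic_cube_mass.
have le_term Q : S Q -> form_term psi g Q <= 4%:E * (form_term phi g Q + form_term d g Q).
  move=> /S_dyadic[mQ Q0y]; have /andP[Q0 Qy] := Q0y.
  have loc f : measurable_fun setT f -> pint mu p f < +oo ->
      \int[mu]_(x in Q) (`|f x| `^ p0)%:E < +oo.
    by move=> mf fp; exact: pint_local_lty (ltW p00) (ltW pp0) mf mQ Qy fp.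
  have Qf : mu Q \is a fin_num by rewrite (ge0_fin_numE (ltW Q0)).
  have g1 : \int[mu]_(x in Q) (`|g x| `^ q)%:E < +oo.
    exact: pint_local_lty (ltW q0) (ltW p'q) mg mQ Qy gp.
  pose A f := (ravg mu (fun x => `|f x| `^ p0)%R Q `^ p0^-1)%R.
  pose Bg := (ravg mu (fun x => `|g x| `^ q)%R Q `^ q^-1)%R.
  have tE f : measurable_fun setT f -> pint mu p f < +oo ->
      form_term f g Q = (A f * Bg * fine (mu Q))%:E.
    move=> mf fp; rewrite [RHS]EFinM (fineK Qf) [X in _ = X * _]EFinM.
    by rewrite /form_term (averageE p00 Q0y (loc _ mf fp)) (averageE q0 Q0y g1).
  have alg (x y z c m : R) : (x <= 4 * (y + z))%R -> (0 <= c)%R -> (0 <= m)%R ->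
      (x * c * m)%:E <= 4%:E * ((y * c * m)%:E + (z * c * m)%:E).
    move=> le_x c_ge0 m_ge0; rewrite -EFinD -EFinM lee_fin.
    have -> : (4 * (y * c * m + z * c * m) = 4 * (y + z) * c * m)%R by ring.
    by rewrite ler_wpM2r// ler_wpM2r.
  rewrite (tE _ mpsi psip) (tE _ mphi phip) (tE _ md dp).
  apply: alg; [|exact: powR_ge0|exact: fine_ge0].
  have := ravg_add p01 mQ mphi md (loc _ mphi phip) (loc _ md dp).
  suff -> : (fun x => `|phi x + d x| `^ p0)%R = (fun x => `|psi x| `^ p0)%R by [].
  by apply/funext => x; rewrite /d subrKC.
apply: ge_ereal_sup => _ [F [finF FS] <-].
apply: (@le_trans _ _ (\sum_(Q \in F) (4%:E * (form_term phi g Q + form_term d g Q)))).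
  rewrite !fsbig_finite//= big_seq [leRHS]big_seq lee_sum// => Q.
  by rewrite in_fset_set// inE => FQ; apply: le_term; exact: FS.
rewrite fsbig_finite//= -ge0_sume_distrr; last first.
  by move=> Q _; rewrite adde_ge0 ?form_term_ge0.
apply: lee_wpmul2l => //; rewrite big_split/=.
have le_esum h : (\sum_(Q <- finmap.enum_fset (fset_set F)) form_term h g Q <= \esum_(Q in S) form_term h g Q).
  by apply: ereal_sup_ubound; exists F; rewrite ?fsbig_finite.
by apply: leeD; exact: le_esum.
Qed.

Variables (D : set (Rn -> R)) (T : (Rn -> R) -> (Rn -> R)) (cT : R).
Hypothesis tD : test_space mu D.
Hypothesis cT0 : (0 < cT)%R.
Variable q0' : \bar R.
Hypothesis q0'E : hoelder_conjugate q0' = q%:E.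
Hypothesis sT : sparse_dominated mu D p0%:E q0' T cT eta.

(** The sparse collection depends on the test function that approximates
    [phi], so the hypothesis on [phi] asks for a bound that is uniform over
    all sparse collections. *)
Lemma dual_bound g u phi (X : R) : D g -> measurable_fun setT u -> pint mu p' u < +oo ->
  (forall f, D f -> pairing mu (T f) g = pairing mu f u) ->
  measurable_fun setT phi -> pint mu p phi < +oo -> (0 <= X)%R ->
  (forall S, sparse mu eta S -> \esum_(Q in S) form_term phi g Q <= X%:E) ->
  `| pairing mu phi u | <= (4 * cT * X)%:E.
Proof.
move=> Dg mu_ up dual mphi phip X0 leX.
have p_ge1 : (1 <= p)%R by rewrite invf_ge1// ltW.
have p'_ge1 : (1 <= p')%R by rewrite invf_ge1 ?lerBlDr ?lerDl ?(ltW t0).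
have p_gt0 : (0 < p)%R by rewrite invr_gt0.
have p'_gt0 : (0 < p')%R by rewrite invr_gt0.
have conj : (p^-1 + p'^-1 = 1)%R by rewrite !invrK; ring.
have [mg gp'] := test_Lp mu_balls tD p'_ge1 Dg.
have [b b0 gb] := pint_fin gp'; have [c c0 ub] := pint_fin up.
have [K K0 KE] : exists2 K : R, (0 <= K)%R & forall a, (0 <= a)%R ->
    form_Lp_cst a b = (a `^ t * K)%R.
  exists (3 ^+ n * (carleson_cst eta (p0^-1 / t) `^ t *
   (carleson_cst eta (p' / q) * b) `^ (1 - t)))%R.
    by rewrite !mulr_ge0 ?powR_ge0 ?exprn_ge0.
  move=> a a0; rewrite /form_Lp_cst powRM//; first ring.
  by apply: carleson_cst_ge0 => //; rewrite ltr_pdivlMr// mul1r.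
have [U U0 UE] : exists2 U : R, (0 <= U)%R & (c `^ (1 - t) = U)%R.
  by exists (c `^ (1 - t))%R; rewrite // powR_ge0.
have [Z ZE Z0] : exists2 Z : R, (4 * cT * K + U = Z)%R & (0 <= Z)%R.
  by exists (4 * cT * K + U)%R; rewrite // addr_ge0// !mulr_ge0// ltW.
apply/lee_addgt0Pr => e e0.
have Z1 : (0 < Z + 1)%R by rewrite ltr_wpDl.
(* the total error is at most [Z] times the L^p distance from [phi] to [psi] *)
have [delta delta0 deltaE] : exists2 delta : R, (0 < delta)%R & (delta `^ t = e / (Z + 1))%R.
  exists ((e / (Z + 1)) `^ p)%R; first by rewrite powR_gt0// divr_gt0.
  by rewrite -powRrM mulVf ?gt_eqF// powRr1// divr_ge0// ltW.
have [psi Dpsi lt_delta] := test_dense mu_balls tD p_ge1 mphi phip delta0.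
have [mpsi psip] := test_Lp mu_balls tD p_ge1 Dpsi.
have md : measurable_fun setT (fun x => phi x - psi x)%R by exact: measurable_funB.
have md' : measurable_fun setT (fun x => psi x - phi x)%R by exact: measurable_funB.
have d'E : pint mu p (fun x => psi x - phi x)%R = pint mu p (fun x => phi x - psi x)%R.
  by apply: eq_integral => x _; rewrite distrC.
have [a a0 dE] := pint_fin (lt_trans lt_delta (ltry delta)).
have at_le : (a `^ t <= e / (Z + 1))%R.
  rewrite -deltaE; apply: ge0_ler_powR; rewrite ?nnegrE ?(ltW t0) ?(ltW delta0)//.
  by move: lt_delta; rewrite dE lte_fin => /ltW.
have [S [sS le_S]] := (sT Dpsi Dg).2.
have le_form : \esum_(Q in S) form_term psi g Q <= (4 * (X + a `^ t * K))%:E.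
  apply: le_trans (form_add mphi mpsi mg phip psip gp' sS) _.
  rewrite EFinM; apply: lee_wpmul2l; first by rewrite lee_fin.
  rewrite EFinD; apply: leeD; first exact: leX.
  rewrite -KE//; apply: form_Lp_bound md' mg _ gb sS.
  by rewrite d'E.
have le_psi : `| pairing mu psi u | <= (4 * cT * (X + a `^ t * K))%:E.
  rewrite -dual//; apply: le_trans le_S _; rewrite q0'E -mulrA mulrCA EFinM.
  by apply: lee_wpmul2l le_form; rewrite lee_fin ltW.
have int_phi := integrable_holder p_gt0 p'_gt0 conj mphi mu_ phip up.
have int_psi := integrable_holder p_gt0 p'_gt0 conj mpsi mu_ psip up.
have int_d := integrable_holder p_gt0 p'_gt0 conj md mu_ (lt_trans lt_delta (ltry delta)) up.
have split : pairing mu phi u = \int[mu]_x ((phi x - psi x) * u x)%:E + pairing mu psi u.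
  rewrite /pairing -integralD//.
  by apply: eq_integral => x _; rewrite -EFinD -mulrDl subrK.
have le_d : `| \int[mu]_x ((phi x - psi x) * u x)%:E | <= (a `^ t * U)%:E.
  apply: le_trans (le_abse_integral _ _ _) _ => //.
    by apply/measurable_EFinP; exact: measurable_funM.
  have := integral_abs_holder p_gt0 p'_gt0 conj md mu_.
  by rewrite dE ub !poweR_EFin !invrK UE -EFinM.
rewrite split; apply: le_trans (lee_abs_add _ _) _.
apply: le_trans (leeD le_d le_psi) _; rewrite -!EFinD lee_fin.
have -> : (a `^ t * U + 4 * cT * (X + a `^ t * K) = 4 * cT * X + a `^ t * Z)%R.
  by rewrite -ZE; ring.
rewrite lerD2l; apply: le_trans (ler_wpM2r Z0 at_le) _.
rewrite mulrAC ler_pdivrMr// ler_wpM2l ?(ltW e0)//.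
by rewrite lerDl.
Qed.

End Duality.

(** * The exceptional set *)

Section WeightedSets.
Context {R : realType} {n : nat}.
Local Notation Rn := (euclidean R n).
Variable mu : {measure set Rn -> \bar R}.
Variable w : Rn -> R.
Hypothesis ww : weight w.
Implicit Types (P Q B D : set Rn) (alpha : 'rV[R]_n).
Local Open Scope ereal_scope.

Let mw D : measurable_fun D (EFin \o w).
Proof. by apply/measurable_EFinP; apply: measurable_funTS; exact: ww.1. Qed.

Let w0 x : 0 <= (w x)%:E. Proof. by rewrite lee_fin ltW// ww.2. Qed.

Lemma weighted_cover (t : seq (set Rn)) D : measurable D ->
  (forall P, P \in t -> measurable P) ->
  (forall x, D x -> exists2 P, P \in t & P x) ->
  weighted mu w D <= \sum_(P <- t) weighted mu w P.
Proof.
elim: t D => [|P t IH] D mD mt Dt.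
  rewrite big_nil (_ : D = set0) ?/weighted ?integral_set0//.
  by rewrite -subset0 => x /Dt[].
have mP : measurable P by apply: mt; rewrite mem_head.
have mDP : measurable (D `\` P) by exact: measurableD.
rewrite big_cons; apply: (@le_trans _ _ (weighted mu w P + weighted mu w (D `\` P))).
  have PDP : D `<=` P `|` (D `\` P).
    by move=> x Dx; have [Px|Px] := pselect (P x); [left|right].
  apply: le_trans (le_weighted _ ww mD (measurableU _ _ mP mDP) PDP) _.
  rewrite /weighted ge0_integral_setU//.
  by rewrite disj_set2E setDIK eqxx.
apply: leeD => //; apply: IH => //.
  by move=> Q Qt; apply: mt; rewrite inE Qt orbT.
move=> x [/Dt[Q + Qx]]; rewrite inE => /predU1P[QP|Qt]; last by exists Q.
by rewrite QP in Qx.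
Qed.

Lemma weighted_bigcup_le (F : (set Rn)^nat) (M : \bar R) :
  (forall i, measurable (F i)) -> nondecreasing_seq F ->
  (forall i, weighted mu w (F i) <= M) -> weighted mu w (\bigcup_i F i) <= M.
Proof.
move=> mF ndF leM.
have cvgF := @ge0_nondecreasing_set_cvg_integral _ _ _ F (EFin \o w) mu ndF mF
  (fun i => @mw (F i)) (fun i x _ => w0 x).
rewrite /weighted -(cvg_lim _ cvgF)//; apply: lime_le; first exact: cvgP cvgF.
exact: nearW.
Qed.

End WeightedSets.

Section BadCubes.
Context {R : realType} {n : nat}.
Local Notation Rn := (euclidean R n).
Variable mu : {measure set Rn -> \bar R}.
Implicit Types (P Q B : set Rn) (alpha : 'rV[R]_n).
Hypothesis n0 : (0 < n)%N.
Hypothesis mu_balls : forall B, balls B -> (0 < mu B < +oo)%E.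
Variables (w h : Rn -> R) (H : R).
Hypothesis ww : weight w.
Hypotheses (mh : measurable_fun setT h) (h0 : forall x, 0 <= h x).
Local Open Scope ereal_scope.
Hypothesis hH : \int[mu]_x (h x)%:E <= H%:E.

Definition bad_cube alpha Q := dyadic_grid alpha Q /\
  weighted mu w (dilate alpha Q) < \int[mu]_(x in Q) (h x)%:E.

Definition bad_set alpha : set Rn := \bigcup_(Q in bad_cube alpha) Q.

Let B alpha (i : nat) : set Rn :=
  if @unpickle (int * 'rV[int]_n)%type i is Some km then
    if `[< bad_cube alpha (dyadic_cube alpha km.1 km.2) >]
    then dyadic_cube alpha km.1 km.2 else set0
  else set0.

Let B_bad alpha i x : B alpha i x -> bad_cube alpha (B alpha i).
Proof.
by rewrite /B; case: unpickle => // km; case: ifPn => [/asboolP|].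
Qed.

Let mB alpha i : measurable (B alpha i).
Proof.
rewrite /B; case: unpickle => // km; case: ifPn => // _.
exact: measurable_dyadic_cube.
Qed.

Let bad_setE alpha : bad_set alpha = \bigcup_i B alpha i.
Proof.
apply/seteqP; split => x.
  move=> [Q [[k [m QE]] badQ] Qx]; exists (pickle (k, m)); first by [].
  by rewrite /B pickleK -QE asboolT//; split => //; exists k, m.
by move=> [i _ Bx]; exists (B alpha i) => //; exact: B_bad Bx.
Qed.

Lemma measurable_bad_set alpha : measurable (bad_set alpha).
Proof. by rewrite bad_setE; apply: bigcupT_measurable. Qed.

(** Finitely many bad cubes of one grid are covered by the maximal ones among
    them, which are disjoint; an increasing union exhausts the countable grid. *)
Lemma weighted_bad_set alpha : dyadic_shifts alpha ->
  weighted mu w (bad_set alpha) <= H%:E.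
Proof.
move=> sa; rewrite bad_setE -bigcup_bigsetU_bigcup.
apply: weighted_bigcup_le => //.
- by move=> i; exact: bigsetU_measurable.
- move=> i j ij; apply/subsetPset; rewrite -!bigcup_mkord => x [a /= ai Bx].
  by exists a => //=; exact: leq_trans ai _.
move=> N; set D := \big[setU/set0]_(i < N.+1) _.
(* [B] takes the value [set0] at indices that are not those of bad cubes *)
pose s := undup [seq Q <- [seq B alpha i | i <- iota 0 N.+1] | Q != set0].
have sP Q : Q \in s -> bad_cube alpha Q.
  rewrite mem_undup mem_filter => /andP[Q0 /mapP[i _ QE]].
  have /set0P[x Qx] := Q0; rewrite QE; apply: (B_bad (x := x)).
  by rewrite -QE.
have ls : laminar s by apply: dyadic_laminar sa _ => Q /sP[].
have mt P : P \in maxima s -> measurable P.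
  by move=> /maxima_sub/sP[/(dyadic_cube_mass n0 mu_balls)[]].
apply: (@le_trans _ _ (\sum_(P <- maxima s) weighted mu w P)).
  apply: weighted_cover => //; first exact: bigsetU_measurable.
  rewrite /D -bigcup_mkord => x [i /= iN Bx].
  have Bs : B alpha i \in s.
    rewrite mem_undup mem_filter; apply/andP; split; first by apply/set0P; exists x.
    by apply/mapP; exists i => //; rewrite mem_iota.
  by have [P Pm BP] := maxima_cover Bs; exists P => //; exact: BP.
apply: le_trans hH.
apply: (@le_trans _ _ (\sum_(P <- maxima s) \int[mu]_(x in P) (h x)%:E)).
  rewrite big_seq [leRHS]big_seq; apply: lee_sum => P Pm.
  have [gP /ltW] := sP _ (maxima_sub Pm); apply: le_trans.
  apply: le_weighted => //; first exact: mt.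
    by apply: measurable_ball; exact: dilate_ball.
  exact: sub_dilate.
apply: sum_integral_trivIset => //.
- by rewrite filter_uniq// undup_uniq.
- exact: maxima_trivIset.
- by move=> P /mt.
- exact/measurable_EFinP.
- by move=> x _; rewrite lee_fin.
Qed.

Definition bad_sets : set Rn := \bigcup_(f in [set: {ffun 'I_n -> 'I_3}]) bad_set (shift_of f).

Lemma measurable_bad_sets : measurable bad_sets.
Proof.
by apply: fin_bigcup_measurable => // f _; exact: measurable_bad_set.
Qed.

Lemma weighted_bad_sets : weighted mu w bad_sets <= (3 ^+ n * H)%:E.
Proof.
pose t := [seq bad_set (shift_of f) | f <- enum {ffun 'I_n -> 'I_3}].
apply: (@le_trans _ _ (\sum_(P <- t) weighted mu w P)).
  apply: weighted_cover => //; first exact: measurable_bad_sets.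
    by move=> P /mapP[f _ ->]; exact: measurable_bad_set.
  move=> x [f _ fx]; exists (bad_set (shift_of f)) => //.
  by apply/mapP; exists f => //; rewrite mem_enum.
rewrite big_map; apply: (@le_trans _ _ (\sum_(f <- enum {ffun 'I_n -> 'I_3}) H%:E)).
  by apply: lee_sum => f _; apply: weighted_bad_set; exact: shift_ofP.
by rewrite big_enum/= sumEFin sumr_const card_ffun !card_ord -natrX mulr_natl.
Qed.

Lemma not_bad alpha Q x : dyadic_shifts alpha -> dyadic_grid alpha Q -> Q x ->
  ~ bad_sets x -> \int[mu]_(y in Q) (h y)%:E <= weighted mu w (dilate alpha Q).
Proof.
move=> sa gQ Qx; rewrite leNgt => nbad; apply/negP => lt; apply: nbad.
have [f fE] := shift_of_surj sa.
exists f; first by [].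
exists Q; last exact: Qx.
by rewrite -fE; split.
Qed.

End BadCubes.

Lemma measurable_level (R : realType) (n : nat) (w H : euclidean R n -> R) (r lambda : R) :
  weight w -> measurable_fun setT H ->
  measurable [set x | (lambda * w x `^ r < `|H x|)%R].
Proof.
move=> ww mH.
have mlt : measurable_fun setT (fun x => lambda * w x `^ r < `|H x|).
  apply: measurable_fun_ltr; last exact: measurableT_comp.
  by apply: measurable_funM => //; apply: measurable_powRr; exact: ww.1.
by rewrite -[X in measurable X]setTI; exact: (mlt measurableT [set true]).
Qed.

(** * The weak-type bound on test functions *)

Section WeakBound.
Context {R : realType} {n : nat}.
Local Notation Rn := (euclidean R n).
Variable mu : {measure set Rn -> \bar R}.
Implicit Types (P Q B E : set Rn) (alpha : 'rV[R]_n).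
Hypothesis n0 : (0 < n)%N.
Hypothesis mu_balls : forall B, balls B -> (0 < mu B < +oo)%E.
Variable C : R.
Hypothesis C1 : 1 <= C.
Hypothesis muC : doubling_with mu C.
Local Notation Cn := (C ^+ (60 * n ^ 2)).

Variables (eta p0 s0 t : R).
Hypotheses (eta0 : 0 < eta) (p01 : 1 <= p0) (s00 : 0 <= s0).
Hypotheses (s0t : s0 < t) (tp0 : t < p0^-1).
Local Notation tau := (p0^-1).
Local Notation q := ((1 - s0)^-1).
Local Notation p := (t^-1).
Local Notation p' := ((1 - t)^-1).

Variables (D : set (Rn -> R)) (T : (Rn -> R) -> (Rn -> R)) (cT : R).
Hypothesis tD : test_space mu D.
Hypothesis cT0 : 0 < cT.
Variable q0' : \bar R.
Hypothesis q0'E : hoelder_conjugate q0' = q%:E.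
Hypothesis sT : sparse_dominated mu D p0%:E q0' T cT eta.

Variables (g u : Rn -> R).
Hypotheses (Dg : D g) (mu_ : measurable_fun setT u) (up : (pint mu p' u < +oo)%E).
Hypothesis dual : forall f, D f -> pairing mu (T f) g = pairing mu f u.

Variable w : Rn -> R.
Hypothesis ww : weight w.
Hypothesis A1w : (A1_const mu w < +oo)%E.
Hypothesis Ay : (Ainfty_const mu w < +oo)%E.
Local Notation A1c := (fine (A1_const mu w)).
Local Notation Ac := (fine (Ainfty_const mu w)).
Local Notation L := (ln (expR 1 + A1c)).
Local Notation s1 := (s0 + gain p0 s0).

Let t0 : 0 < t. Proof. exact: le_lt_trans s0t. Qed.
Let tau1 : tau <= 1. Proof. by rewrite invf_le1// (lt_le_trans ltr01). Qed.
Let t1 : t < 1. Proof. exact: lt_le_trans tau1. Qed.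
Let s0tau : s0 < tau. Proof. exact: lt_trans tp0. Qed.
Let s01 : s0 < 1. Proof. exact: lt_trans t1. Qed.
Let gain0 : 0 < gain p0 s0. Proof. by rewrite divr_gt0// subr_gt0. Qed.
Let s11 : s1 < 1.
Proof. by have := s0tau; have := tau1; rewrite /gain; lra. Qed.
Let s0p : 0 < 1 - s0. Proof. by rewrite subr_gt0. Qed.
Let s1p : 0 < 1 - s1. Proof. by rewrite subr_gt0. Qed.
Let Cn0 : 0 < Cn. Proof. by rewrite exprn_gt0// (lt_le_trans ltr01). Qed.
Let Cn1 : 1 <= Cn. Proof. by rewrite exprn_ege1. Qed.
Let q_ge1 : 1 <= q. Proof. by rewrite invf_ge1// lerBlDr lerDl. Qed.
Let q_gt0 : 0 < q. Proof. by rewrite invr_gt0. Qed.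

Let A1_ge0 : 0 <= A1c.
Proof. by apply: fine_ge0; exact: A1_const_ge0. Qed.

Let L1 : 1 <= L.
Proof. exact: ln_A1_ge1. Qed.

Let wB B : balls B -> (weighted mu w B < +oo)%E.
Proof. exact: A1_weighted_ball. Qed.

Let Ac1 : 1 <= Ac.
Proof.
rewrite -lee_fin fineK; first exact: Ainfty_ge1.
rewrite ge0_fin_numE//; apply: le_trans (Ainfty_ge1 mu_balls ww wB).
by rewrite lee_fin.
Qed.

Definition form_cst : R :=
  embedding_cst eta p0 s0 * (expR 1 * (eta^-1 * Cn)) `^ (1 - s0) +
  embedding_cst eta p0 s1 * (tail_cst s0 (gain p0 s0) * (eta^-1 * Cn)) `^ (1 - s1).

Definition level_set_cst : R :=
  Num.max 1 ((2 * (4 * cT * 3 ^+ n * form_cst)) `^ (1 - s1)^-1) * (ln (2 * Cn) + 2).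

Lemma embedding_cst_ge0 r : 0 <= embedding_cst eta p0 r.
Proof. by rewrite /embedding_cst; case: ifP => // _; exact: powR_ge0. Qed.

Let tail0 : 0 <= tail_cst s0 (gain p0 s0).
Proof.
rewrite /tail_cst mulr_ge0 ?expR_ge0// invr_ge0 subr_ge0 -expRN /powR gt_eqF ?expR_gt0//.
by rewrite expRK mulrN1 expR_le1 oppr_le0 divr_ge0// ltW.
Qed.

Let form_cst_ge0 : 0 <= form_cst.
Proof. by rewrite addr_ge0// mulr_ge0 ?embedding_cst_ge0 ?powR_ge0. Qed.

Variable lambda : R.
Hypothesis lambda0 : 0 < lambda.

Let h x := (`|g x| / lambda) `^ q.
Let mh : measurable_fun setT h.
Proof.
have [mg _] := test_Lp mu_balls tD q_ge1 Dg.
by apply: measurable_powRr; apply: measurable_funM => //; exact: measurableT_comp.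
Qed.
Let h0 x : 0 <= h x. Proof. exact: powR_ge0. Qed.

Let hE x : `|g x| `^ q = lambda `^ q * h x.
Proof.
rewrite /h -powRM ?divr_ge0 ?(ltW lambda0)//; congr (_ `^ _).
by rewrite mulrC divfK// gt_eqF.
Qed.

Let integral_h I : pint mu q g = I%:E -> (\int[mu]_x (h x)%:E <= (I / lambda `^ q)%:E)%E.
Proof.
have lq0 : 0 < lambda `^ q by exact: powR_gt0.
move=> gI; have : ((lambda `^ q)%:E * \int[mu]_x (h x)%:E = I%:E)%E.
  rewrite -ge0_integralZl_EFin//; last 3 first.
  - by move=> x _; rewrite lee_fin.
  - exact/measurable_EFinP.
  - exact: ltW.
  by rewrite -gI; apply: eq_integral => x _; rewrite hE EFinM.
have : (0 <= \int[mu]_x (h x)%:E)%E by apply: integral_ge0 => x _; rewrite lee_fin.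
case: (\int[mu]_x (h x)%:E)%E => [r| |]//= _.
  by rewrite -EFinM => -[rE]; rewrite lee_fin -rE mulrAC mulfV ?mul1r// gt_eqF.
by rewrite gt0_muley// lte_fin.
Qed.

(** One more than the integer part of [ln (2 Cn (e + A1))] is large enough for
    the decay over the levels to beat the A_1 constant, and is of the order of
    its logarithm. *)
Lemma exists_scale : exists k0 : nat, [/\ 2 * A1c * Cn <= expR 1 ^+ k0,
  1 <= k0%:R :> R & k0%:R <= (ln (2 * Cn) + 2) * L].
Proof.
pose c := 2 * Cn * (expR 1 + A1c).
have e0 : 0 < expR 1 + A1c by rewrite ltr_wpDr ?expR_gt0.
have c0 : 0 < c by rewrite !mulr_gt0.
have Cn2 : 1 <= 2 * Cn by have := Cn1; lra.
have lnC0 : 0 <= ln (2 * Cn) by exact: ln_ge0.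
have lncE : ln c = ln (2 * Cn) + L by rewrite /c [LHS]lnM ?posrE ?mulr_gt0.
have lnc0 : 0 <= ln c by rewrite lncE; exact: addr_ge0 lnC0 (le_trans ler01 L1).
exists (Num.truncn (ln c)).+1; split; last 2 first.
- by rewrite ler1n.
- have := truncn_le (ln c); rewrite lnc0 -natr1 => le_k.
  apply: (@le_trans _ _ (ln c + 1)); first by rewrite lerD2r.
  rewrite lncE; have := ler_wpM2l lnC0 L1; have := L1; lra.
rewrite -expRM_natl mulr1; apply: (@le_trans _ _ c).
  rewrite /c mulrAC ler_wpM2l ?mulr_ge0 ?(ltW Cn0)//.
  by rewrite lerDr expR_ge0.
by rewrite -{1}(lnK c0) ler_expR ltW// truncnS_gt.
Qed.

(** The estimate on the part of the level set that is left once the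
    exceptional set is removed, cut down to a set of finite measure so that
    [w(E)] can be divided out. *)
Lemma level_set_bound E (V I : R) : measurable E -> (mu E < +oo)%E ->
  weighted mu w E = V%:E -> pint mu q g = I%:E ->
  (forall alpha Q x, dyadic_shifts alpha -> dyadic_grid alpha Q -> Q x -> E x ->
     (\int[mu]_(y in Q) (h y)%:E <= weighted mu w (dilate alpha Q))%E) ->
  (forall x, E x -> lambda * w x `^ (1 - s0) <= `|u x|) ->
  V <= level_set_cst * L * Ac * (I / lambda `^ q).
Proof.
move=> mE muE wE gI goodE uE.
have [mg _] := test_Lp mu_balls tD q_ge1 Dg.
have V0 : 0 <= V by rewrite -lee_fin -wE; exact: weighted_ge0.
have I0 : 0 <= I by rewrite -lee_fin -gI; exact: pint_ge0.
have lq0 : 0 < lambda `^ q by exact: powR_gt0.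
set H := I / lambda `^ q.
have H0 : 0 <= H by rewrite divr_ge0// ltW.
have hH : (\int[mu]_x (h x)%:E <= H%:E)%E by exact: integral_h.
pose sg x : R := if 0 <= u x then 1 else -1.
have sg1 x : `|sg x| = 1 by rewrite /sg; case: ifP => _; rewrite ?normrN normr1.
have sgu x : sg x * u x = `|u x|.
  rewrite /sg; case: (leP 0 (u x)) => u0; first by rewrite mul1r ger0_norm.
  by rewrite mulN1r ltr0_norm.
have msg : measurable_fun setT sg.
  apply: measurable_fun_ifT => //; exact: measurable_fun_ler.
(* then [phi * u = w `^ s0 * |u|], which is at least [lambda * w] on [E] *)
pose phi x : R := if x \in E then sg x * w x `^ s0 else 0.
have mE' : measurable_fun setT (fun x : Rn => x \in E).
  by apply: (measurable_fun_bool true); rewrite setTI preimage_mem_true.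
have mphi : measurable_fun setT phi.
  apply: measurable_fun_ifT => //; apply: measurable_funM => //.
  by apply: measurable_powRr; exact: ww.1.
have phiE x : `|phi x| <= if x \in E then w x `^ s0 else 0.
  by rewrite /phi; case: ifP => _; rewrite ?normr0// normrM sg1 mul1r ger0_norm// powR_ge0.
have mw : measurable_fun E (EFin \o w).
  by apply/measurable_EFinP; apply: measurable_funTS; exact: ww.1.
have p_gt0 : 0 < p by rewrite invr_gt0.
have phip : (pint mu p phi < +oo)%E.
  have : (pint mu p phi <= \int[mu]_(x in E) (1 + (w x)%:E))%E.
    rewrite /pint [leRHS]integral_mkcond; apply: ge0_le_integral => //.
    - by apply/measurable_EFinP; exact: measurable_pabs.
    - by apply/(measurable_restrictT _ _).1 => //; exact: emeasurable_funD.
    - move=> x _; rewrite /patch; have := phiE x; case: ifP => xE le_phi; last first.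
        have /eqP : `|phi x| = 0 by apply/eqP; rewrite eq_le le_phi normr_ge0.
        by rewrite normr_eq0 => /eqP ->; rewrite normr0 powR0// gt_eqF.
      have wx := ww.2 x; rewrite -EFinD lee_fin.
      apply: (@le_trans _ _ ((w x `^ s0) `^ p)).
        by apply: ge0_ler_powR; rewrite ?nnegrE ?powR_ge0 ?(ltW p_gt0).
      have sp0 : 0 <= s0 * p by rewrite mulr_ge0// ltW.
      have sp1 : s0 * p <= 1 by rewrite ler_pdivrMr// mul1r ltW.
      by rewrite -powRrM; exact: powR_le1D (ltW wx) sp0 sp1.
  move=> /le_lt_trans; apply; rewrite ge0_integralD//.
  - rewrite (integral_cst mu mE 1) mul1e lte_add_pinfty//.
    by have -> : (\int[mu]_(x in E) (w x)%:E = V%:E)%E by []; exact: ltry.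
  - by move=> x _; rewrite lee_fin ltW// ww.2.
have [k0 [k0A k01 k0L]] := exists_scale.
pose FB := embedding_cst eta p0 s0 * V `^ s0 * (k0%:R * (expR 1 * (eta^-1 * Cn * Ac) * H)) `^ (1 - s0) +
  embedding_cst eta p0 s1 * V `^ s1 * (tail_cst s0 (gain p0 s0) * (eta^-1 * Cn * Ac) * H) `^ (1 - s1).
have FB0 : 0 <= FB.
  by rewrite addr_ge0//; apply: mulr_ge0 (powR_ge0 _ _); apply: mulr_ge0 (powR_ge0 _ _); exact: embedding_cst_ge0.
have p00 : 0 < p0 by exact: lt_le_trans p01.
have pp0 : p0 <= p by rewrite -(invrK p0) lef_pV2 ?posrE ?invr_gt0// ltW.
have p'q : q <= p'.
  by rewrite lef_pV2 ?posrE ?subr_gt0// lerD2l lerN2 ltW.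
have p'1 : 1 <= p' by rewrite (le_trans q_ge1).
have [_ gp'] := test_Lp mu_balls tD p'1 Dg.
have leX S : sparse mu eta S -> (\esum_(Q in S) form_term mu p0 q phi g Q <= (3 ^+ n * (lambda * FB))%:E)%E.
  move=> sS; apply: esum_dyadic_le => [Q||alpha sa s us sP].
  - exact: form_term_ge0.
  - by case: sS.
  have st : sparse_tree mu eta s by apply: sparse_sparse_tree n0 mu_balls _ _ _ _ sS sa us sP.
  have [_ _ ms _] := st.
  pose G0 x := `|phi x| `^ p0.
  have alg (a b m : R) : (a%:E * (lambda * b)%:E * m%:E = (lambda * (a * b * m))%:E)%E.
    by rewrite -!EFinM; congr EFin; ring.
  have termE Q : Q \in s -> form_term mu p0 q phi g Q =
      (lambda * (ravg mu G0 Q `^ p0^-1 * ravg mu h Q `^ (1 - s0) * fine (mu Q)))%:E.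
    move=> Qs; have [mQ Q0y] := ms _ Qs; have /andP[Q0 Qy] := Q0y.
    have f1 : (\int[mu]_(x in Q) (`|phi x| `^ p0)%:E < +oo)%E.
      exact: pint_local_lty (ltW p00) pp0 mphi mQ Qy phip.
    have g1 : (\int[mu]_(x in Q) (`|g x| `^ q)%:E < +oo)%E.
      exact: pint_local_lty (ltW q_gt0) p'q mg mQ Qy gp'.
    rewrite /form_term (averageE p00 Q0y f1) (averageE q_gt0 Q0y g1).
    have -> : ravg mu (fun x => `|g x| `^ q) Q = lambda `^ q * ravg mu h Q.
      rewrite -ravg_scale//; last exact: ltW.
      by congr ravg; apply/funext => x; exact: hE.
    rewrite powRM ?ravg_ge0 ?(ltW lq0)// -powRrM mulfV ?gt_eqF// powRr1 ?(ltW lambda0)// invrK.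
    rewrite -alg; congr (_ * _)%E; exact: mass_fin st Qs.
  have -> : (\sum_(Q <- s) form_term mu p0 q phi g Q)%E = (lambda * \sum_(Q <- s)
      ravg mu G0 Q `^ p0^-1 * ravg mu h Q `^ (1 - s0) * fine (mu Q))%:E.
    rewrite mulr_sumr -sumEFin; apply: eq_big_seq => Q Qs.
    exact: termE.
  rewrite lee_fin; apply: ler_wpM2l; first exact: ltW.
  apply: (@form_bound _ _ mu n0 mu_balls C C1 muC w ww A1w Ay eta p0 s0 eta0 p01 s00 s0tau
    h phi E H V mh h0 hH mE wE mphi phiE alpha s k0 sa _ st _ k0A).
  - by move=> Q /sP[].
  - by move=> Q x /sP[_ gQ]; exact: goodE.
have low : ((lambda * V)%:E <= pairing mu phi u)%E.
  rewrite EFinM -wE /weighted -ge0_integralZl_EFin//; last 2 first.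
  - by move=> x _; rewrite lee_fin ltW// ww.2.
  - exact: ltW.
  rewrite integral_mkcond /pairing; apply: ge0_le_integral => //.
  - by move=> x _; rewrite /patch; case: ifP => // _; rewrite -EFinM lee_fin mulr_ge0// ltW// ww.2.
  - by apply/(measurable_restrictT _ _).1 => //; exact: measurable_funeM.
  - by apply/measurable_EFinP; exact: measurable_funM.
  - move=> x _; rewrite /patch /phi; case: ifP => [/set_mem Ex|_]; last by rewrite mul0r.
    rewrite -EFinM lee_fin mulrAC sgu.
    apply: le_trans (ler_wpM2r (powR_ge0 _ _) (uE x Ex)).
    by rewrite -mulrA -powRD ?(gt_eqF (ww.2 x)) ?implybT// subrK powRr1// ltW// ww.2.
have tq : 1 - t < q^-1 by rewrite invrK ltrD2l ltrN2.
have X0 : 0 <= 3 ^+ n * (lambda * FB) by rewrite mulr_ge0 ?mulr_ge0 ?exprn_ge0// ltW.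
have := @dual_bound _ _ mu n0 mu_balls eta p0 q t eta0 p01 q_ge1 t0 tp0 tq D T cT tD cT0 q0' q0'E sT
  g u phi _ Dg mu_ up dual mphi phip X0 leX.
have pos : (0 <= pairing mu phi u)%E.
  by apply: le_trans low; rewrite lee_fin mulr_ge0// ltW.
rewrite gee0_abs// => /(le_trans low); rewrite lee_fin => le_V.
have {}le_V : V <= 4 * cT * 3 ^+ n * FB.
  rewrite -(ler_pM2l lambda0); apply: le_trans le_V _.
  by rewrite le_eqVlt; apply/orP; left; apply/eqP; ring.
set Y := k0%:R * Ac * H.
have Ac0 : 0 <= Ac by rewrite (le_trans ler01).
have AH0 : 0 <= Ac * H by exact: mulr_ge0.
have Y0 : 0 <= Y by rewrite /Y -mulrA mulr_ge0// (le_trans ler01).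
have etaC : 0 <= eta^-1 * Cn by rewrite mulr_ge0 ?invr_ge0// ltW.
have le_FB : FB <= form_cst * (V `^ s0 * Y `^ (1 - s0) + V `^ s1 * Y `^ (1 - s1)).
  have c1 : 0 <= expR 1 * (eta^-1 * Cn) by rewrite mulr_ge0 ?expR_ge0.
  have c2 : 0 <= tail_cst s0 (gain p0 s0) * (eta^-1 * Cn) by exact: mulr_ge0.
  have t1E : (k0%:R * (expR 1 * (eta^-1 * Cn * Ac) * H)) `^ (1 - s0) =
      (expR 1 * (eta^-1 * Cn)) `^ (1 - s0) * Y `^ (1 - s0).
    by rewrite -powRM//; congr (_ `^ _); rewrite /Y; ring.
  have t2E : (tail_cst s0 (gain p0 s0) * (eta^-1 * Cn * Ac) * H) `^ (1 - s1) <=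
      (tail_cst s0 (gain p0 s0) * (eta^-1 * Cn)) `^ (1 - s1) * Y `^ (1 - s1).
    rewrite -powRM//; apply: ge0_ler_powR; rewrite ?nnegrE ?(ltW s1p)//.
    - have -> : tail_cst s0 (gain p0 s0) * (eta^-1 * Cn * Ac) * H =
        tail_cst s0 (gain p0 s0) * (eta^-1 * Cn) * (Ac * H) by ring.
      exact: mulr_ge0.
    - exact: mulr_ge0.
    - have -> : tail_cst s0 (gain p0 s0) * (eta^-1 * Cn * Ac) * H =
        tail_cst s0 (gain p0 s0) * (eta^-1 * Cn) * (Ac * H) by ring.
      apply: ler_wpM2l => //; rewrite /Y -mulrA.
      exact: ler_peMl.
  rewrite /FB t1E /form_cst.
  set a := embedding_cst eta p0 s0; set b := embedding_cst eta p0 s1.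
  set A := (expR 1 * _) `^ _; set B := (tail_cst _ _ * (_ * _)) `^ (1 - s1) in t2E *.
  have a0 : 0 <= a by exact: embedding_cst_ge0.
  have b0 : 0 <= b by exact: embedding_cst_ge0.
  have A0 : 0 <= A by exact: powR_ge0.
  have B0 : 0 <= B by exact: powR_ge0.
  have v0 : 0 <= V `^ s0 by exact: powR_ge0.
  have v1 : 0 <= V `^ s1 by exact: powR_ge0.
  have y0 : 0 <= Y `^ (1 - s0) by exact: powR_ge0.
  have y1 : 0 <= Y `^ (1 - s1) by exact: powR_ge0.
  apply: (@le_trans _ _ (a * V `^ s0 * (A * Y `^ (1 - s0)) + b * V `^ s1 * (B * Y `^ (1 - s1)))).
    by rewrite lerD2l ler_wpM2l// mulr_ge0.
  have := mulr_ge0 (mulr_ge0 a0 A0) (mulr_ge0 v1 y1).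
  have := mulr_ge0 (mulr_ge0 b0 B0) (mulr_ge0 v0 y0).
  move=> h1 h2; rewrite -subr_ge0.
  have -> : (a * A + b * B) * (V `^ s0 * Y `^ (1 - s0) + V `^ s1 * Y `^ (1 - s1)) -
     (a * V `^ s0 * (A * Y `^ (1 - s0)) + b * V `^ s1 * (B * Y `^ (1 - s1))) =
     b * B * (V `^ s0 * Y `^ (1 - s0)) + a * A * (V `^ s1 * Y `^ (1 - s1)) by ring.
  exact: addr_ge0.
set M := 4 * cT * 3 ^+ n * form_cst.
have M0 : 0 <= M by rewrite !mulr_ge0 ?exprn_ge0// ltW.
have le_VM : V <= M * (V `^ s0 * Y `^ (1 - s0) + V `^ s1 * Y `^ (1 - s1)).
  apply: le_trans le_V _; rewrite /M -[leRHS]mulrA; apply: ler_wpM2l => //.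
  by rewrite !mulr_ge0 ?exprn_ge0// ltW.
have s0s1 : s0 < s1 by rewrite ltrDl.
apply: le_trans (absorb s00 s0s1 s11 M0 V0 Y0 le_VM) _.
rewrite /level_set_cst -/M /Y; set N := Num.max _ _.
have N0 : 0 <= N by rewrite le_max ler01.
rewrite -!mulrA ler_wpM2l// [leRHS]mulrA.
exact: ler_wpM2r.
Qed.

Definition weak_cst : R := 3 ^+ n + level_set_cst.

(** The function [u] is only required to represent the functional given by
    [g]. With [g = 0] the bound shows that a function that annihilates all
    test functions vanishes, which gives the linearity of the dual operator. *)
Lemma weak_bound :
  (weighted mu w [set x | (lambda * w x `^ (1 - s0) < `|u x|)%R] <=
   (weak_cst * L * Ac / lambda `^ q)%:E * pint mu q g)%E.
Proof.
have [mg gq] := test_Lp mu_balls tD q_ge1 Dg.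
have [I I0 gI] := pint_fin gq.
have lq0 : 0 < lambda `^ q by exact: powR_gt0.
have hH := integral_h gI.
have AL0 : 0 <= L * Ac by rewrite mulr_ge0 ?(le_trans ler01).
have H0 : 0 <= I / lambda `^ q by rewrite divr_ge0// ltW.
have level_set_cst0 : 0 <= level_set_cst.
  rewrite /level_set_cst mulr_ge0// ?le_max ?ler01//.
  by rewrite addr_ge0// ln_ge0//; have := Cn1; lra.
set E0 := [set x | _].
have mE0 : measurable E0 by exact: measurable_level.
pose bad := bad_sets mu w h.
have mbad : measurable bad by exact: measurable_bad_sets.
(* bounded pieces have finite [w]-measure, as [level_set_bound] requires *)
pose ball N : set Rn := eball (0 : 'rV[R]_n) N%:R.
have mball N : measurable (ball N) by exact: measurable_eball.
have -> : E0 = \bigcup_N (E0 `&` ball N) by rewrite -setI_bigcupr bigcup_eball setIT.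
apply: weighted_bigcup_le => //.
- by move=> N; exact: measurableI.
- move=> N M NM; apply/subsetPset; apply: setIS; apply/subsetPset.
  exact: eball_nondecreasing.
move=> N; pose E := (E0 `&` ball N) `\` bad.
have mE : measurable E by apply: measurableD => //; exact: measurableI.
have bN : balls (ball N.+1) by exists 0, N.+1%:R; split => //; rewrite ltr0n.
have EN : E `<=` ball N.+1.
  move=> x [[_ bx] _]; suff : (ball N `<=` ball N.+1)%classic by exact.
  by apply/subsetPset; exact: eball_nondecreasing.
have muE : (mu E < +oo)%E.
  have /andP[_] := mu_balls bN; apply: le_lt_trans.
  by apply: le_measure; rewrite ?inE.
have wEy : (weighted mu w E < +oo)%E.
  by apply: le_lt_trans (wB bN); exact: le_weighted.
have [V wE] : exists V : R, weighted mu w E = V%:E.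
  exists (fine (weighted mu w E)); rewrite fineK// ge0_fin_numE//.
  exact: weighted_ge0.
have le_V : V <= level_set_cst * L * Ac * (I / lambda `^ q).
  apply: (level_set_bound mE muE wE gI).
  - by move=> alpha Q x sa gQ Qx [_ nbad]; exact: not_bad sa gQ Qx nbad.
  - by move=> x [[/= /ltW]].
rewrite gI -EFinM.
apply: (@le_trans _ _ (weighted mu w bad + weighted mu w E)%E).
  have := @weighted_cover _ _ mu w ww [:: bad; E] (E0 `&` ball N).
  rewrite !big_cons big_nil adde0; apply.
  - exact: measurableI.
  - by move=> P; rewrite !inE => /orP[]/eqP->.
  - move=> x Ex; have [bx|nbx] := pselect (bad x).
      by exists bad => //; rewrite mem_head.
    by exists E => //; rewrite !inE eqxx orbT.
have := weighted_bad_sets n0 mu_balls ww mh h0 hH.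
rewrite -/bad wE => le_bad.
apply: le_trans (leeD le_bad (lexx _)) _; rewrite -EFinD lee_fin.
have : 3 ^+ n * (I / lambda `^ q) <= 3 ^+ n * (L * Ac) * (I / lambda `^ q).
  rewrite ler_wpM2r// ler_peMr ?exprn_ge0//.
  by rewrite -[leLHS]mulr1 ler_pM.
rewrite /weak_cst.
have -> : (3 ^+ n + level_set_cst) * L * Ac / lambda `^ q * I =
  3 ^+ n * (L * Ac) * (I / lambda `^ q) + level_set_cst * L * Ac * (I / lambda `^ q) by ring.
by move=> le1; exact: lerD.
Qed.

End WeakBound.

(** * Extension by density *)

Section Sequences.
Context {R : realType}.

Lemma cvg_of_summable_steps (a : R^nat) (J : nat) :
  (forall j, (J <= j)%N -> `|a j.+1 - a j| <= 2^-1 ^+ j) -> cvgn a.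
Proof.
move=> steps.
suff : cvgn (fun j => a (j + J)%N).
  by move=> /cvg_ex[l al]; apply/cvg_ex; exists l; move: al; rewrite (@cvg_shiftn J _ a).
pose u j := a (j + J).+1 - a (j + J)%N.
have : cvgn [normed series u].
  apply: (@series_le_cvg _ _ (geometric 1 2^-1)).
  - by move=> j; exact: normr_ge0.
  - by move=> j; rewrite /geometric/= mul1r exprn_ge0// invr_ge0.
  - move=> j; rewrite /geometric/= mul1r; apply: le_trans (steps _ (leq_addl _ _)) _.
    by rewrite exprD ler_piMr ?exprn_ge0 ?invr_ge0// exprn_ile1 ?invr_ge0// invf_le1// ler1n.
  - apply: is_cvg_geometric_series.
    by rewrite ger0_norm ?invr_ge0// invf_lt1// ltr1n.
move=> /normed_cvg cu.
rewrite (_ : (fun j => a (j + J)%N) = (fun j => series u j + a J)).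
  by apply: is_cvgD => //; exact: is_cvg_cst.
apply/funext => j; rewrite /series/= /u.
rewrite (telescope_sumr (fun k => a (k + J)%N)) ?leq0n// add0n.
by rewrite subrK.
Qed.

End Sequences.

Section Extension.
Context {R : realType} {n : nat}.
Local Notation Rn := (euclidean R n).
Variable mu : {measure set Rn -> \bar R}.
Hypothesis mu_balls : forall B, balls B -> (0 < mu B < +oo)%E.
Variable D : set (Rn -> R).
Hypothesis tD : test_space mu D.
Variable S : (Rn -> R) -> (Rn -> R).
Variables (q r : R).
Hypothesis q1 : 1 <= q.
Hypothesis mS : forall g, D g -> measurable_fun setT (S g).
Hypothesis linS : forall (a : R) f g, D f -> D g ->
  {ae mu, forall x, S (fun x => a * f x + g x) x = a * S f x + S g x}.

Definition weak_type (w : Rn -> R) (K : R) := forall g lambda, D g -> 0 < lambda ->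
  (weighted mu w [set x | (lambda * w x `^ r < `|S g x|)%R] <=
   (K / lambda `^ q)%:E * pint mu q g)%E.

Let q0 : 0 < q. Proof. exact: lt_le_trans q1. Qed.

Lemma weighted_null w N : weight w -> measurable N -> mu N = 0%E -> weighted mu w N = 0%E.
Proof.
move=> ww mN N0; rewrite -(@integral_abs_eq0 _ _ _ mu N (EFin \o w))//.
  by apply: eq_integral => x _ /=; rewrite ger0_norm// ltW// ww.2.
by apply/measurable_EFinP; apply: measurable_funTS; exact: ww.1.
Qed.

(** Fatou's lemma: where the images converge to [H], the level set of [H] is
    contained in the lower limit of the level sets. *)
Lemma weak_limit w K (u : nat -> Rn -> R) (H : Rn -> R) lambda (M : R) J0 :
  weight w -> weak_type w K -> (forall j, D (u j)) -> measurable_fun setT H ->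
  {ae mu, forall x, S (u j) x @[j --> \oo] --> H x} -> 0 < lambda -> 0 <= K ->
  (forall j, (J0 <= j)%N -> (pint mu q (u j) <= M%:E)%E) ->
  (weighted mu w [set x | (lambda * w x `^ r < `|H x|)%R] <= (K / lambda `^ q * M)%:E)%E.
Proof.
move=> ww wK Du mH [N [mN N0 subN]] lambda0 K0 leM.
pose A j : set Rn := [set x | (lambda * w x `^ r < `|S (u j) x|)%R].
have mA j : measurable (A j) by apply: measurable_level => //; exact: mS.
pose F i : set Rn := \bigcap_(j >= i) A j.
have mF i : measurable (F i) by apply: bigcap_measurableType => j _; exact: mA.
have ndF : nondecreasing_seq F.
  move=> i j ij; apply/subsetPset => x Fx k /= jk; apply: Fx => /=.
  exact: leq_trans jk.
have bound i : (weighted mu w (F i) <= (K / lambda `^ q * M)%:E)%E.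
  apply: (@le_trans _ _ (weighted mu w (A (maxn i J0)))).
    by apply: le_weighted => // x; apply => /=; rewrite leq_maxl.
  apply: le_trans (wK _ _ (Du _) lambda0) _; rewrite [leRHS]EFinM.
  apply: lee_wpmul2l; first by rewrite lee_fin divr_ge0// powR_ge0.
  by apply: leM; rewrite leq_maxr.
have le_U := weighted_bigcup_le ww mF ndF bound.
have mU : measurable (\bigcup_i F i) by exact: bigcupT_measurable.
have := @weighted_cover _ _ mu w ww [:: \bigcup_i F i; N]
  [set x | (lambda * w x `^ r < `|H x|)%R].
rewrite !big_cons big_nil adde0 (weighted_null ww mN N0) adde0 => le_cover.
apply: le_trans (le_cover _ _ _) le_U.
- exact: measurable_level.
- by move=> P; rewrite !inE => /orP[]/eqP->.
move=> x Hx; have [Nx|Nx] := pselect (N x).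
  by exists N => //; rewrite !inE eqxx orbT.
exists (\bigcup_i F i); first by rewrite mem_head.
have cx : S (u j) x @[j --> \oo] --> H x.
  by apply: contrapT => ncx; apply: Nx; exact: subN.
have : `|S (u j) x| @[j --> \oo] --> `|H x| by exact: cvg_norm.
move=> /cvgr_gt /(_ _ Hx)[J _ JP].
by exists J => // j /= /JP.
Qed.

Lemma ae_eq0_of_weak (H : Rn -> R) : measurable_fun setT H ->
  (forall lambda, 0 < lambda ->
    (weighted mu (fun=> 1%R) [set x | (lambda * 1 `^ r < `|H x|)%R] <= 0)%E) ->
  {ae mu, forall x, H x = 0}.
Proof.
move=> mH small.
have small_ae k : {ae mu, forall x, `|H x| <= k.+1%:R^-1}.
  have m1 := measurable_level r k.+1%:R^-1 weight1 mH.
  exists [set x | (k.+1%:R^-1 * 1 `^ r < `|H x|)%R]; split => //.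
    apply/eqP; rewrite eq_le measure_ge0 andbT -weighted1//.
    by apply: small; rewrite invr_gt0.
  by move=> x /= /negP; rewrite -ltNge powR1 mulr1.
have : {ae mu, forall x, forall k : nat, `|H x| <= k.+1%:R^-1} by exact: ae_foralln.
apply: filterS => x le_k; apply/eqP; rewrite -normr_eq0 eq_le normr_ge0 andbT.
rewrite leNgt; apply/negP => Hx.
have := le_k (Num.truncn `|H x|^-1); rewrite leNgt => /negP; apply.
by rewrite invf_plt ?posrE// truncnS_gt.
Qed.

Variable K1 : R.
Hypothesis K10 : 0 <= K1.
Hypothesis weak1 : weak_type (fun=> 1) K1.

Lemma null_limit (u : nat -> Rn -> R) (H : Rn -> R) :
  (forall j, D (u j)) -> measurable_fun setT H ->
  {ae mu, forall x, S (u j) x @[j --> \oo] --> H x} ->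
  (forall e : R, 0 < e -> exists J, forall j, (J <= j)%N -> (pint mu q (u j) <= e%:E)%E) ->
  {ae mu, forall x, H x = 0}.
Proof.
move=> Du mH uH u0; apply: ae_eq0_of_weak => // lambda lambda0.
apply/lee_addgt0Pr => e e0; rewrite add0e.
have k0 : 0 < K1 / lambda `^ q + 1 by rewrite ltr_wpDl// divr_ge0// powR_ge0.
have [J leJ] := u0 (e / (K1 / lambda `^ q + 1)) (divr_gt0 e0 k0).
apply: le_trans (weak_limit weight1 weak1 Du mH uH lambda0 K10 leJ) _.
by rewrite lee_fin mulrCA ler_piMr ?(ltW e0)// ler_pdivrMr// mul1r lerDl.
Qed.

(** The approximating sequence is not required to converge fast, and [H] is
    determined up to null sets by [extension_unique]. *)
Definition is_extension (f H : Rn -> R) := measurable_fun setT H /\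
  exists g : nat -> Rn -> R, [/\ forall j, D (g j),
    forall e : R, 0 < e -> exists J, forall j, (J <= j)%N ->
      (pint mu q (fun x => f x - g j x)%R <= e%:E)%E &
    {ae mu, forall x, S (g j) x @[j --> \oo] --> H x}].

Lemma D_lin a f g : D f -> D g -> D (fun x => a * f x + g x).
Proof. by move=> Df Dg; have [_ + _] := tD; exact. Qed.

Lemma ae_cvg_lin (a : R) (f g : nat -> Rn -> R) (H1 H2 : Rn -> R) :
  (forall j, D (f j)) -> (forall j, D (g j)) ->
  {ae mu, forall x, S (f j) x @[j --> \oo] --> H1 x} ->
  {ae mu, forall x, S (g j) x @[j --> \oo] --> H2 x} ->
  {ae mu, forall x, S (fun x => a * f j x + g j x) x @[j --> \oo] --> a * H1 x + H2 x}.
Proof.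
move=> Df Dg fH gH.
have : {ae mu, forall x, forall j, S (fun x => a * f j x + g j x) x = a * S (f j) x + S (g j) x}.
  by apply: ae_foralln => j; exact: linS.
apply: filterS3 fH gH => x fx gx eqx.
under eq_fun do rewrite eqx.
by apply: cvgD => //; apply: cvgM => //; exact: cvg_cst.
Qed.

Lemma small_lin (a : R) (f g : nat -> Rn -> R) :
  (forall j, measurable_fun setT (f j)) -> (forall j, measurable_fun setT (g j)) ->
  (forall e : R, 0 < e -> exists J, forall j, (J <= j)%N -> (pint mu q (f j) <= e%:E)%E) ->
  (forall e : R, 0 < e -> exists J, forall j, (J <= j)%N -> (pint mu q (g j) <= e%:E)%E) ->
  (forall e : R, 0 < e -> exists J, forall j, (J <= j)%N ->
     (pint mu q (fun x => a * f j x + g j x)%R <= e%:E)%E).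
Proof.
move=> mf mg f0 g0 e e0.
have c0 : 0 < 2 `^ q * (`|a| `^ q + 1) :> R.
  by rewrite mulr_gt0 ?powR_gt0// ltr_wpDl ?powR_ge0.
have [J1 J1P] := f0 _ (divr_gt0 e0 c0); have [J2 J2P] := g0 _ (divr_gt0 e0 c0).
exists (maxn J1 J2) => j; rewrite geq_max => /andP[/J1P le1 /J2P le2].
apply: le_trans (pint_lin mu a (ltW q0) (mf j) (mg j)) _.
set d := e / _ in le1 le2.
apply: (@le_trans _ _ ((2 `^ q)%:E * ((`|a| `^ q)%:E * d%:E + d%:E))%E).
  apply: lee_wpmul2l; first by rewrite lee_fin powR_ge0.
  apply: leeD; last exact: le2.
  by apply: lee_wpmul2l; [rewrite lee_fin powR_ge0|exact: le1].
rewrite -EFinM lee_fin.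
have -> : 2 `^ q * (`|a| `^ q * d + d) = d * (2 `^ q * (`|a| `^ q + 1)) by ring.
by rewrite /d divfK// gt_eqF.
Qed.

(** The difference of both sides is the limit of images of test functions that
    tend to zero. The case of one function is uniqueness. *)
Lemma extension_lin a f1 f2 H1 H2 H3 : measurable_fun setT f1 -> measurable_fun setT f2 ->
  is_extension f1 H1 -> is_extension f2 H2 ->
  is_extension (fun x => a * f1 x + f2 x) H3 ->
  {ae mu, forall x, H3 x = a * H1 x + H2 x}.
Proof.
move=> mf1 mf2 [mH1 [g1 [D1 c1 l1]]] [mH2 [g2 [D2 c2 l2]]] [mH3 [g3 [D3 c3 l3]]].
have mD g : D g -> measurable_fun setT g by move=> /(test_Lp mu_balls tD q1)[].
pose u j x := -1 * g3 j x + (a * g1 j x + g2 j x).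
pose H x := -1 * H3 x + (a * H1 x + H2 x).
have mlin (b : R) (k1 k2 : Rn -> R) : measurable_fun setT k1 -> measurable_fun setT k2 ->
    measurable_fun setT (fun x => b * k1 x + k2 x).
  by move=> mk1 mk2; apply: measurable_funD => //; exact: measurable_funM.
have : {ae mu, forall x, H x = 0}.
  apply: (@null_limit u).
  - by move=> j; do 2 apply: D_lin => //.
  - by apply: (mlin (-1)) => //; exact: mlin.
  - have l12 := ae_cvg_lin a D1 D2 l1 l2.
    have D12 j : D (fun x => a * g1 j x + g2 j x) by exact: D_lin.
    exact: (ae_cvg_lin (-1) D3 D12 l3 l12).
  - move=> e e0.
    have m1 j : measurable_fun setT (fun x => f1 x - g1 j x).
      by apply: measurable_funB => //; exact: mD.
    have m2 j : measurable_fun setT (fun x => f2 x - g2 j x).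
      by apply: measurable_funB => //; exact: mD.
    have m3 j : measurable_fun setT (fun x => a * f1 x + f2 x - g3 j x).
      by apply: measurable_funB; [exact: mlin|exact: mD].
    have c12 := small_lin a m1 m2 c1 c2.
    have [J JP] := small_lin (-1) (fun j => mlin a _ _ (m1 j) (m2 j)) m3 c12 c3 e0.
    exists J => j /JP; apply: le_trans; rewrite le_eqVlt; apply/orP; left; apply/eqP.
    apply: eq_integral => x _; congr (_ `^ _)%:E; congr `|_|.
    by rewrite /u; ring.
by apply: filterS => x; rewrite /H => Hx; lra.
Qed.

Lemma pint_sub_diag f : pint mu q (fun x => f x - f x) = 0%E.
Proof.
rewrite /pint integral0_eq// => x _; rewrite subrr normr0 powR0//.
by rewrite gt_eqF.
Qed.

Lemma is_extension_test f : D f -> is_extension f (S f).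
Proof.
move=> Df; split; first exact: mS.
exists (fun=> f); split => //.
- by move=> e e0; exists 0%N => j _; rewrite pint_sub_diag lee_fin ltW.
- by apply: aeW => x; exact: cvg_cst.
Qed.

Lemma extension_unique f H1 H2 : measurable_fun setT f ->
  is_extension f H1 -> is_extension f H2 -> {ae mu, forall x, H1 x = H2 x}.
Proof.
move=> mf e1 e2.
have e0 : is_extension (fun x => 0 * f x + f x) H1.
  rewrite (_ : (fun x => 0 * f x + f x) = f)//.
  by apply/funext => x; rewrite mul0r add0r.
apply: filterS (extension_lin mf mf e2 e2 e0) => x ->.
by rewrite mul0r add0r.
Qed.

(** Test functions that approximate [f] fast have images whose successive
    differences exceed [2^-j] only on a set of measure [2^-(j+1)]; by
    Borel-Cantelli the images converge almost everywhere. *)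
Lemma extension_exists f : measurable_fun setT f -> (pint mu q f < +oo)%E ->
  exists H, is_extension f H.
Proof.
move=> mf fq.
have h0 (j : nat) : 0 < 2^-1 ^+ j :> R by rewrite exprn_gt0// invr_gt0.
(* chosen so that the weak bound at height [2^-j] gives at most [2^-(j+1)];
   the last two factors come from the quasi-triangle inequality *)
pose e j : R := 2^-1 ^+ j.+1 * (2^-1 ^+ j) `^ q / ((K1 + 1) * 2 `^ q * 2).
have c0 : 0 < (K1 + 1) * 2 `^ q * 2 by rewrite !mulr_gt0 ?powR_gt0// ltr_wpDl.
have e0 j : 0 < e j by rewrite divr_gt0// mulr_gt0// powR_gt0.
have e_dec j : e j.+1 <= e j.
  rewrite ler_wpM2r ?invr_ge0 ?(ltW c0)// ler_pM ?powR_ge0 ?(ltW (h0 _))//.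
    by rewrite exprS ler_piMl ?(ltW (h0 _))// invf_le1// ler1n.
  apply: ge0_ler_powR; rewrite ?nnegrE ?(ltW q0) ?(ltW (h0 _))//.
  by rewrite exprS ler_piMl ?(ltW (h0 _))// invf_le1// ler1n.
have e_le j : e j <= 2^-1 ^+ j.
  have a1 : 2^-1 ^+ j.+1 <= 2^-1 ^+ j :> R.
    by rewrite exprS ler_piMl ?(ltW (h0 _))// invf_le1// ler1n.
  have b1 : (2^-1 ^+ j) `^ q <= 1 :> R.
    have le1 : (2^-1 ^+ j) `^ q <= 1 `^ q :> R.
      apply: ge0_ler_powR; rewrite ?nnegrE ?(ltW q0) ?(ltW (h0 _))//.
      by rewrite exprn_ile1 ?invr_ge0// invf_le1// ler1n.
    by rewrite powR1 in le1.
  have c1 : 1 <= (K1 + 1) * 2 `^ q * 2.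
    have p1 : 1 <= 2 `^ q :> R by rewrite -[leLHS](powRr0 2) ler_powR ?ler1n ?(ltW q0).
    have : 1 <= (K1 + 1) * 2 `^ q by rewrite -[leLHS]mulr1 ler_pM// lerDr.
    lra.
  rewrite ler_pdivrMr//; apply: (@le_trans _ _ (2^-1 ^+ j * 1)).
    by rewrite ler_pM ?powR_ge0 ?(ltW (h0 _)).
  by rewrite ler_wpM2l ?(ltW (h0 _)).
have approx j : exists g, D g /\ (pint mu q (fun x => f x - g x)%R < (e j)%:E)%E.
  by have [g Dg lt] := test_dense mu_balls tD q1 mf fq (e0 j); exists g.
have [g gP] := choice approx.
have Dg j : D (g j) by have [] := gP j.
have mg j : measurable_fun setT (g j) by have [] := test_Lp mu_balls tD q1 (Dg j).
have mfg j : measurable_fun setT (fun x => f x - g j x) by exact: measurable_funB.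
pose v j x := -1 * g j x + g j.+1 x.
have Dv j : D (v j) by exact: D_lin.
have le_v j : (pint mu q (v j) <= (2 `^ q * (2 * e j))%:E)%E.
  have -> : pint mu q (v j) = pint mu q (fun x => -1 * (f x - g j.+1 x) + (f x - g j x)).
    by apply: eq_integral => x _; congr (_ `^ _)%:E; congr `|_|; rewrite /v; ring.
  apply: le_trans (pint_lin mu _ (ltW q0) (mfg _) (mfg _)) _; rewrite normrN1 powR1 mul1e EFinM.
  apply: lee_wpmul2l; first by rewrite lee_fin powR_ge0.
  have -> : 2 * e j = e j + e j by ring.
  rewrite EFinD; apply: leeD; last by have [_ /ltW] := gP j.
  by have [_ /ltW /le_trans] := gP j.+1; apply; rewrite lee_fin.
pose A j : set Rn := [set x | (2^-1 ^+ j * 1 `^ r < `|S (v j) x|)%R].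
have mA j : measurable (A j) by apply: (measurable_level (w := fun=> 1)) => //; exact: mS.
have le_A j : (mu (A j) <= (1 / (2 ^ j.+1)%:R)%:E)%E.
  rewrite -weighted1//; apply: le_trans (weak1 (Dv j) (h0 j)) _.
  apply: (@le_trans _ _ ((K1 / (2^-1 ^+ j) `^ q)%:E * (2 `^ q * (2 * e j))%:E)%E).
    by apply: lee_wpmul2l => //; rewrite lee_fin divr_ge0// powR_ge0.
  rewrite -EFinM lee_fin natrX div1r -exprVn /e.
  have k0 : K1 + 1 != 0 by rewrite gt_eqF// ltr_wpDl.
  have p1 : (2^-1 ^+ j) `^ q != 0 :> R by rewrite gt_eqF// powR_gt0.
  have p2 : 2 `^ q != 0 :> R by rewrite gt_eqF// powR_gt0.
  have -> : K1 / (2^-1 ^+ j) `^ q * (2 `^ q * (2 * (2^-1 ^+ j.+1 * (2^-1 ^+ j) `^ q /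
      ((K1 + 1) * 2 `^ q * 2)))) = 2^-1 ^+ j.+1 * (K1 / (K1 + 1)).
    by field; rewrite k0 p1 p2.
  rewrite ler_piMr ?(ltW (h0 _))// ler_pdivrMr ?ltr_wpDl// mul1r.
  by rewrite lerDl.
have sumA : (\sum_(j <oo) mu (A j) < +oo)%E.
  apply: (@le_lt_trans _ _ (\sum_(j <oo) (0 + (1 / (2 ^ j.+1)%:R)%:E))%E).
    by apply: lee_nneseries => // j _; rewrite add0e.
  apply: le_lt_trans (epsilon_trick _ _ _) _ => //.
  by rewrite eseries0// add0e ltry.
have BC := lim_sup_set_cvg0 mA sumA.
have BC_ae : {ae mu, forall x, ~ lim_sup_set A x}.
  exists (lim_sup_set A); split => //.
    apply: bigcapT_measurable => i; apply: bigcup_measurable => j _; exact: mA.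
  by move=> x /= /contrapT.
have lin_ae : {ae mu, forall x, forall j, S (v j) x = -1 * S (g j) x + S (g j.+1) x}.
  by apply: ae_foralln => j; exact: linS.
(* the upper limit is measurable whether or not the sequence converges *)
pose H x := fine (limn_esup (fun j => (S (g j) x)%:E)).
exists H; split.
  apply: measurableT_comp => //; apply: measurable_fun_limn_esup => j.
  by apply/measurable_EFinP; exact: mS.
exists g; split => //.
- move=> d d0; exists (Num.truncn d^-1).+1 => j Jj.
  have [_ /ltW /le_trans] := gP j; apply; rewrite lee_fin.
  apply: le_trans (e_le j) _; rewrite exprVn -[d]invrK lef_pV2 ?posrE ?invr_gt0 ?exprn_gt0//.
  apply: le_trans (ltW (truncnS_gt _)) _; rewrite -natrX ler_nat.
  exact: leq_trans Jj (ltnW (ltn_expl j _)).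
- apply: filterS2 BC_ae lin_ae => x nA lin.
  have [J JP] : exists J : nat, forall j, (J <= j)%N -> `|S (g j.+1) x - S (g j) x| <= 2^-1 ^+ j.
    move: nA; rewrite /lim_sup_set => /existsNP[J] /not_implyP[_ nJ].
    exists J => j Jj; rewrite leNgt; apply/negP => lt; apply: nJ; exists j => //=.
    by rewrite /A /= powR1 mulr1 lin mulN1r addrC.
  have /cvg_ex[l cl] := cvg_of_summable_steps JP.
  suff -> : H x = l by [].
  rewrite /H (_ : limn_esup _ = l%:E)//.
  have ecl : (S (g j) x)%:E @[j --> \oo] --> l%:E by apply: cvg_EFin => //; exact: nearW.
  by have [_ ->] := cvg_limn_einf_sup ecl.
Qed.

Lemma pint_tail f (g : nat -> Rn -> R) (d : R) : measurable_fun setT f ->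
  (forall j, D (g j)) -> (pint mu q f < +oo)%E -> 0 < d ->
  (forall e : R, 0 < e -> exists J, forall j, (J <= j)%N ->
      (pint mu q (fun x => f x - g j x)%R <= e%:E)%E) ->
  exists J, forall j, (J <= j)%N ->
    (pint mu q (g j) <= ((fine (pint mu q f) `^ q^-1 + d) `^ q)%:E)%E.
Proof.
move=> mf Dg fq d0 c.
have [F F0 fE] := pint_fin fq; rewrite fE /=.
have [J JP] := c _ (powR_gt0 q d0); exists J => j Jj.
have [mg gq] := test_Lp mu_balls tD q1 (Dg j).
have mfg : measurable_fun setT (fun x => g j x - f x) by exact: measurable_funB.
have le_e : (pint mu q (fun x => g j x - f x)%R <= (d `^ q)%:E)%E.
  suff -> : pint mu q (fun x => g j x - f x)%R = pint mu q (fun x => f x - g j x)%R by exact: JP.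
  by apply: eq_integral => x _; rewrite distrC.
have [G G0 gE] := pint_fin gq.
have [E E0 eE] := pint_fin (le_lt_trans le_e (ltry _)).
rewrite eE lee_fin in le_e.
have := @minkowski_EFin _ _ _ mu f (fun x => g j x - f x) q mf mfg q1.
rewrite !LnormE (_ : pint mu q (f \+ (fun x => g j x - f x))%R = pint mu q (g j)); last first.
  by apply: eq_integral => x _ /=; rewrite addrC subrK.
rewrite fE gE eE !poweR_EFin -EFinD !lee_fin => le_G.
have E_d : E `^ q^-1 <= d.
  rewrite -[leRHS]powRr1 ?(ltW d0)// -(mulfV (lt0r_neq0 q0)) powRrM.
  by apply: ge0_ler_powR; rewrite ?nnegrE ?invr_ge0 ?powR_ge0 ?(ltW q0).
rewrite -[leLHS]powRr1// -(mulVf (lt0r_neq0 q0)) powRrM.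
apply: ge0_ler_powR; rewrite ?nnegrE ?addr_ge0 ?powR_ge0 ?(ltW q0) ?(ltW d0)//.
by apply: le_trans le_G _; rewrite lerD2l.
Qed.

(** The norms of the approximants tend to that of [f], so the weak bound
    passes to the limit with the same constant. *)
Lemma extension_weak f H w K lambda : measurable_fun setT f -> (pint mu q f < +oo)%E ->
  is_extension f H -> weight w -> weak_type w K -> 0 <= K -> 0 < lambda ->
  (lambda%:E * (weighted mu w [set x | (lambda * w x `^ r < `|H x|)%R]) `^ q^-1 <=
   (K `^ q^-1)%:E * (pint mu q f) `^ q^-1)%E.
Proof.
move=> mf fq [mH [g [Dg c l]]] ww wK K0 lambda0.
have [F F0 fE] := pint_fin fq.
have lq : lambda `^ q `^ q^-1 = lambda.
  by rewrite -powRrM mulfV ?lt0r_neq0// powRr1// ltW.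
rewrite fE poweR_EFin; apply/lee_addgt0Pr => e e0.
pose d := e / (K `^ q^-1 + 1).
have k0 : 0 < K `^ q^-1 + 1 by rewrite ltr_wpDl ?powR_ge0.
have d0 : 0 < d by exact: divr_gt0.
have [J JP] := pint_tail mf Dg fq d0 c.
have := weak_limit ww wK Dg mH l lambda0 K0 JP.
rewrite fE /=; set M := F `^ q^-1 + d => le_W.
have M0 : 0 <= M by rewrite addr_ge0 ?powR_ge0 ?(ltW d0).
have [V [V0 VE]] : exists V : R, 0 <= V /\
    weighted mu w [set x | (lambda * w x `^ r < `|H x|)%R] = V%:E.
  have W0 := weighted_ge0 mu ww [set x | (lambda * w x `^ r < `|H x|)%R].
  exists (fine (weighted mu w [set x | (lambda * w x `^ r < `|H x|)%R])).
  split; first exact: fine_ge0.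
  by rewrite fineK// ge0_fin_numE//; apply: le_lt_trans le_W (ltry _).
rewrite VE poweR_EFin -!EFinM -EFinD lee_fin; rewrite VE lee_fin in le_W.
have : lambda * V `^ q^-1 <= K `^ q^-1 * M.
  rewrite -{1}lq -powRM ?powR_ge0// -[M]powRr1// -(mulfV (lt0r_neq0 q0)) powRrM.
  rewrite -powRM ?powR_ge0//.
  apply: ge0_ler_powR; rewrite ?nnegrE ?invr_ge0 ?mulr_ge0 ?powR_ge0 ?(ltW q0)//.
  apply: le_trans (ler_wpM2l (powR_ge0 _ _) le_W) _.
  have lq0 : lambda `^ q != 0 by rewrite gt_eqF// powR_gt0.
  suff -> : lambda `^ q * (K / lambda `^ q * M `^ q) = K * M `^ q by [].
  by field.
move=> /le_trans; apply; rewrite /M mulrDr lerD2l /d mulrCA.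
by rewrite ler_piMr ?(ltW e0)// ler_pdivrMr// mul1r lerDl.
Qed.

Lemma extension_null f H : measurable_fun setT f -> pint mu q f = 0%E ->
  is_extension f H -> {ae mu, forall x, H x = 0}.
Proof.
move=> mf f0 fH; have [mH _] := fH; apply: ae_eq0_of_weak => // lambda lambda0.
have fq : (pint mu q f < +oo)%E by rewrite f0 ltry.
have := extension_weak mf fq fH weight1 weak1 K10 lambda0.
rewrite f0 poweR0r ?invr_eq0 ?lt0r_neq0// mule0.
set W := weighted _ _ _ => le0.
have W0 : (0 <= W)%E by exact: (weighted_ge0 mu weight1).
rewrite leNgt; apply/negP => W_gt0; move: le0; rewrite leNgt => /negP; apply.
by rewrite mule_gt0 ?lte_fin// poweR_gt0.
Qed.

End Extension.

(** * The dual operator *)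

Section DualExtension.
Context {R : realType} {n : nat}.
Local Notation Rn := (euclidean R n).
Variable mu : {measure set Rn -> \bar R}.
Hypothesis n0 : (0 < n)%N.
Hypothesis mu_balls : forall B, balls B -> (0 < mu B < +oo)%E.
Variable C : R.
Hypothesis C1 : 1 <= C.
Hypothesis muC : doubling_with mu C.
Variables (eta p0 s0 t : R).
Hypotheses (eta0 : 0 < eta) (p01 : 1 <= p0) (s00 : 0 <= s0).
Hypotheses (s0t : s0 < t) (tp0 : t < p0^-1).
Local Notation q := ((1 - s0)^-1).
Local Notation p' := ((1 - t)^-1).
Variables (D : set (Rn -> R)) (T S : (Rn -> R) -> (Rn -> R)) (cT : R).
Hypothesis tD : test_space mu D.
Hypothesis cT0 : 0 < cT.
Variable q0' : \bar R.
Hypothesis q0'E : hoelder_conjugate q0' = q%:E.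
Hypothesis sT : sparse_dominated mu D p0%:E q0' T cT eta.
Hypothesis SLp : forall g, D g -> measurable_fun setT (S g) /\ (pint mu p' (S g) < +oo)%E.
Hypothesis dual : forall f g, D f -> D g -> pairing mu (T f) g = pairing mu f (S g).
Local Notation W := (Num.max 1 (weak_cst (n := n) C eta p0 s0 cT)).

Let t0 : 0 < t. Proof. exact: le_lt_trans s0t. Qed.
Let tau1 : p0^-1 <= 1. Proof. by rewrite invf_le1// (lt_le_trans ltr01). Qed.
Let t1 : t < 1. Proof. exact: lt_le_trans tau1. Qed.
Let s0p : 0 < 1 - s0. Proof. by rewrite subr_gt0 (lt_trans s0t). Qed.
Let q_gt0 : 0 < q. Proof. by rewrite invr_gt0. Qed.
Let q_ge1 : 1 <= q. Proof. by rewrite invf_ge1// lerBlDr lerDl. Qed.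
Let p'_gt0 : 0 < p'. Proof. by rewrite invr_gt0 subr_gt0. Qed.
Let p'_ge1 : 1 <= p'.
Proof. by rewrite invf_ge1 ?subr_gt0// lerBlDr lerDl ltW. Qed.
Let p_ge1 : 1 <= t^-1. Proof. by rewrite invf_ge1// ltW. Qed.
Let pp' : t^-1^-1 + p'^-1 = 1. Proof. by rewrite !invrK addrC subrK. Qed.
Let W0 : 0 < W. Proof. by rewrite lt_max ltr01. Qed.

Let mS g : D g -> measurable_fun setT (S g). Proof. by move=> /SLp[]. Qed.

(** The weight 1 is the one through which unweighted estimates are read off
    the weighted ones. *)
Lemma A1_const1 : (A1_const mu (fun=> 1%R) < +oo)%E.
Proof.
apply: (@le_lt_trans _ _ 1%E); last exact: ltry.
apply: ge_ereal_sup => _ [Q [alpha sa gQ] <-].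
have [mQ /[dup] Q0y /andP[Q0 Qy]] := dyadic_cube_mass n0 mu_balls gQ.
rewrite (average1E weight1 Q0y) (weighted1 _ mQ).
have muQ : mu Q = (fine (mu Q))%:E by rewrite fineK// ge0_fin_numE// ltW.
have m0 : 0 < fine (mu Q) by rewrite fine_gt0// Q0.
have -> : ((mu Q)^-1 * mu Q)%E = 1%E.
  by rewrite muQ inver gt_eqF// -EFinM mulVf// gt_eqF.
rewrite mul1e.
have : (1 <= ess_inf_on mu Q (EFin \o (fun=> 1%R)))%E.
  by apply: ereal_sup_ubound; apply: aeW.
case: (ess_inf_on _ _ _) => [e| |]//.
  rewrite lee_fin => e1; have e0 : 0 < e by exact: lt_le_trans e1.
  by rewrite inver gt_eqF// lee_fin invf_le1.
by rewrite invey.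
Qed.

Lemma pairing_lin phi f g a :
  mu.-integrable setT (fun x => (phi x * f x)%:E) ->
  mu.-integrable setT (fun x => (phi x * g x)%:E) ->
  (pairing mu phi (fun x => a * f x + g x)%R = a%:E * pairing mu phi f + pairing mu phi g)%E.
Proof.
move=> pf pg; rewrite /pairing -integralZl// -integralD//; last exact: integrableZl.
by apply: eq_integral => x _; rewrite -EFinM -EFinD; congr EFin; ring.
Qed.

(** The defect of linearity represents the zero functional on test functions,
    hence vanishes by the weak bound for [g = 0]. *)
Lemma dual_linear a f g : D f -> D g ->
  {ae mu, forall x, S (fun x => a * f x + g x) x = a * S f x + S g x}.
Proof.
move=> Df Dg; have Dh : D (fun x => a * f x + g x) by exact: (D_lin tD).
have D0 : D (fun=> 0) by have [] := tD.
have [mf fp] := SLp Df; have [mg gp] := SLp Dg; have [mh hp] := SLp Dh.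
pose k x := a * S f x + S g x.
have mk : measurable_fun setT k.
  by apply: measurable_funD => //; exact: measurable_funM.
have kp : (pint mu p' k < +oo)%E by apply: pint_lin_lty => //; exact: ltW.
pose u x := -1 * k x + S (fun x => a * f x + g x) x.
have mu_ : measurable_fun setT u.
  by apply: measurable_funD => //; exact: measurable_funM.
have up : (pint mu p' u < +oo)%E by apply: pint_lin_lty => //; exact: ltW.
have du phi : D phi -> pairing mu (T phi) (fun=> 0) = pairing mu phi u.
  move=> Dphi; have [mphi phip] := test_Lp mu_balls tD p_ge1 Dphi.
  have t0V : 0 < t^-1 by rewrite invr_gt0.
  have intS v : measurable_fun setT v -> (pint mu p' v < +oo)%E ->
      mu.-integrable setT (fun x => (phi x * v x)%:E).
    by move=> mv vp; exact: (integrable_holder t0V p'_gt0 pp').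
  have intT v : D v -> mu.-integrable setT (fun x => (T phi x * v x)%:E).
    by move=> Dv; have [] := sT Dphi Dv.
  rewrite /u (pairing_lin _ (intS _ mk kp) (intS _ mh hp)).
  rewrite /k (pairing_lin _ (intS _ mf fp) (intS _ mg gp)).
  rewrite -!dual// (pairing_lin _ (intT _ Df) (intT _ Dg)).
  rewrite -(pairing_lin _ (intT _ Df) (intT _ Dg)).
  rewrite -(pairing_lin _ (intT _ Dh) (intT _ Dh)).
  by apply: eq_integral => x _; congr EFin; ring.
have u0 : {ae mu, forall x, u x = 0}.
  apply: (@ae_eq0_of_weak _ _ mu (1 - s0)) => // lambda lambda0.
  have Ay1 : (Ainfty_const mu (fun=> 1%R) < +oo)%E by have [] := Ainfty1 mu_balls.
  apply: le_trans (weak_bound n0 mu_balls C1 muC eta0 p01 s00 s0t tp0 tD cT0 q0'E sT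
    D0 mu_ up du weight1 A1_const1 Ay1 lambda0) _.
  rewrite (_ : pint mu q (fun=> 0) = 0%E) ?mule0//.
  by apply: integral0_eq => x _; rewrite normr0 powR0// gt_eqF.
by apply: filterS u0 => x; rewrite /u /k => ux; lra.
Qed.

Definition weight_cst w : R :=
  W * ln (expR 1 + fine (A1_const mu w)) * fine (Ainfty_const mu w).

Lemma Ainfty_const_ge0 w : weight w -> (0 <= Ainfty_const mu w)%E.
Proof.
move=> ww; apply: le_trans (ereal_sup_ubound _); last first.
  by exists (eball 0 1) => //; exists 0, 1.
rewrite mule_ge0 ?inve_ge0 ?(weighted_ge0 mu ww)//.
by apply: integral_ge0 => x _; exact: maximal_ge0.
Qed.

Lemma weight_cst_ge0 w : weight w -> 0 <= weight_cst w.
Proof.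
move=> ww; have L1 := ln_A1_ge1 mu ww.
apply: mulr_ge0; first by apply: mulr_ge0; [exact: ltW|exact: le_trans L1].
by apply: fine_ge0; exact: Ainfty_const_ge0.
Qed.

Lemma dual_weak w : A1 mu w -> (Ainfty_const mu w < +oo)%E ->
  weak_type mu D S q (1 - s0) w (weight_cst w).
Proof.
move=> [ww A1w] Ay g lambda Dg lambda0; have [mg gp] := SLp Dg.
have dg f : D f -> pairing mu (T f) g = pairing mu f (S g) by move=> Df; exact: dual.
apply: le_trans (weak_bound n0 mu_balls C1 muC eta0 p01 s00 s0t tp0 tD cT0 q0'E sT
    Dg mg gp dg ww A1w Ay lambda0) _.
apply: lee_wpmul2r; first exact: pint_ge0.
have L0 : 0 <= ln (expR 1 + fine (A1_const mu w)) by exact: le_trans (ln_A1_ge1 mu ww).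
rewrite lee_fin ler_wpM2r ?invr_ge0 ?powR_ge0// ler_wpM2r//.
  by apply: fine_ge0; exact: Ainfty_const_ge0.
by rewrite ler_wpM2r// le_max lexx orbT.
Qed.

(** When the A_infinity constant is infinite the right-hand side is infinite,
    unless [f] vanishes almost everywhere; its image then vanishes too. *)
Lemma dual_extension : exists Text : (Rn -> R) -> (Rn -> R),
  extends_to mu D [set` Lfun mu q%:E] S Text /\
  forall w, A1 mu w -> forall f, f \in Lfun mu q%:E ->
    (weighted_weak_Lnorm mu w q (fun x => Text f x / (w x `^ q^-1))%R <=
     (W `^ (1 - s0))%:E *
       (Ainfty_const mu w * (ln (expR 1 + fine (A1_const mu w)))%:E) `^ q^-1 *
       'N[mu]_q%:E[EFin \o f])%E.
Proof.
have Ay1 : (Ainfty_const mu (fun=> 1%R) < +oo)%E by have [] := Ainfty1 mu_balls.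
have K10 := weight_cst_ge0 weight1.
have weak1 := dual_weak (conj weight1 A1_const1) Ay1.
have Lq f : f \in Lfun mu q%:E -> measurable_fun setT f /\ (pint mu q f < +oo)%E.
  rewrite inE => /andP[]; rewrite inE /= => mf; rewrite inE /= /finite_norm LnormE.
  by move=> /lty_poweRy lty; split => //; apply: lty; rewrite invrK gt_eqF.
have ext_ex f : exists H, measurable_fun setT f -> (pint mu q f < +oo)%E ->
    is_extension mu D S q f H.
  have [[mf fq]|nf] := pselect (measurable_fun setT f /\ (pint mu q f < +oo)%E).
    have [H fH] := extension_exists mu_balls tD q_ge1 mS dual_linear K10 weak1 mf fq.
    by exists H.
  by exists f => mf fq; case: nf.
have [Text TextP] := choice ext_ex.
exists Text; split.
  split; last first.
    move=> f Df; have [mf fq] := test_Lp mu_balls tD q_ge1 Df.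
    have := extension_unique mu_balls tD q_ge1 mS dual_linear K10 weak1 mf
      (TextP f mf fq) (is_extension_test mu q_ge1 mS Df).
    by apply: filterS => x + _.
  split; first by move=> f /Lq[mf fq]; have [] := TextP f mf fq.
  move=> a f g /Lq[mf fq] /Lq[mg gq].
  have mh : measurable_fun setT (fun x => a * f x + g x).
    by apply: measurable_funD => //; exact: measurable_funM.
  have hq : (pint mu q (fun x => a * f x + g x)%R < +oo)%E.
    by apply: pint_lin_lty => //; exact: ltW.
  have := extension_lin mu_balls tD q_ge1 mS dual_linear K10 weak1 mf mg
    (TextP f mf fq) (TextP g mg gq) (TextP _ mh hq).
  by apply: filterS => x + _.
move=> w A1w f /Lq[mf fq]; have [ww _] := A1w.
have fT := TextP f mf fq; have [mT _] := fT.
apply: ge_ereal_sup => _ [lambda /= lambda0 <-].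
have -> : [set x | (lambda < `|Text f x / w x `^ q^-1|)%R] =
    [set x | (lambda * w x `^ (1 - s0) < `|Text f x|)%R].
  apply/seteqP; split => x /=;
    by rewrite invrK normrM normfV (ger0_norm (powR_ge0 _ _)) ltr_pdivlMr// powR_gt0// ww.2.
have L1 := ln_A1_ge1 mu ww.
set L := ln _ in L1 *; have L0 : 0 < L by exact: lt_le_trans L1.
have Ac0 := Ainfty_const_ge0 ww.
rewrite LnormE.
have [Ay|] := ltP (Ainfty_const mu w) +oo%E.
  apply: le_trans (extension_weak mu_balls tD q_ge1 mS mf fq fT ww (dual_weak A1w Ay)
    (weight_cst_ge0 ww) lambda0) _.
  have [r r0 AcE] : exists2 r : R, 0 <= r & Ainfty_const mu w = r%:E.
    exists (fine (Ainfty_const mu w)); first exact: fine_ge0.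
    by rewrite fineK// ge0_fin_numE.
  rewrite /weight_cst -/L AcE /= -(EFinM (W `^ (1 - s0))).
  rewrite -mulrA (powRM _ (ltW W0)) ?mulr_ge0// ?(ltW L0)// invrK (mulrC L).
  exact: lexx.
rewrite leye_eq => /eqP ->.
have [f0|f0] := eqVneq (pint mu q f) 0%E.
  have := extension_null mu_balls tD q_ge1 mS K10 weak1 mf f0 fT.
  move=> [N [mN N0 subN]].
  set E := [set x | _].
  have mE : measurable E by exact: measurable_level.
  have -> : weighted mu w E = 0%E.
    apply: weighted_null => //; apply/eqP; rewrite eq_le measure_ge0 andbT -N0.
    apply: le_measure; rewrite ?inE// => x Ex; apply: subN => /= Tx0.
    move: Ex; rewrite /E /= Tx0 normr0 ltNge => /negP; apply.
    by rewrite mulr_ge0 ?powR_ge0 ?(ltW lambda0).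
  rewrite poweR0r ?invrK ?gt_eqF// mule0.
  by rewrite !mule_ge0 ?poweR_ge0// lee_fin powR_ge0.
rewrite gt0_mulye ?lte_fin// poweRyr ?invrK ?gt_eqF//.
rewrite gt0_muley ?lte_fin ?powR_gt0// gt0_mulye ?leey//.
by rewrite poweR_gt0// lt_neqAle eq_sym f0 pint_ge0.
Qed.

End DualExtension.

Lemma hoelder_conjugate_inv (R : realType) (r : R) : (1 < r)%R ->
  hoelder_conjugate r%:E = ((1 - r^-1)^-1)%:E.
Proof.
move=> r1; have r0 : (0 < r)%R by exact: lt_trans r1.
rewrite /hoelder_conjugate /= eqe gt_eqF// -EFinB inver subr_eq0 gt_eqF//.
rewrite -EFinM; congr EFin.
have r10 : (r - 1 != 0)%R by rewrite subr_eq0 gt_eqF.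
by field; rewrite r10 gt_eqF.
Qed.

(** The reciprocal [s0] of [q0], which is zero for an infinite [q0], serves as
    the only parameter for both cases. *)
Lemma exponent_conjugate (R : realType) (p0 : R) (q0 : \bar R) :
  (1 <= p0)%R -> (p0%:E < q0)%E -> exists s0 : R,
    [/\ (0 <= s0)%R, hoelder_conjugate q0 = ((1 - s0)^-1)%:E &
      forall p : R, (0 < p)%R -> (p%:E < q0)%E -> (s0 < p^-1)%R].
Proof.
move=> p01; case: q0 => [q0| |]//.
  rewrite lte_fin => p0q0; have q01 : (1 < q0)%R by exact: le_lt_trans p01 p0q0.
  have q00 : (0 < q0)%R by exact: lt_trans q01.
  exists q0^-1; split; first by rewrite invr_ge0 ltW.
    exact: hoelder_conjugate_inv.
  by move=> p pos; rewrite lte_fin => pq; rewrite ltf_pV2 ?posrE.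
move=> _; exists 0%R; split=> //.
  by rewrite hoelder_conjugatey subr0 invr1.
by move=> p pos _; rewrite invr_gt0.
Qed.

Local Open Scope ereal_scope.

Theorem theorem1p5 (R : realType) (n : nat) (p0 q0 : \bar R)
    (cT eta nu : R) :
  (0 < n)%N -> 1 <= p0 -> p0 < q0 -> (0 < cT)%R -> (0 < eta <= 1)%R ->
  exists c : R, (0 < c)%R /\
    forall (mu : {measure set (euclidean R n) -> \bar R})
      (D : set (euclidean R n -> R))
      (T Tst : (euclidean R n -> R) -> (euclidean R n -> R)),
      doubling_measure mu -> doubling_dim mu = nu ->
      test_space mu D ->
      linear_on mu D T -> sparse_dominated mu D p0 q0 T cT eta ->
      dual_operator mu D p0 q0 T Tst ->
      (* Tst, given on test functions, extends to L^{q0'} *)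
      exists Text : (euclidean R n -> R) -> (euclidean R n -> R),
        extends_to mu D [set` Lfun mu (hoelder_conjugate q0)] Tst Text /\
        forall w : euclidean R n -> R, A1 mu w ->
        forall f : euclidean R n -> R, f \in Lfun mu (hoelder_conjugate q0) ->
          let q := fine (hoelder_conjugate q0) in
          weighted_weak_Lnorm mu w q (fun x => Text f x / (w x `^ q^-1))%R
          <= c%:E *
             (Ainfty_const mu w *
              (ln (expR 1 + fine (A1_const mu w)))%:E) `^ q^-1 *
             'N[mu]_(hoelder_conjugate q0)[EFin \o f].
Proof.
move=> n0 p01 p0q0 cT0 /andP[eta0 _].
case: p0 p01 p0q0 => [p0| |]// p01 p0q0; last by rewrite ltNge leey in p0q0.
rewrite lee_fin in p01; have [s0 [s00 q0E s0P]] := exponent_conjugate p01 p0q0.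
exists (Num.max 1 (weak_cst (n := n) (2 `^ nu) eta p0 s0 cT) `^ (1 - s0))%R.
split; first by rewrite powR_gt0// lt_max ltr01.
move=> mu D T Tst dm dimE tD linT sT [p [/andP[p0p pq0] dual]].
have [C1 muC] := doubling_dimP dm; rewrite dimE in C1 muC.
case: p p0p pq0 dual => [p| |]// p0p pq0 dual; last by rewrite ltNge leey in pq0.
rewrite lte_fin in p0p.
have p1 : (1 < p)%R by exact: le_lt_trans p01 p0p.
have pos0 : (0 < p0)%R by exact: lt_le_trans p01.
have tp0 : (p^-1 < p0^-1)%R by rewrite ltf_pV2 ?posrE// (lt_trans pos0).
have s0t : (s0 < p^-1)%R by apply: s0P => //; exact: lt_trans p0p.
have SLp g : D g -> measurable_fun setT (Tst g) /\ pint mu ((1 - p^-1)^-1)%R (Tst g) < +oo.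
  move=> /dual[+ _]; rewrite (hoelder_conjugate_inv p1) inE => /andP[].
  rewrite inE /= => mf; rewrite inE /= /finite_norm LnormE => /lty_poweRy lty.
  by split => //; apply: lty; rewrite invrK subr_eq0 gt_eqF// invf_lt1// (lt_trans ltr01).
have pair f g : D f -> D g -> pairing mu (T f) g = pairing mu f (Tst g).
  by move=> Df /dual[_]; apply.
have [mu_balls _] := dm.
have := dual_extension n0 mu_balls C1 muC eta0 p01 s00 s0t tp0 tD cT0 q0E sT SLp pair.
by rewrite q0E.
Qed.
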